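(* Let $I$ be a left ideal of the Weyl algebra $D$ such that $M=D/I$ is holonomic, let $\mathcal M=\mathcal D/\mathcal D I$, let $w\in\mathbf{R}^n$ be a weight vector with $w_i>0$ for all $i$, let $d\ge0$, and let $$D^p[\mathbf{s}]\xrightarrow{\ \cdot A\ }D^q[\mathbf{t}]\xrightarrow{\ \cdot B\ }D^r[\mathbf{u}],\qquad A=\psi_{d+1},\ B=\psi_d,$$ be the part at degree $d$ of an adapted free resolution $(\psi_i)$ of $M$ associated to $w$. Let $k_1$ be the maximal integral root of the $b$-function of $M$ associated to $(-w,w)$. Let $\mathbf c^{(1)},\dots,\mathbf c^{(e)}\in\mathrm{Ker}\,\tau_{k_1}(\bar A^T)$ represent a basis of the $K$-vector space $$\frac{\mathrm{Ker}\,\tau_{k_1}(\bar A^T)}{\mathrm{Im}\,\tau_{k_1}(\bar B^T)},$$ and for each $i$ let $\mathbf c^{(i)}_\infty\in(K^{n\infty})^q[\mathbf t]$ be an extension of $\mathbf c^{(i)}$ obtained by successively extending it, degree by degree, to elements of $\mathrm{Ker}\,\tau_m(\bar A^T)$ for all integers $m\ge k_1$ (that is, $\tau_{k_1}(\mathbf c^{(i)}_\infty)=\mathbf c^{(i)}$ and $\tau_m(\mathbf c^{(i)}_\infty)\in\mathrm{Ker}\,\tau_m(\bar A^T)$ for all $m\ge k_1$). Then the set of (vectors of) power series $\sigma(\mathbf c^{(1)}_\infty),\dots,\sigma(\mathbf c^{(e)}_\infty)$ is a basis of $$\mathcal{E}xt^d_{\mathcal D}(\mathcal M,\hat{\mathcal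 O})=\frac{\left\{\mathbf f=(f_1,\dots,f_q)^T\in\hat{\mathcal O}^q\ \middle|\ A\bullet\mathbf f=0\right\}}{\left\{B\bullet(g_1,\dots,g_r)^T\ \middle|\ g_i\in\hat{\mathcal O}\right\}}$$ as a $K$-vector space. In particular, when $d=0$, this set is a basis of the space of classical power series solutions $\{f\in\hat{\mathcal O} : \ell\bullet f=0\text{ for all }\ell\in I\}$, since the denominator is $0$ in the expression above.
   Context: Let $K=\mathbf{C}$, $D=K\langle x_1,\dots,x_n,\partial_1,\dots,\partial_n\rangle$ the Weyl algebra, $\mathcal D$ the sheaf of analytic differential operators in $x_1,\dots,x_n$, and $\hat{\mathcal O}=K[[x_1,\dots,x_n]]$ (formal power series at the origin; $\mathcal{E}xt^d_{\mathcal D}(\mathcal M,\hat{\mathcal O})$ is understood as its germ at the origin, i.e. $\mathrm{Ext}^d_{\mathcal D_0}(\mathcal D_0/\mathcal D_0I,K[[x]])$). $\bullet$ denotes the action of differential operators on power series. Elements of $D^p$ are row vectors, and a $p\times q$ matrix $A$ over $D$ gives the left $D$-linear map $\cdot A: D^p\to D^q$, $Q\mapsto QA$; it acts on column vectors $\hat{\mathcal O}^q\to\hat{\mathcal O}^p$ by $f\mapsto A\bullet f$. We write $\mathbf N_0=\{0,1,2,\dots\}$ and $\mathbf{e}^j$ for the $j$-th standard vector. Orders and initial parts: for a degree shift vector $\mathbf{t}\in\mathbf{Z}^q$, a nonzero $P=\sum c_{\alpha\beta j}x^\alpha\partial^\beta \mathbf{e}^j\in D^q$ has $\mathrm{ord}_{(-w,w)}[\mathbf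 t](P)=\max\{w\cdot(\beta-\alpha)+t_j : c_{\alpha\beta j}\ne0\}$, and $\mathrm{in}_{(-w,w)}[\mathbf t](P)\in D^q$ is the sum of the terms of $P$ attaining this maximum (and $\mathrm{in}(0)=0$). For a left submodule $N\subset D^q$, $\mathrm{in}_{(-w,w)}[\mathbf t](N)$ is the left submodule of $D^q$ generated by the initial parts of the elements of $N$. $D^q[\mathbf t]$ denotes $D^q$ with degree shift $\mathbf t$. Adapted resolution: a free resolution $$\cdots\xrightarrow{\psi_{2}}D^{b_1}[\mathbf{m}_1]\xrightarrow{\psi_1}D^{b_0}[\mathbf{m}_0]\to M\to0,\qquad b_0=1,\ \mathbf m_0=(0),$$ of $M=D/I$, with degree shifts $\mathbf{m}_i\in\mathbf{Z}^{b_i}$ such that every nonzero row $R$ of the matrix $\psi_{i+1}$ satisfies $\mathrm{ord}_{(-w,w)}[\mathbf m_i](R)=$ the corresponding entry of $\mathbf m_{i+1}$, is called adapted (for $w$) if at every object $D^{b_i}[\mathbf m_i]$: (1) the kernel of the outgoing map ($\cdot\psi_i$ for $i\ge1$, the projection $D\to M$ for $i=0$) is generated by the rows of $\psi_{i+1}$; and (2) $\mathrm{in}_{(-w,w)}[\mathbf m_i]$ of this kernel is generated by $\mathrm{in}_{(-w,w)}[\mathbf m_i](R)$, $R$ running over the rows of $\psi_{i+1}$. By convention $\psi_0=0$ with $D^{b_{-1}}=0$ (so for $d=0$ one has $r=0$ and $B=0$). $b$-function: the $b$-function of $M=D/I$ associated to $(-w,w)$ is the monic generator $b(s)$ of the ideal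 $\{b\in K[s] : b(\sum_i w_ix_i\partial_i)\in\mathrm{in}_{(-w,w)}(I)\}$ (nonzero since $M$ is holonomic); $k_1$ is its maximal integral root. Matrices and truncation: a vector $c=(c_{k\ell})_{k\in\mathbf N_0^n,\,1\le\ell\le q}$ with $c_{k\ell}\in K$ is identified with $\sigma(c)=\sum_{k,\ell}\frac{c_{k\ell}}{k!}x^k\mathbf e^\ell\in\hat{\mathcal O}^q$. The space of such vectors is $(K^{n\infty})^q[\mathbf t]$; the index $(k,\ell)$ has degree $w\cdot k+t_\ell$, and $(K^{n\infty})^q[\mathbf t]_{\le m}$ is the finite-dimensional space of vectors with indices of degree $\le m$ only. The truncation $\tau_m:(K^{n\infty})^q[\mathbf t]\to(K^{n\infty})^q[\mathbf t]_{\le m}$ forgets the entries of degree $>m$. Indices are sorted by increasing degree (ties broken by a fixed order). For a $p\times q$ matrix $A=(A^j_\ell)$, define $a^{ij}_{k\ell}\in K$ ($i,k\in\mathbf N_0^n$, $1\le j\le p$, $1\le\ell\le q$) by writing $\partial^iA^j_\ell$ in normally ordered form $\sum a_{\alpha k}x^\alpha\partial^k$ and setting $x=0$, so that the result is $\sum_k a^{ij}_{k\ell}\partial^k$. The linear map $\cdot\bar A^T:(K^{n\infty})^q[\mathbf t]\to(K^{n\infty})^p[\mathbf s]$ sends the row vector $(c_{k\ell})$ to the row vector whose $(i,j)$ entry is $\sum_{k,\ell}a^{ij}_{k\ell}c_{k\ell}$; under $\sigma$ it is the map $\hat{\mathcal O}^q\to\hat{\mathcal O}^p$, $f\mapsto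 A\bullet f$. The map $\cdot\bar B^T:(K^{n\infty})^r[\mathbf u]\to(K^{n\infty})^q[\mathbf t]$ is defined in the same way from the $q\times r$ matrix $B$. These matrices are block upper triangular with respect to degree, so restricting to indices of degree $\le m$ gives, for each $m$, a complex of finite-dimensional spaces $$(K^{n\infty})^r[\mathbf u]_{\le m}\xrightarrow{\cdot\tau_m(\bar B^T)}(K^{n\infty})^q[\mathbf t]_{\le m}\xrightarrow{\cdot\tau_m(\bar A^T)}(K^{n\infty})^p[\mathbf s]_{\le m},$$ where $\tau_m(\cdot)$ of a matrix is the submatrix with row and column indices of degree $\le m$.
   Formalization: For non-integral weights the claim can fail (n=1, w=1/2, I=D(x∂)(x∂−1), d=0), so it is also assumed that every root of the b-function equal to the degree of some index (k,ℓ) of (K^{n∞})^q[t] is at most k_1; this is automatic for integer weights. *)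

(* Defs.v *)
From HB Require Import structures.
From mathcomp Require Import all_boot all_order all_algebra.
From mathcomp Require Import boolp functions reals.
From mathcomp Require Import complex ssrcomplements mpoly.

Set Implicit Arguments.
Unset Strict Implicit.
Unset Printing Implicit Defensive.
Import Order.TTheory GRing.Theory Num.Theory.
Local Open Scope ring_scope.

Section FormalSeries.
Variables (n : nat) (A : comNzRingType).
Implicit Types (f g h : 'X_{1..n} -> A).

(* [f m] is the coefficient of x^m. *)
Definition fseries : Type := 'X_{1..n} -> A.

HB.instance Definition _ := GRing.Lmodule.copy fseries ('X_{1..n} -> A^o).

Definition fs_mul (f g : fseries) : fseries := fun m =>
  \sum_(k : 'X_{1..n < (mdeg m).+1, (mdeg m).+1} | m == (k.1 + k.2)%MM)
     f k.1 * g k.2.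

Definition mp_fseries (p : {mpoly A[n]}) : fseries := fun m => p@_m.

Definition fs_trunc (d : nat) (f : fseries) : {mpoly A[n]} :=
  \sum_(k : 'X_{1..n < d}) f k *: 'X_[k].

Lemma lem_mdeg (k m : 'X_{1..n}) : (k <= m)%MM -> (mdeg k <= mdeg m)%N.
Proof. by move/submK => <-; rewrite mdegD leq_addl. Qed.

Lemma fs_truncE d f m : (mdeg m < d)%N -> (fs_trunc d f)@_m = f m.
Proof. exact: mcoeff_mpoly. Qed.

Lemma fs_mul_coef (f g : fseries) (p q : {mpoly A[n]}) m :
  (forall k, (k <= m)%MM -> p@_k = f k) ->
  (forall k, (k <= m)%MM -> q@_k = g k) ->
  fs_mul f g m = (p * q)@_m.
Proof.
move=> Hp Hq; rewrite mcoeffM; apply: eq_bigr => k /eqP Em.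
have [k1 k2] : (k.1 <= m)%MM /\ (k.2 <= m)%MM.
  by move: (val k.1) (val k.2) Em => a b ->; rewrite lem_addr lem_addl.
by rewrite Hp ?Hq.
Qed.

Lemma fs_mulE (f g : fseries) d m : (mdeg m < d)%N ->
  fs_mul f g m = (fs_trunc d f * fs_trunc d g)@_m.
Proof.
by move=> md; apply: fs_mul_coef => k /lem_mdeg km;
   rewrite fs_truncE // (leq_ltn_trans km).
Qed.

Lemma fs_mulA : associative fs_mul.
Proof.
move=> f g h; apply: funext => m; set d := (mdeg m).+1.
have le k : (k <= m)%MM -> (mdeg k < d)%N by move/lem_mdeg; rewrite /d ltnS.
rewrite (@fs_mul_coef _ _ (fs_trunc d f) (fs_trunc d g * fs_trunc d h)).
- rewrite mulrA; apply/esym/fs_mul_coef => k /le kd.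
  + by rewrite (fs_mulE _ _ kd).
  + by rewrite fs_truncE.
- by move=> k /le kd; rewrite fs_truncE.
- by move=> k /le kd; rewrite (fs_mulE _ _ kd).
Qed.

Lemma fs_mulC : commutative fs_mul.
Proof.
move=> f g; apply: funext => m.
by rewrite !(@fs_mulE _ _ (mdeg m).+1) // mulrC.
Qed.

Lemma fs_mul1 : left_id (mp_fseries 1) fs_mul.
Proof.
move=> f; apply: funext => m.
rewrite (@fs_mul_coef _ _ 1 (fs_trunc (mdeg m).+1 f)) //.
  by rewrite mul1r fs_truncE.
by move=> k /lem_mdeg km; rewrite fs_truncE.
Qed.

Lemma fs_mulDl : left_distributive fs_mul +%R.
Proof.
move=> f g h; apply: funext => m; rewrite /fs_mul -[RHS]big_split /=.
by apply: eq_bigr => k _; rewrite mulrDl.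
Qed.

Lemma fs_1neq0 : mp_fseries 1 != 0.
Proof.
apply/eqP => /(congr1 (fun f : fseries => f 0%MM)); rewrite /mp_fseries mcoeff1 eqxx.
by move/eqP; rewrite oner_eq0.
Qed.

HB.instance Definition _ := GRing.Zmodule_isComNzRing.Build fseries
  fs_mulA fs_mulC fs_mul1 fs_mulDl fs_1neq0.

Definition fs_deriv (i : 'I_n) (f : fseries) : fseries :=
  fun m => f (m + U_(i))%MM *+ (m i).+1.

Lemma fs_deriv_is_additive i : zmod_morphism (fs_deriv i).
Proof. by move=> f g; apply: funext => m; exact: mulrnBl. Qed.

HB.instance Definition _ i :=
  GRing.isZmodMorphism.Build fseries fseries (fs_deriv i) (fs_deriv_is_additive i).

Lemma fs_derivM i (f g : fseries) :
  fs_deriv i (f * g) = fs_deriv i f * g + f * fs_deriv i g.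
Proof.
apply: funext => m; set d := (mdeg m).+2.
have lt k : (k <= m)%MM -> (mdeg k < d)%N by move/lem_mdeg/leq_ltn_trans; apply.
have ltU k : (k <= m)%MM -> (mdeg (k + U_(i))%MM < d)%N.
  by move/lem_mdeg; rewrite mdegD mdeg1 addn1 /d !ltnS.
have D (f' : fseries) k : (k <= m)%MM ->
    (mderiv i (fs_trunc d f'))@_k = fs_deriv i f' k.
  by move=> km; rewrite mcoeff_deriv fs_truncE ?ltU.
have T (f' : fseries) k : (k <= m)%MM -> (fs_trunc d f')@_k = f' k.
  by move=> km; rewrite fs_truncE ?lt.
rewrite {1}/fs_deriv [X in X *+ _](@fs_mulE f g d) ?ltU ?lepm_refl //.
rewrite -mcoeff_deriv mderivM mcoeffD.
congr (_ + _); symmetry; apply: fs_mul_coef => k km; by rewrite ?D ?T.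
Qed.

Lemma fs_derivC i j (f : fseries) :
  fs_deriv i (fs_deriv j f) = fs_deriv j (fs_deriv i f).
Proof.
apply: funext => m; rewrite /fs_deriv -!mulrnA !mnmDE !mnm1E.
rewrite -!addmA [(U_(j) + _)%MM]addmC; congr (_ *+ _).
rewrite [j == i]eq_sym; case: eqVneq => [->|_]; first by [].
by rewrite !addn0 mulnC.
Qed.

End FormalSeries.

Record derivations n (A : comNzRingType) := Derivations {
  der :> 'I_n -> {additive A -> A};
  derM : forall i a b, der i (a * b) = der i a * b + a * der i b;
  derC : forall i j a, der i (der j a) = der j (der i a) }.

(* An operator is stored through its normally ordered form: the coefficient   *)
(* [P@_b : A] is the one of \partial^b, written on the left. The additive     *)
(* group is that of {mpoly A[n]}, the product is not.                         *)
Definition diffop n (A : comNzRingType) (delta : derivations n A) : Type :=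
  {mpoly A[n]}.

Section DiffOp.
Variables (n : nat) (A : comNzRingType) (delta : derivations n A).

HB.instance Definition _ := GRing.Zmodule.copy (diffop delta) {mpoly A[n]}.

(* \partial_i o (q \partial^c) = delta_i(q) \partial^c + q \partial_i \partial^c *)
Definition dop_pderiv (i : 'I_n) (Q : {mpoly A[n]}) : {mpoly A[n]} :=
  map_mpoly (delta i) Q + 'X_i * Q.

Definition dop_pderivm (b : 'X_{1..n}) (Q : {mpoly A[n]}) : {mpoly A[n]} :=
  foldr (fun i => iter (b i) (dop_pderiv i)) Q (enum 'I_n).

Definition dop_mul (P Q : {mpoly A[n]}) : {mpoly A[n]} :=
  \sum_(b <- msupp P) P@_b *: dop_pderivm b Q.

Lemma dop_pderiv_is_additive i : zmod_morphism (dop_pderiv i).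
Proof. by move=> P Q; rewrite /dop_pderiv raddfB mulrBr addrACA opprD. Qed.

HB.instance Definition _ i := GRing.isZmodMorphism.Build {mpoly A[n]} {mpoly A[n]}
  (dop_pderiv i) (dop_pderiv_is_additive i).

Lemma dop_pderivm_is_additive b : zmod_morphism (dop_pderivm b).
Proof.
move=> P Q; rewrite /dop_pderivm; elim: (enum _) => //= i s ->.
by elim: (b i) => //= k ->; rewrite raddfB.
Qed.

HB.instance Definition _ b := GRing.isZmodMorphism.Build {mpoly A[n]} {mpoly A[n]}
  (dop_pderivm b) (dop_pderivm_is_additive b).

Lemma dop_mulwE k P Q : (msize P <= k)%N ->
  dop_mul P Q = \sum_(b : 'X_{1..n < k}) P@_b *: dop_pderivm b Q.
Proof.
move=> lek; rewrite /dop_mul (big_mksub 'X_{1..n < k}) /=; first last.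
- by move=> x /msize_mdeg_lt /leq_trans; apply.
- by rewrite msupp_uniq.
by rewrite big_rmcond //= => b /memN_msupp_eq0 ->; rewrite scale0r.
Qed.

Lemma dop_mulBl : left_distributive dop_mul (fun P Q => P - Q).
Proof.
move=> P1 P2 Q; pose k := maxn (msize (P1 - P2)) (maxn (msize P1) (msize P2)).
rewrite !(@dop_mulwE k) ?leq_max ?leqnn ?orbT // -sumrB.
by apply: eq_bigr => b _; rewrite mcoeffB scalerBl.
Qed.

Lemma dop_mul0l Q : dop_mul 0 Q = 0.
Proof. by rewrite /dop_mul msupp0 big_nil. Qed.

Lemma dop_mulDl : left_distributive dop_mul +%R.
Proof.
move=> P1 P2 Q; rewrite -{1}[P2]opprK dop_mulBl.
by rewrite -[in dop_mul (- P2) _](sub0r P2) dop_mulBl dop_mul0l sub0r opprK.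
Qed.

Lemma dop_mulBr P : zmod_morphism (dop_mul P).
Proof.
move=> Q1 Q2; rewrite /dop_mul -sumrB.
by apply: eq_bigr => b _; rewrite raddfB /= scalerBr.
Qed.

HB.instance Definition _ P := GRing.isZmodMorphism.Build {mpoly A[n]} {mpoly A[n]}
  (dop_mul P) (dop_mulBr P).

Lemma dop_mulDr : right_distributive dop_mul +%R.
Proof. by move=> P Q1 Q2; rewrite raddfD. Qed.

Lemma dop_mulX b Q : dop_mul 'X_[b] Q = dop_pderivm b Q.
Proof. by rewrite /dop_mul msuppX big_seq1 mcoeffX eqxx scale1r. Qed.

Lemma dop_mulZl a P Q : dop_mul (a *: P) Q = a *: dop_mul P Q.
Proof.
pose k := maxn (msize (a *: P)) (msize P).
rewrite !(@dop_mulwE k) ?leq_max ?leqnn ?orbT // scaler_sumr.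
by apply: eq_bigr => b _; rewrite mcoeffZ scalerA.
Qed.

Lemma dop_mul_suml I (r : seq I) (F : I -> {mpoly A[n]}) Q :
  dop_mul (\sum_(i <- r) F i) Q = \sum_(i <- r) dop_mul (F i) Q.
Proof.
by elim: r => [|i r IH]; rewrite ?big_nil ?dop_mul0l // !big_cons dop_mulDl IH.
Qed.

Lemma dop_pderivZ i a Q :
  dop_pderiv i (a *: Q) = delta i a *: Q + a *: dop_pderiv i Q.
Proof.
apply/mpolyP => m; rewrite /dop_pderiv !mcoeffD -scalerAr !mcoeffZ mcoeffD.
by rewrite !mcoeff_map_mpoly mcoeffZ derM mulrDr addrA.
Qed.

Lemma dop_pderivC i j Q :
  dop_pderiv i (dop_pderiv j Q) = dop_pderiv j (dop_pderiv i Q).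
Proof.
have MX k l P : map_mpoly (delta k) ('X_l * P) = 'X_l * map_mpoly (delta k) P.
  apply/mpolyP => m; rewrite mcoeff_map_mpoly !mcoeffM raddf_sum.
  apply: eq_bigr => -[a b] /= _; rewrite mcoeff_map_mpoly !mcoeffX.
  by case: eqP; rewrite ?mul1r ?mul0r ?raddf0.
rewrite /dop_pderiv !raddfD /= !mulrDr !MX.
have -> : map_mpoly (delta i) (map_mpoly (delta j) Q) =
          map_mpoly (delta j) (map_mpoly (delta i) Q).
  by apply/mpolyP => m; rewrite !mcoeff_map_mpoly derC.
by rewrite addrACA -[RHS]addrACA [in RHS]addrA mulrCA -!addrA; congr (_ + _);
   rewrite addrCA.
Qed.

Lemma dop_pderiv_pderivm i b Q :
  dop_pderiv i (dop_pderivm b Q) = dop_pderivm (b + U_(i))%MM Q.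
Proof.
have iterC j k P : dop_pderiv i (iter k (dop_pderiv j) P) =
                   iter k (dop_pderiv j) (dop_pderiv i P).
  by elim: k => //= k IH; rewrite dop_pderivC IH.
pose F b s := foldr (fun i => iter (b i) (dop_pderiv i)) Q s.
have E (s : seq 'I_n) : uniq s ->
    F (b + U_(i))%MM s = if i \in s then dop_pderiv i (F b s) else F b s.
  elim: s => //= j s IH /andP[js us]; rewrite inE mnmDE mnm1E IH //.
  case: eqVneq js => [<- /negPf->|_ _]; rewrite ?addn1 //= addn0.
  by case: ifP => //= _; rewrite iterC.
by have := E _ (enum_uniq 'I_n); rewrite mem_enum => /esym.
Qed.

Lemma dop_pderivm0 Q : dop_pderivm 0%MM Q = Q.
Proof. by rewrite /dop_pderivm; elim: (enum _) => //= i s ->; rewrite mnm0E. Qed.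

Lemma dop_pderivm_ind (T : 'X_{1..n} -> Prop) :
  T 0%MM -> (forall b i, T b -> T (b + U_(i))%MM) -> forall b, T b.
Proof.
move=> T0 TS b; rewrite [b]multinomUE_id.
elim/big_rec: _ => // i m _ Tm; elim: (b i) => [|k IH]; first by rewrite mulm0n add0m.
by rewrite mulmS -addmA addmC; apply: TS.
Qed.

Lemma dop_pderivX i b : dop_pderiv i 'X_[b] = 'X_[b + U_(i)].
Proof.
rewrite /dop_pderiv -mpolyXD addmC -[RHS]add0r; congr (_ + _).
apply/mpolyP => m; rewrite mcoeff_map_mpoly mcoeffX mcoeff0.
suff E1 : delta i 1 = 0 by case: (b == m) => /=; rewrite ?E1 ?raddf0.
by apply: (addrI (delta i 1)); rewrite addr0 -{3}[1]mulr1 derM mulr1 mul1r.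
Qed.

Lemma dop_pderiv_mul i P Q :
  dop_mul (dop_pderiv i P) Q = dop_pderiv i (dop_mul P Q).
Proof.
rewrite [P]mpolyE (raddf_sum (dop_pderiv i)) /= !dop_mul_suml raddf_sum /=.
apply: eq_bigr => b _; rewrite dop_pderivZ dop_mulDl !dop_mulZl dop_pderivZ.
by rewrite dop_pderivX !dop_mulX dop_pderiv_pderivm.
Qed.

Lemma dop_pderivm_mul b P Q :
  dop_mul (dop_pderivm b P) Q = dop_pderivm b (dop_mul P Q).
Proof.
elim/dop_pderivm_ind: b => [|b i IH]; first by rewrite !dop_pderivm0.
by rewrite -!dop_pderiv_pderivm dop_pderiv_mul IH.
Qed.

Lemma dop_mulA : associative dop_mul.
Proof.
move=> P Q S; rewrite [P]mpolyE dop_mul_suml (dop_mul_suml _ _ Q) dop_mul_suml; apply: eq_bigr => b _.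
by rewrite !dop_mulZl !dop_mulX dop_pderivm_mul.
Qed.

Lemma dop_mul1l : left_id 1 dop_mul.
Proof. by move=> P; rewrite -mpolyX0 dop_mulX dop_pderivm0. Qed.

Lemma dop_mul1r : right_id 1 dop_mul.
Proof.
have E b : dop_pderivm b 1 = 'X_[b].
  elim/dop_pderivm_ind: b => [|b i IH]; first by rewrite dop_pderivm0 mpolyX0.
  by rewrite -dop_pderiv_pderivm IH dop_pderivX.
by move=> P; rewrite [RHS]mpolyE /dop_mul; apply: eq_bigr => b _; rewrite E.
Qed.

HB.instance Definition _ := GRing.Zmodule_isNzRing.Build (diffop delta)
  dop_mulA dop_mul1l dop_mul1r dop_mulDl dop_mulDr (oner_neq0 {mpoly A[n]}).

End DiffOp.

Definition mp_derivations n (K : comNzRingType) : derivations n {mpoly K[n]} :=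
  @Derivations n {mpoly K[n]} (fun i => mderiv i : {additive _ -> _})
    (fun i => @mderivM n K i) (fun i j => @mderiv_comm n K j i).

Definition fs_derivations n (K : comNzRingType) : derivations n (fseries n K) :=
  @Derivations n (fseries n K) (fun i => @fs_deriv n K i : {additive _ -> _})
    (@fs_derivM n K) (@fs_derivC n K).

(* The Weyl algebra, and the operators of finite order with formal power      *)
(* series coefficients.                                                       *)
Definition weyl n (K : comNzRingType) : Type := diffop (@mp_derivations n K).
Definition fdiffop n (K : comNzRingType) : Type := diffop (@fs_derivations n K).

HB.instance Definition _ n K := GRing.NzRing.on (weyl n K).
HB.instance Definition _ n K := GRing.NzRing.on (fdiffop n K).

Section Weyl.
Variables (n : nat) (K : comNzRingType).
Local Notation D := (weyl n K).
Local Notation symbol := {mpoly {mpoly K[n]}[n]}.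

Definition weyl_scale (c : K) (P : D) : D := (c%:MP_[n] *: (P : symbol)).

Lemma weyl_scaleA (a b : K) P : weyl_scale a (weyl_scale b P) = weyl_scale (a * b) P.
Proof. by rewrite /weyl_scale scalerA mpolyCM. Qed.
Lemma weyl_scale1 : left_id 1 weyl_scale.
Proof. by move=> P; rewrite /weyl_scale scale1r. Qed.
Lemma weyl_scaleDr : right_distributive weyl_scale +%R.
Proof. by move=> a P Q; exact: (scalerDr (a%:MP_[n]) (P : symbol) Q). Qed.
Lemma weyl_scaleDl P : {morph weyl_scale^~ P : a b / a + b}.
Proof. by move=> a b; rewrite /weyl_scale mpolyCD scalerDl. Qed.

HB.instance Definition _ := GRing.Zmodule_isLmodule.Build K D
  weyl_scaleA weyl_scale1 weyl_scaleDr weyl_scaleDl.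

(* x^a \partial^b, its coefficient in P, and the pairs (a, b) occurring in P. *)
Definition wmon (a b : 'X_{1..n}) : D :=
  ('X_[a] : {mpoly K[n]}) *: ('X_[b] : symbol).
Definition wcoef (P : D) (a b : 'X_{1..n}) : K := ((P : symbol)@_b)@_a.
Definition wsupp (P : D) : seq ('X_{1..n} * 'X_{1..n}) :=
  [seq (a, b) | b <- msupp (P : symbol), a <- msupp (P : symbol)@_b].

End Weyl.

Definition to_fdiffop n (K : comNzRingType) (P : weyl n K) : fdiffop n K :=
  map_mpoly (@mp_fseries n K) (P : {mpoly {mpoly K[n]}[n]}).

Definition fs_derivm n (K : comNzRingType) (b : 'X_{1..n}) (f : fseries n K) :
  fseries n K := foldr (fun i => iter (b i) (@fs_deriv n K i)) f (enum 'I_n).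

Definition fact_act n (K : comNzRingType) (P : fdiffop n K) (f : fseries n K) :
  fseries n K :=
  \sum_(b <- msupp (P : {mpoly (fseries n K)[n]}))
     (P : {mpoly (fseries n K)[n]})@_b * fs_derivm b f.

Definition wact n (K : comNzRingType) (P : weyl n K) (f : fseries n K) :
  fseries n K := fact_act (to_fdiffop P) f.

Definition wmat_act n (K : comNzRingType) p q (A : 'M[weyl n K]_(p, q))
  (f : 'I_q -> fseries n K) : 'I_p -> fseries n K :=
  fun i => \sum_j wact (A i j) (f j).

Definition lspan (S : nzRingType) (V : lmodType S) (G : V -> Prop) (v : V) :=
  exists (N : nat) (a : 'I_N -> S) (g : 'I_N -> V),
    (forall i, G (g i)) /\ v = \sum_i a i *: g i.

Definition left_ideal (S : nzRingType) (I : S -> Prop) :=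
  [/\ I 0, forall P Q, I P -> I Q -> I (P + Q) & forall P Q, I Q -> I (P * Q)].

(* The family v, contained in the subspace Z, represents a basis of Z / W. *)
Definition basis_mod (K : nzRingType) (V : lmodType K) (Z W : V -> Prop)
    (e : nat) (v : 'I_e -> V) :=
  [/\ forall i, Z (v i),
      forall a : 'I_e -> K, W (\sum_i a i *: v i) -> forall i, a i = 0 &
      forall f, Z f -> exists a : 'I_e -> K, W (f - \sum_i a i *: v i)].

(* D/I is holonomic when it is 0 or when its dimension in the sense of        *)
(* Bernstein is n: the dimension of F_k / (F_k \cap I), F_k being the         *)
(* Bernstein filtration, is for large k a polynomial of degree n in k.        *)
Definition bernstein n (K : comNzRingType) (k : nat) (P : weyl n K) :=
  forall a b, wcoef P a b <> 0 -> (mdeg a + mdeg b <= k)%N.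

Definition holonomic n (K : comNzRingType) (I : weyl n K -> Prop) :=
  (forall P, I P) \/
  exists (chi : {poly rat}) (k0 : nat), size chi = n.+1 /\
    forall k, (k0 <= k)%N ->
      exists (N : nat) (v : 'I_N -> weyl n K),
        chi.[k%:R] = N%:R /\
        basis_mod (@bernstein n K k) (fun P => bernstein k P /\ I P) v.

Section Weights.
Variables (R : realType) (n : nat).
Local Notation K := R[i].
Local Notation D := (weyl n K).
Variable w : 'I_n -> R.

Section Initial.
Variables (q : nat) (t : 'I_q -> int).
Implicit Types (P : 'rV[D]_q) (j : 'I_q).

(* The order of x^ab.1 \partial^ab.2 e^j. *)
Definition term_ord (ab : 'X_{1..n} * 'X_{1..n}) j : R :=
  \sum_i w i * ((ab.2 i)%:R - (ab.1 i)%:R) + (t j)%:~R.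

Definition top_term P ab j : bool :=
  [forall j', all (fun ab' => term_ord ab' j' <= term_ord ab j) (wsupp (P 0 j'))].

(* [has_ord P r]: P is nonzero and ord_(-w,w)[t](P) = r. *)
Definition has_ord P (r : R) :=
  exists j ab, [/\ ab \in wsupp (P 0 j), top_term P ab j & term_ord ab j = r].

Definition initial P : 'rV[D]_q :=
  \row_j \sum_(ab <- wsupp (P 0 j) | top_term P ab j)
     wcoef (P 0 j) ab.1 ab.2 *: wmon K ab.1 ab.2.

Definition initial_submod (N : 'rV[D]_q -> Prop) : 'rV[D]_q -> Prop :=
  lspan (fun Q => exists2 P, N P & Q = initial P).

End Initial.

(* in_(-w,w)(I), obtained by identifying D with D^1. *)
Definition initial_ideal (I : D -> Prop) (P : D) :=
  initial_submod (fun=> 0) (fun Q : 'rV_1 => I (Q 0 0)) (P%:M).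

Definition weight_theta : D :=
  \sum_i (w i)%:C%C *: wmon K U_(i)%MM U_(i)%MM.

Definition at_theta (b : {poly K}) : D := \sum_(i < size b) b`_i *: weight_theta ^+ i.

Definition is_bfunction (I : D -> Prop) (b : {poly K}) :=
  b \is monic /\ forall p : {poly K}, initial_ideal I (at_theta p) <-> b %| p.

Definition max_integral_root (b : {poly K}) (k1 : int) :=
  root b k1%:~R /\ forall k : int, root b k%:~R -> k <= k1.

End Weights.

(* The maps ... -> D^(rk 1)[sh 1] -> D^(rk 0)[sh 0], where [dif i] is the     *)
(* matrix of \psi_(i+1).                                                      *)
Record shifted_free n (K : comNzRingType) := ShiftedFree {
  rk : nat -> nat;
  sh : forall i, 'I_(rk i) -> int;
  dif : forall i, 'M[weyl n K]_(rk i.+1, rk i) }.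
Arguments sh {n K} _ _ _.

Section Resolution.
Variables (n : nat) (K : comNzRingType) (F : shifted_free n K).
Local Notation D := (weyl n K).

(* Rank and shift of the target of \psi_i; the rank is 0 for i = 0. *)
Definition rk_pred i : nat := if i is i'.+1 then rk F i' else 0%N.

Definition sh_pred i : 'I_(rk_pred i) -> int :=
  match i return 'I_(rk_pred i) -> int with
  | 0%N => fun=> 0
  | i'.+1 => sh F i'
  end.

Definition psi i : 'M[D]_(rk F i, rk_pred i) :=
  match i return 'M[D]_(rk F i, rk_pred i) with
  | 0%N => 0
  | i'.+1 => dif F i'
  end.

(* Kernel of the map leaving D^(rk i); for i = 0, where rk 0 = 1, this is     *)
(* the projection D -> D/I.                                                   *)
Definition out_kernel (I : D -> Prop) i (Q : 'rV[D]_(rk F i)) : Prop :=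
  if i is 0%N then forall j, I (Q 0 j) else Q *m psi i = 0.

End Resolution.

Definition adapted_resolution (R : realType) n (w : 'I_n -> R)
    (I : weyl n R[i] -> Prop) (F : shifted_free n R[i]) :=
  [/\ rk F 0 = 1%N,
      forall j, sh F 0 j = 0,
      forall i k, row k (psi F i.+1) != 0 ->
        has_ord w (sh F i) (row k (psi F i.+1)) (sh F i.+1 k)%:~R,
      forall i Q, out_kernel I Q <->
        lspan (fun P => exists k, P = row k (psi F i.+1)) Q &
      forall i Q, initial_submod w (sh F i) (out_kernel I (i := i)) Q <->
        lspan (fun P => exists k, P = initial w (sh F i) (row k (psi F i.+1))) Q].

(* Convergence of \sum_m f_m x^m in a neighbourhood of the origin. *)
Definition convergent n (K : numFieldType) (f : fseries n K) :=
  exists C rho : K, 0 < rho /\ forall m, `|f m| * rho ^+ mdeg m <= C.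

Definition analytic_op n (K : numFieldType) (P : fdiffop n K) :=
  forall b, convergent (P : {mpoly (fseries n K)[n]})@_b.

Section AnalyticResolution.
Variables (n : nat) (K : numFieldType) (I : weyl n K -> Prop).
Variable (F : shifted_free n K).

(* The left ideal D_0 I, D_0 being the ring of the analytic operators. *)
Definition analytic_ideal (P : fdiffop n K) :=
  exists (N : nat) (a : 'I_N -> fdiffop n K) (g : 'I_N -> weyl n K),
    (forall i, analytic_op (a i) /\ I (g i)) /\
    P = \sum_i a i * to_fdiffop (g i).

Definition analytic_kernel i (Q : 'rV[fdiffop n K]_(rk F i)) : Prop :=
  if i is 0%N then forall j, analytic_ideal (Q 0 j)
  else Q *m map_mx (@to_fdiffop n K) (psi F i) = 0.

(* The matrices \psi_i, read over D_0, form a free resolution of D_0/D_0 I.   *)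
(* As Hom_(D_0)(D_0^b, K[[x]]) = K[[x]]^b, the cohomology of the complex of   *)
(* the maps f |-> \psi_i \bullet f then is Ext_(D_0)(D_0/D_0 I, K[[x]]).      *)
Definition analytic_resolution :=
  rk F 0 = 1%N /\
  forall i (Q : 'rV[fdiffop n K]_(rk F i)), (forall j, analytic_op (Q 0 j)) ->
    (analytic_kernel Q <->
     exists S : 'rV[fdiffop n K]_(rk F i.+1), (forall j, analytic_op (S 0 j)) /\
       Q = S *m map_mx (@to_fdiffop n K) (psi F i.+1)).

End AnalyticResolution.

Section Truncation.
Variables (R : realType) (n : nat) (w : 'I_n -> R).
Local Notation K := R[i].

(* (K^(n\infty))^q *)
Definition ivec q : Type := 'X_{1..n} * 'I_q -> K^o.
HB.instance Definition _ q := GRing.Lmodule.on (ivec q).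

Definition ideg q (t : 'I_q -> int) (kl : 'X_{1..n} * 'I_q) : R :=
  \sum_i w i * (kl.1 i)%:R + (t kl.2)%:~R.

Definition sigma q (c : ivec q) : 'I_q -> fseries n K :=
  fun l k => c (k, l) / (\prod_(i < n) (k i)`!)%:R.

(* [bar_coef A i j k l] is the coefficient of \partial^k in the restriction   *)
(* to x = 0 of \partial^i A^j_l.                                              *)
Definition bar_coef p q (A : 'M[weyl n K]_(p, q)) i j k l : K :=
  wcoef (wmon K 0%MM i * A j l) 0%MM k.

Definition bar_mul p q (A : 'M[weyl n K]_(p, q)) (c : ivec q) : ivec p :=
  fun ij => \sum_l \sum_(ab <- wsupp (wmon K 0%MM ij.1 * A ij.2 l) | ab.1 == 0%MM)
     bar_coef A ij.1 ij.2 ab.2 l * c (ab.2, l).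

(* The finite-dimensional space of the vectors with indices of degree <= m    *)
(* is identified with the one of the infinite vectors vanishing at the other  *)
(* indices.                                                                   *)
Definition trunc (m : int) q (t : 'I_q -> int) (c : ivec q) : ivec q :=
  fun kl => if ideg t kl <= m%:~R then c kl else 0.

Definition truncated m q t (c : ivec q) := trunc m t c = c.

(* Product with the submatrix of rows and columns of degree <= m. *)
Definition trunc_mul m p q (A : 'M[weyl n K]_(p, q)) (t : 'I_q -> int)
  (s : 'I_p -> int) (c : ivec q) : ivec p := trunc m s (bar_mul A (trunc m t c)).

Definition trunc_ker m p q (A : 'M[weyl n K]_(p, q)) t s (c : ivec q) :=
  truncated m t c /\ trunc_mul m A t s c = 0.

Definition trunc_im m q r (B : 'M[weyl n K]_(q, r)) u t (c : ivec q) :=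
  exists2 g : ivec r, truncated m u g & c = trunc_mul m B u t g.

End Truncation.

(* A root of b can be the degree of an index without being an integer when    *)
(* the weights are not integers: for w = 1/2 and I = D (x d)(x d - 1), one    *)
(* has b = s (s - 1/2) and k1 = 0, but x has degree 1/2. Integral weights     *)
(* exclude this.                                                              *)
Lemma integral_weight_degrees (R : realType) n (w : 'I_n -> R) q (t : 'I_q -> int)
    (b : {poly R[i]}) (k1 : int) :
  (forall i, exists z : int, w i = z%:~R) -> max_integral_root b k1 ->
  forall kl, root b (ideg w t kl)%:C%C -> ideg w t kl <= k1%:~R.
Proof.
move=> wZ [_ k1max] kl.
have [z ->] : exists z : int, ideg w t kl = z%:~R.
  have [z zE] := fin_all_exists (wZ : forall i : 'I_n, exists z, w i = z%:~R).
  exists (\sum_i z i * (kl.1 i)%:Z + t kl.2); rewrite /ideg rmorphD rmorph_sum /=.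
  by congr (_ + _); apply: eq_bigr => i _; rewrite zE rmorphM.
by rewrite rmorph_int ler_int => /k1max.
Qed.

(* Main.v *)
Require Import Defs.
From HB Require Import structures.
From mathcomp Require Import all_boot all_order all_algebra.
From mathcomp Require Import boolp functions reals complex ssrcomplements mpoly.
From mathcomp Require Import zify ring lra.
(** Why the theorem holds.

    Give the term [x^k e_l] of a vector of power series the degree [w.k + t_l].
    The matrices [psi_i] do not lower degrees, and on the lowest parts they act
    through their initial parts [gpsi_i]. The proof compares the complex of
    formal power series with its truncation at degree [k1].

    Degrees above [k1]. The matrices [gpsi_i] form an exact complex ([gr_exact]).
    For this one needs that the resolution is strict: an element of order at most
    [r] of a kernel is [S psi] with the order of [S] controlled by [r]
    ([strict_kernel]). Division by the initial parts lowers the order step by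
    step without end, since orders are unbounded below; [strict_generators]
    makes it stop by first choosing finitely many generators with controlled
    representations ([weyl_standard_basis]), which is an Artin-Rees property of
    the V-filtration. Right multiplication by [b(theta)] is zero on [D / in(I)],
    so its lift to the graded complex, which is diagonal, is null-homotopic
    ([homotopy]). On solutions of degree [mu] it acts as the scalar [b(mu)], hence
    the graded complex of solutions is exact in every degree [mu] that is not a
    root of [b] ([gr_lift]); no degree above [k1] is a root. Lifting degree by degree,
    a solution with terms of degree above [k1] only is a boundary ([lift_high]).

    Degrees up to [k1]. The truncated complex is the quotient of the formal one by
    the degrees above [k1], so a solution is determined modulo boundaries by its
    truncation, and the given extensions of a basis are a basis
    ([truncated_basis]). For [d = 0] a solution of the first matrix is a solution
    of [I], because its rows generate [I] ([classical_solutions]).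

    The resolution over the analytic operators. It stays exact because convergent
    power series are flat over the polynomials ([convergent_flat]). A convergent
    solution of a polynomial linear system is divided by a standard basis of the
    polynomial solutions, for an order with the lowest degrees first; the
    quotients converge by a majorant estimate, and the remainder is zero because
    polynomial solutions are dense among formal ones ([poly_solutions_dense],
    again an Artin-Rees argument).

    Both Artin-Rees arguments are instances of [standard_basis], a consequence of
    Dickson's lemma in which the slack of a bound for the total degree is one of
    the exponents. *)

Set Implicit Arguments.
Unset Strict Implicit.
Unset Printing Implicit Defensive.
Import Order.TTheory GRing.Theory Num.Theory.
Local Open Scope ring_scope.

(** * Dickson's lemma and orders defined by linear functionals *)

(** The induction is on the set [J] of coordinates along which [S] varies: an
    element that is not above a chosen [x0] has one of finitely many values
    below [x0] at some coordinate of [J], and fixing that value shrinks [J]. *)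
Lemma dickson_on (X : eqType) k (f : X -> 'I_k -> nat) (J : {set 'I_k})
    (S : X -> Prop) :
  (forall x y i, S x -> S y -> i \notin J -> f x i = f y i) ->
  exists s : seq X, {in s, forall x, S x} /\
    forall y, S y -> exists2 x, x \in s & forall i, (f x i <= f y i)%N.
Proof.
move: {2}#|J| (leqnn #|J|) => c; elim: c J S => [|c IH] J S.
  rewrite leqn0 cards_eq0 => /eqP J0 fix_S.
  case: (pselect (exists x, S x)) => [[x Sx]|noS].
    exists [:: x]; split=> [y|y Sy]; first by rewrite inE => /eqP ->.
    by exists x; rewrite ?inE // => i; rewrite (fix_S x y) // J0 inE.
  by exists [::]; split=> // y Sy; case: noS; exists y.
move=> leJ fix_S.
case: (pselect (exists x, S x)) => [[x0 Sx0]|noS]; last first.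
  by exists [::]; split=> // y Sy; case: noS; exists y.
pose T (p : {i : 'I_k & 'I_(f x0 i)}) x := S x /\ f x (tag p) = tagged p.
have basis (p : {i : 'I_k & 'I_(f x0 i)}) : tag p \in J ->
    exists s : seq X, {in s, forall x, T p x} /\
    forall y, T p y -> exists2 x, x \in s & forall i, (f x i <= f y i)%N.
  move=> pJ; apply: (IH (J :\ tag p)).
    by move: leJ; rewrite (cardsD1 (tag p) J) pJ.
  move=> x y i [Sx xp] [Sy yp]; rewrite !inE negb_and negbK.
  by case/orP=> [/eqP ->|/(fix_S x y i Sx Sy)//]; rewrite xp yp.
have /boolp.choice[sf sfP] (p : {i : 'I_k & 'I_(f x0 i)}) : exists s : seq X,
    tag p \in J -> {in s, forall x, T p x} /\
    forall y, T p y -> exists2 x, x \in s & forall i, (f x i <= f y i)%N.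
  by have [/basis[s sP]|_] := boolP (tag p \in J); [exists s | exists [::]].
exists (x0 :: flatten [seq sf p | p <- enum {: {i : 'I_k & 'I_(f x0 i)}} & tag p \in J]).
split=> [y|y Sy].
  rewrite inE => /predU1P[->//|/flatten_mapP[p]].
  by rewrite mem_filter => /andP[/sfP[sT _] _] /sT[].
have [le0|] := boolP [forall i, (f x0 i <= f y i)%N].
  by exists x0; [rewrite inE eqxx|apply/forallP].
case/forallPn=> i; rewrite -ltnNge => lt_i.
have iJ : i \in J.
  by apply: contraLR lt_i => /(fix_S _ _ _ Sx0 Sy) ->; rewrite ltnn.
pose p : {i : 'I_k & 'I_(f x0 i)} := Tagged (fun i => 'I_(f x0 i)) (Ordinal lt_i).
have [_ /(_ y (conj Sy erefl))[x xs le_xy]] := sfP p iJ.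
exists x => //; rewrite inE; apply/orP; right; apply/flatten_mapP; exists p => //.
by rewrite mem_filter iJ mem_enum.
Qed.

Lemma dickson (X : eqType) k (f : X -> 'I_k -> nat) (S : X -> Prop) :
  exists s : seq X, {in s, forall x, S x} /\
    forall y, S y -> exists2 x, x \in s & forall i, (f x i <= f y i)%N.
Proof. by apply: (@dickson_on _ _ _ setT) => x y i _ _; rewrite inE. Qed.

Section FunctionalOrder.
Variables (R : realDomainType) (m : nat) (J : finType).
Local Notation T := ('X_{1..m} * J)%type.

(** A linear functional on the indices [(a, j)] of the monomials [x^a e_j]:
    its values on the variables and on the basis vectors [e_j]. *)
Definition functional : Type := (('I_m -> R) * (J -> R))%type.

Definition fun_at (L : functional) (t : T) : R :=
  \sum_i L.1 i * (t.1 i)%:R + L.2 t.2.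

Definition fun_mon (L : functional) (g : 'X_{1..m}) : R := \sum_i L.1 i * (g i)%:R.

Definition shiftT (g : 'X_{1..m}) (t : T) : T := ((g + t.1)%MM, t.2).

Lemma fun_at_shift L g t : fun_at L (shiftT g t) = fun_mon L g + fun_at L t.
Proof.
rewrite /fun_at /fun_mon /= addrA -big_split; congr (_ + _).
by apply: eq_bigr => i _; rewrite mnmDE natrD mulrDr.
Qed.

Fixpoint lex_lt (Ls : seq functional) (t t' : T) : bool :=
  if Ls is L :: Ls' then
    (fun_at L t < fun_at L t') || (fun_at L t == fun_at L t') && lex_lt Ls' t t'
  else false.

Lemma lex_lt_irr Ls t : lex_lt Ls t t = false.
Proof. by elim: Ls => //= L Ls ->; rewrite ltxx eqxx. Qed.

Lemma lex_lt_trans Ls : transitive (lex_lt Ls).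
Proof.
elim: Ls => //= L Ls IH y x z /orP[xy|/andP[/eqP xy lxy]] /orP[yz|/andP[/eqP yz lyz]].
- by rewrite (lt_trans xy yz).
- by rewrite -yz xy.
- by rewrite xy yz.
- by rewrite xy yz eqxx (IH _ _ _ lxy lyz) orbT.
Qed.

Lemma lex_lt_shift Ls g t t' : lex_lt Ls (shiftT g t) (shiftT g t') = lex_lt Ls t t'.
Proof. by elim: Ls => //= L Ls ->; rewrite !fun_at_shift ltrD2l (inj_eq (addrI _)). Qed.

Lemma lex_lt_total Ls t t' : {in Ls, forall L, fun_at L t = fun_at L t'} \/
  lex_lt Ls t t' \/ lex_lt Ls t' t.
Proof.
elim: Ls => [|L Ls [IH|[IH|IH]]]; first by left.
- rewrite /=; have [lt|lt|eq] := ltgtP (fun_at L t) (fun_at L t').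
  + by right; left.
  + by right; right.
  + by left=> L'; rewrite inE => /predU1P[->|/IH].
- right; rewrite /=; have [lt|lt|eq] := ltgtP (fun_at L t) (fun_at L t'); first by left.
  + by right.
  + by left.
- right; rewrite /=; have [lt|lt|eq] := ltgtP (fun_at L t) (fun_at L t'); first by left.
  + by right.
  + by right.
Qed.

Definition deg_fun : functional := (fun=> 1, fun=> 0).

Definition coord_fun i : functional := (fun i' => (i' == i)%:R, fun=> 0).

Definition comp_fun : functional := (fun=> 0, fun j => (enum_rank j)%:R).

Lemma deg_funE t : fun_at deg_fun t = (mdeg t.1)%:R.
Proof.
rewrite /fun_at /= addr0 mdegE natr_sum.
by apply: eq_bigr => i _; rewrite mul1r.
Qed.

Lemma coord_funE i t : fun_at (coord_fun i) t = (t.1 i)%:R.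
Proof.
rewrite /fun_at /= addr0 (bigD1 i) //= eqxx mul1r big1 ?addr0 // => i' /negPf ->.
by rewrite mul0r.
Qed.

Lemma comp_funE t : fun_at comp_fun t = (enum_rank t.2)%:R.
Proof. by rewrite /fun_at /= big1 ?add0r // => i _; rewrite mul0r. Qed.

Definition tie_break : seq functional :=
  deg_fun :: rcons [seq coord_fun i | i <- enum 'I_m] comp_fun.

(** The total degree comes right after [v] because the Weyl relation replaces
    [x \partial] by [1], a term of the same weight and lower degree, which must
    come lower in the order; the other functionals only make the order total. *)
Definition tlt (v : functional) := lex_lt (v :: tie_break).

Lemma tlt_total v t t' : t != t' -> tlt v t t' || tlt v t' t.
Proof.
move=> ne; have [eqL|[]] := lex_lt_total (v :: tie_break) t t'; last first.
- by rewrite -/(tlt v _ _) => ->; rewrite orbT.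
- by rewrite -/(tlt v _ _) => ->.
case/eqP: ne; case: t t' eqL => [a j] [a' j'] eqL; congr (_, _).
  apply/mnmP => i; apply/eqP; rewrite -(eqr_nat R); apply/eqP.
  have := eqL (coord_fun i); rewrite !coord_funE /=; apply.
  by rewrite !inE mem_rcons inE map_f ?mem_enum ?orbT.
apply/enum_rank_inj/val_inj/eqP; rewrite -(eqr_nat R); apply/eqP.
have := eqL comp_fun; rewrite !comp_funE /=; apply.
by rewrite !inE mem_rcons inE eqxx ?orbT.
Qed.

Lemma tlt_le v t t' : tlt v t t' -> fun_at v t <= fun_at v t'.
Proof. by case/orP=> [/ltW//|/andP[/eqP->]]. Qed.

Lemma tlt_deg v t t' : fun_at v t <= fun_at v t' -> (mdeg t.1 < mdeg t'.1)%N ->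
  tlt v t t'.
Proof.
rewrite le_eqVlt /tlt /= => /orP[->|-> //]; rewrite !deg_funE !ltr_nat => ->.
by rewrite orbT.
Qed.

End FunctionalOrder.

Definition fun_comb m (J : finType) (Z : int) (L L' : functional int m J) :
  functional int m J := (fun i => Z * L.1 i + L'.1 i, fun j => Z * L.2 j + L'.2 j).

Lemma fun_combE m (J : finType) Z (L L' : functional int m J) t :
  fun_at (fun_comb Z L L') t = Z * fun_at L t + fun_at L' t.
Proof.
rewrite /fun_at /= mulrDr mulr_sumr addrACA -big_split; congr (_ + _).
by apply: eq_bigr => i _; rewrite mulrDl mulrA.
Qed.

(** [Z] only has to exceed the finitely many differences of values of [L'],
    because the values of [L] that differ do so by at least 1. *)
Lemma lex_combine m (J : finType) (L L' : functional int m J)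
    (s : seq (('X_{1..m} * J) * ('X_{1..m} * J))) :
  {in s, forall p, fun_at L p.1 < fun_at L p.2 \/
     fun_at L p.1 = fun_at L p.2 /\ fun_at L' p.1 < fun_at L' p.2} ->
  exists Z0 : int, forall Z, Z0 <= Z ->
    {in s, forall p, fun_at (fun_comb Z L L') p.1 < fun_at (fun_comb Z L L') p.2}.
Proof.
elim: s => [|p s IH] lt_s; first by exists 0.
case: IH => [q qs|Z0 Z0P]; first by apply: lt_s; rewrite inE qs orbT.
exists (Num.max Z0 (1 + `|fun_at L' p.1 - fun_at L' p.2|)) => Z.
rewrite ge_max => /andP[/Z0P Zs leZ] q; rewrite inE => /predU1P[->|/Zs//].
rewrite !fun_combE; case: (lt_s p (mem_head _ _)) => [lt_p|[-> lt_p]]; last first.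
  by rewrite ltrD2l.
have gap : fun_at L p.1 + 1 <= fun_at L p.2 by rewrite lezD1.
have := ler_norm (fun_at L' p.1 - fun_at L' p.2); have := normr_ge0 (fun_at L' p.1 - fun_at L' p.2).
move: leZ gap; set u := `|_|; move: (fun_at L' _) (fun_at L' _) (fun_at L _) (fun_at L _).
move=> a b c e; nia.
Qed.

(** The single functional is a combination of those of the list with rapidly
    decreasing coefficients. *)
Lemma lex_lt_functional m (J : finType) (Ls : seq (functional int m J))
    (s : seq (('X_{1..m} * J) * ('X_{1..m} * J))) :
  {in s, forall p, lex_lt Ls p.1 p.2} ->
  exists L : functional int m J, {in s, forall p, fun_at L p.1 < fun_at L p.2}.
Proof.
elim: Ls s => [|L Ls IH] s lt_s.
  by exists (deg_fun _ _ _) => p /lt_s.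
have [|L' L'P] := IH [seq p <- s | fun_at L p.1 == fun_at L p.2].
  move=> p; rewrite mem_filter => /andP[/eqP eqL /lt_s] /=.
  by rewrite eqL ltxx eqxx.
have [|Z0 Z0P] := @lex_combine _ _ L L' s; last first.
  by exists (fun_comb Z0 L L'); apply: Z0P.
move=> p ps; move: (lt_s p ps) => /= /orP[|/andP[eqL _]]; first by left.
by right; split; [apply/eqP|apply: L'P; rewrite mem_filter eqL].
Qed.

(** * Standard bases with controlled representations *)

Lemma count_lt (X : eqType) (p q : pred X) (s : seq X) x :
  (forall y, p y -> q y) -> x \in s -> q x -> ~~ p x -> (count p s < count q s)%N.
Proof.
move=> pq + qx px; elim: s => //= y s IH; rewrite inE => /predU1P[<-|/IH lt_s].
  by rewrite qx (negPf px) add0n add1n ltnS sub_count.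
apply: (@leq_ltn_trans (q y + count p s)); rewrite ?ltn_add2l // leq_add2r.
by case: (p y) (pq y) => // ->.
Qed.

Section StandardBasis.
Variables (R : realDomainType) (m : nat) (J : finType) (omega : functional R m J).
Local Notation T := ('X_{1..m} * J)%type.
Local Notation "t <_o t'" := (tlt omega t t') (at level 70).

Lemma seq_tmax (s : seq T) : s != [::] ->
  exists2 t, t \in s & {in s, forall t', t' = t \/ t' <_o t}.
Proof.
elim: s => // t s IH _; have [->|/IH[u us umax]] := eqVneq s [::].
  by exists t; rewrite ?inE // => t'; rewrite inE => /eqP; left.
have [ut|] := boolP ((u <_o t) || (u == t)).
  exists t; rewrite ?mem_head // => t'; rewrite inE => /predU1P[->|/umax]; first by left.
  case/orP: ut => [ut [->|/lex_lt_trans t'u]|/eqP <- //]; right => //.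
  exact: t'u.
rewrite negb_or => /andP[utN /(tlt_total omega)]; rewrite (negPf utN) /= => tu.
exists u; rewrite ?inE ?us ?orbT // => t'; rewrite inE => /predU1P[->|/umax//].
by right.
Qed.

Definition mons_upto (d : nat) : seq T :=
  [seq (val g, j) | g <- enum {: 'X_{1..m < d.+1}}, j <- enum J].

Lemma mem_mons_upto d t : (mdeg t.1 <= d)%N -> t \in mons_upto d.
Proof.
move=> le_d; have lt_d : (mdeg t.1 < d.+1)%N by [].
apply/allpairsP; exists (BMultinom lt_d, t.2); rewrite !mem_enum.
by split=> //; apply: surjective_pairing.
Qed.

Variables (K : fieldType) (V : zmodType) (scal : K -> V -> V).
Variables (cf : T -> V -> K) (act : 'X_{1..m} -> V -> V) (N : V -> Prop).

Definition bounded d v := forall t, cf t v != 0 -> (mdeg t.1 <= d)%N.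

Definition is_lead v t := cf t v != 0 /\ forall t', cf t' v != 0 -> t' = t \/ t' <_o t.

Hypothesis cfB : forall t u c v, cf t (u - scal c v) = cf t u - c * cf t v.
Hypothesis cf_ext : forall v, (forall t, cf t v = 0) -> v = 0.
Hypothesis cf_fin : forall v, exists d, bounded d v.
Hypothesis act_bounded : forall d g v, bounded d v -> bounded (mdeg g + d) (act g v).
Hypothesis act_lead : forall g v t, is_lead v t -> is_lead (act g v) (shiftT g t).
Hypothesis N_sub : forall u c v, N u -> N v -> N (u - scal c v).
Hypothesis N_act : forall g v, N v -> N (act g v).

Lemma lead_exists v : v != 0 -> exists t, is_lead v t.
Proof.
move=> v0; have [d dv] := cf_fin v.
have [|t] := @seq_tmax [seq t <- mons_upto d | cf t v != 0].
  apply: contra v0 => /eqP s0; apply/eqP/cf_ext => t; apply/eqP/negPn/negP => tv.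
  have : t \in [seq t <- mons_upto d | cf t v != 0].
    by rewrite mem_filter tv mem_mons_upto ?dv.
  by rewrite s0.
rewrite mem_filter => /andP[tv _] tmax; exists t; split=> // t' t'v.
by apply: tmax; rewrite mem_filter t'v mem_mons_upto ?dv.
Qed.

(** The coordinates to which Dickson's lemma is applied: the exponent of the
    leading monomial, the slack of its degree under a bound [d] for the degrees
    of the whole element, and the component, which is recorded twice so that
    comparable triples have the same component. *)
Definition lead_coords (x : nat * V * T) (i : 'I_m + 'I_3) : nat :=
  match i with
  | inl i => x.2.1 i
  | inr k => nth 0%N [:: (x.1.1 - mdeg x.2.1)%N; nat_of_ord (enum_rank x.2.2);
                    (#|J| - enum_rank x.2.2)%N] k
  end.

(** Because [tlt omega] compares the values of [omega] first, a representation
    whose leading monomials do not exceed that of [Q] respects the filtration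
    defined by [omega]. Subtracting multiples of basis elements lowers the leading monomial and,
    because the slack is a coordinate, keeps the bound on the degrees; only
    finitely many monomials satisfy that bound, so this stops although the order
    is not a well-order. *)
Theorem standard_basis : exists s : seq (V * T),
  [/\ {in s, forall p, N p.1 /\ is_lead p.1 p.2},
      forall Q t, N Q -> is_lead Q t -> exists g p, p \in s /\ t = shiftT g p.2 &
      forall Q (rho : R), N Q -> (forall t, cf t Q != 0 -> fun_at omega t <= rho) ->
      exists r : seq (K * 'X_{1..m} * (V * T)),
        {in r, forall x, x.2 \in s /\ fun_mon omega x.1.2 + fun_at omega x.2.2 <= rho} /\
        Q = \sum_(x <- r) scal x.1.1 (act x.1.2 x.2.1)].
Proof.
(* The same element occurs in [S] with every bound [d] for its degrees. *)
pose S (x : nat * V * T) := [/\ N x.1.2, bounded x.1.1 x.1.2 & is_lead x.1.2 x.2].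
have [s0 [s0S s0P]] := @dickson _ _ (fun x k => lead_coords x (fintype.split k)) S.
have divide d Q t : S (d, Q, t) -> exists x, exists g, [/\ x \in s0, S x,
    t = shiftT g x.2 & (mdeg g + x.1.1 <= d)%N].
  move=> SQ; have [x xs xle] := s0P _ SQ; have Sx := s0S _ xs.
  have {xle}le_x i : (lead_coords x i <= lead_coords (d, Q, t) i)%N.
    by have := xle (unsplit i); rewrite !unsplitK.
  have lex : (x.2.1 <= t.1)%MM by apply/mnm_lepP => i; apply: (le_x (inl i)).
  have jx : x.2.2 = t.2.
    apply/enum_rank_inj/val_inj/eqP; rewrite eqn_leq.
    have /= le1 := le_x (inr (@Ordinal 3 1 isT)).
    have /= le2 := le_x (inr (@Ordinal 3 2 isT)).
    rewrite le1 /=; move: le2 (ltn_ord (enum_rank x.2.2)) (ltn_ord (enum_rank t.2)).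
    by move: #|_| (nat_of_ord _) (nat_of_ord _) => c a b; lia.
  exists x, (t.1 - x.2.1)%MM; split=> //.
    by rewrite /shiftT submK // jx; apply: surjective_pairing.
  have /= := le_x (inr (@Ordinal 3 0 isT)).
  have : mdeg t.1 = (mdeg (t.1 - x.2.1) + mdeg x.2.1)%N by rewrite -mdegD submK.
  case: Sx => _ bx [/bx le1 _]; case: SQ => _ bQ [/bQ le2 _] /=.
  move: le1 le2 => /=; lia.
exists [seq (x.1.2, x.2) | x <- s0]; split.
- by move=> p /mapP[x /s0S[Nx _ lx] ->].
- move=> Q t NQ lQ; have [d dQ] := cf_fin Q.
  have [|x [g [xs _ tE _]]] := divide d Q t; first by split.
  by exists g, (x.1.2, x.2); split=> //; apply: map_f.
move=> Q rho NQ; have [d dQ] := cf_fin Q.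
have [Q0|] := eqVneq Q 0; first by exists [::]; rewrite big_nil.
move=> /lead_exists[t lQ].
(* Induction on the number of monomials of degree at most [d] below the leading one. *)
move: {2}(count _ _).+1 (ltnSn (count (fun t' => t' <_o t) (mons_upto d))) => c.
elim: c => [//|c IH] in Q t NQ dQ lQ * => lt_c rhoQ.
have [|x [g [xs [Nx bx lx] tE le_d]]] := divide d Q t; first by split.
have [Pt Pmax] : is_lead (act g x.1.2) t by rewrite tE; apply: act_lead.
pose k := cf t Q / cf t (act g x.1.2); pose Q' := Q - scal k (act g x.1.2).
have kP : {in [:: (k, g, (x.1.2, x.2))], forall y : K * 'X_{1..m} * (V * T),
    y.2 \in [seq (x.1.2, x.2) | x <- s0] /\
    fun_mon omega y.1.2 + fun_at omega y.2.2 <= rho}.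
  move=> y; rewrite inE => /eqP -> /=; rewrite map_f //; split=> //.
  by rewrite -fun_at_shift -tE; apply: rhoQ; case: lQ.
have Q'Q t' : cf t' Q' != 0 -> t' <_o t.
  rewrite cfB => nz; have [t'E|ne] := eqVneq t' t.
    by case/eqP: nz; rewrite t'E /k divfK ?subrr.
  have [Qt'|] := eqVneq (cf t' Q) 0.
    have [|/eqP|//] := Pmax t'; last by rewrite (negPf ne).
    by apply: contraNneq nz => ->; rewrite Qt' mulr0 subrr.
  by case/(proj2 lQ) => // /eqP; rewrite (negPf ne).
have bounded_Q' : bounded d Q'.
  move=> u; rewrite cfB => nz; have [Qu|/dQ//] := eqVneq (cf u Q) 0.
  apply: leq_trans le_d; apply: (act_bounded bx).
  by apply: contraNneq nz => ->; rewrite Qu mulr0 subrr.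
have QE : Q = Q' + scal k (act g x.1.2) by rewrite subrK.
have [Q'0|] := eqVneq Q' 0.
  by exists [:: (k, g, (x.1.2, x.2))]; rewrite big_seq1 {1}QE Q'0 add0r.
move=> /lead_exists[t' lQ'].
have [||||r [rP Q'E]] := IH Q' t' _ _ lQ'.
- by apply: N_sub => //; apply: N_act.
- by [].
- have t't : t' <_o t by apply: Q'Q; case: lQ'.
  rewrite -ltnS; apply: leq_trans lt_c; rewrite ltnS.
  apply: (@count_lt _ _ _ _ t') => //; last by rewrite /tlt lex_lt_irr.
    by move=> u /lex_lt_trans; apply.
  by apply: mem_mons_upto; apply: bounded_Q'; case: lQ'.
- move=> u /Q'Q ut; apply: le_trans (tlt_le ut) (rhoQ _ _); by case: lQ.
exists ((k, g, (x.1.2, x.2)) :: r); split; last by rewrite big_cons -Q'E addrC -QE.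
move=> y; rewrite inE => /predU1P[->|/rP//]; apply: kP; exact: mem_head.
Qed.

End StandardBasis.

(** * Polynomial solutions of linear systems approximate formal ones *)

Lemma mcoeffXM n (K : nzRingType) (p : {mpoly K[n]}) a m :
  ('X_[a] * p)@_m = if (a <= m)%MM then p@_(m - a) else 0.
Proof.
rewrite -(commr_mpolyX a p); case: ifP => [le_am|/negbT nle].
  by rewrite -{1}(submK le_am) addmC mcoeffMX.
apply: memN_msupp_eq0; rewrite (perm_mem (msuppMX _ _)).
by apply: contra nle => /mapP[b _ ->]; apply: lem_addr.
Qed.

Lemma mp_fs_mulE n (K : comNzRingType) (p : {mpoly K[n]}) (f : fseries n K) m :
  (f * mp_fseries p) m = \sum_(a <- msupp p | (a <= m)%MM) p@_a * f (m - a)%MM.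
Proof.
rewrite mulrC [LHS](@fs_mul_coef _ _ _ _ p (fs_trunc (mdeg m).+1 f)) //; last first.
  by move=> k /lem_mdeg km; rewrite fs_truncE.
rewrite {1}[p]mpolyE mulr_suml raddf_sum /= [RHS]big_mkcond.
apply: eq_bigr => a _; rewrite -scalerAl mcoeffZ mcoeffXM.
case: ifP => [le_am|_]; rewrite ?mulr0 // fs_truncE // ltnS.
exact: mdegB.
Qed.

Lemma mp_fseries_is_zmod_morphism n (K : comNzRingType) :
  zmod_morphism (@mp_fseries n K).
Proof. by move=> p q; apply: funext => m; rewrite /mp_fseries mcoeffB. Qed.

Lemma mp_fseries_is_monoid_morphism n (K : comNzRingType) :
  monoid_morphism (@mp_fseries n K).
Proof.
split=> // p q; apply: funext => m; apply/esym/fs_mul_coef => k _ //.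
Qed.

HB.instance Definition _ n (K : comNzRingType) :=
  GRing.isZmodMorphism.Build {mpoly K[n]} (fseries n K) (@mp_fseries n K)
    (@mp_fseries_is_zmod_morphism n K).
HB.instance Definition _ n (K : comNzRingType) :=
  GRing.isMonoidMorphism.Build {mpoly K[n]} (fseries n K) (@mp_fseries n K)
    (@mp_fseries_is_monoid_morphism n K).

Section PolyModules.
Variables (n : nat) (K : fieldType).

(** The order it induces has the terms of lowest degree as leading terms. *)
Definition local_fun (J : finType) : functional int n J := (fun=> -1, fun=> 0).

Lemma local_funE (J : finType) t : fun_at (local_fun J) t = - (mdeg t.1)%:R.
Proof.
by rewrite -deg_funE /fun_at /= !addr0 -sumrN; apply: eq_bigr => i _; rewrite mulNr.
Qed.

Lemma local_monE (J : finType) g : fun_mon (local_fun J) g = - (mdeg g)%:R.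
Proof.
rewrite /fun_mon mdegE natr_sum -sumrN.
by apply: eq_bigr => i _; rewrite mulN1r.
Qed.

Definition pcoef (J : finType) (t : 'X_{1..n} * J) (v : {ffun J -> {mpoly K[n]}}) : K :=
  (v t.2)@_t.1.

Definition pact (J : finType) (g : 'X_{1..n}) (v : {ffun J -> {mpoly K[n]}}) :=
  [ffun j => 'X_[g] * v j].

Lemma poly_standard_basis (J : finType) (N : {ffun J -> {mpoly K[n]}} -> Prop) :
  (forall u c v, N u -> N v -> N (u - c *: v)) ->
  (forall g v, N v -> N (pact g v)) ->
  exists s : seq ({ffun J -> {mpoly K[n]}} * ('X_{1..n} * J)),
  [/\ {in s, forall p, N p.1 /\ is_lead (local_fun J) (@pcoef J) p.1 p.2},
      forall Q, N Q -> Q != 0 -> exists t g p,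
        [/\ is_lead (local_fun J) (@pcoef J) Q t, p \in s & t = shiftT g p.2] &
      forall Q d, N Q -> (forall t, pcoef t Q != 0 -> (d <= mdeg t.1)%N) ->
      exists r : seq (K * 'X_{1..n} * ({ffun J -> {mpoly K[n]}} * ('X_{1..n} * J))),
        {in r, forall x, x.2 \in s /\ (d <= mdeg x.1.2 + mdeg x.2.2.1)%N} /\
        Q = \sum_(x <- r) x.1.1 *: pact x.1.2 x.2.1].
Proof.
move=> N_sub N_act.
have cfB t u c v : @pcoef J t (u - c *: v) = pcoef t u - c * pcoef t v.
  by rewrite /pcoef !ffunE mcoeffB mcoeffZ.
have cf_ext v : (forall t, @pcoef J t v = 0) -> v = 0.
  move=> v0; apply/ffunP => j; rewrite ffunE; apply/mpolyP => a.
  by rewrite mcoeff0; apply: (v0 (a, j)).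
have cf_fin v : exists d, bounded (@pcoef J) d v.
  exists (\sum_j msize (v j))%N => t; rewrite -mcoeff_msupp => /msize_mdeg_lt/ltnW.
  by move/leq_trans; apply; rewrite (bigD1 t.2) //= leq_addr.
have act_cf g v t : @pcoef J t (pact g v) =
    if (g <= t.1)%MM then pcoef ((t.1 - g)%MM, t.2) v else 0.
  by rewrite /pcoef ffunE mcoeffXM.
have act_supp g v t : @pcoef J t (pact g v) != 0 ->
    exists2 t', t = shiftT g t' & pcoef t' v != 0.
  rewrite act_cf; case: ifP => [le_g nz|]; last by rewrite eqxx.
  exists ((t.1 - g)%MM, t.2) => //.
  by rewrite /shiftT addmC submK //; apply: surjective_pairing.
have act_bounded d g v : bounded (@pcoef J) d v ->
    bounded (@pcoef J) (mdeg g + d) (pact g v).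
  by move=> dv t /act_supp[t' -> /dv]; rewrite mdegD leq_add2l.
have act_lead g v t : is_lead (local_fun J) (@pcoef J) v t ->
    is_lead (local_fun J) (@pcoef J) (pact g v) (shiftT g t).
  move=> [tv tmax]; split.
    by rewrite act_cf lem_addr /= addmC addmK; case: (t) tv.
  move=> u /act_supp[t' -> /tmax[->|lt_t]]; first by left.
  by right; rewrite /tlt lex_lt_shift.
have [s [sN sl srep]] := standard_basis cfB cf_ext cf_fin act_bounded act_lead N_sub N_act.
exists s; split=> //.
  move=> Q NQ Q0; have [t lt] := lead_exists (local_fun J) cf_ext cf_fin Q0.
  by have [g [p [ps tE]]] := sl _ _ NQ lt; exists t, g, p.
move=> Q d NQ dQ; have [t tQ|r [rP QE]] := srep Q (- d%:R) NQ.
  by rewrite local_funE lerN2 ler_nat; apply: dQ.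
exists r; split=> // x /rP[xs]; rewrite local_monE local_funE -opprD lerN2 -natrD.
by rewrite ler_nat.
Qed.

(** This is the Artin-Rees argument: the polynomial truncation of a formal
    solution is mapped to an element of the image of the system of high order,
    which by controlled division is the image of a vector of high order. *)
Lemma poly_solutions_dense (J J' : finType) (M : J -> J' -> {mpoly K[n]})
    (Q : J -> fseries n K) (L : nat) :
  (forall j', \sum_j Q j * mp_fseries (M j j') = 0) ->
  exists Q' : {ffun J -> {mpoly K[n]}}, (forall j', \sum_j Q' j * M j j' = 0) /\
    forall j a, (mdeg a < L)%N -> (Q' j)@_a = Q j a.
Proof.
move=> QM; pose img (r : {ffun J -> {mpoly K[n]}}) := [ffun j' => \sum_j r j * M j j'].
have imgB u c v : img (u - c *: v) = img u - c *: img v.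
  apply/ffunP => j'; rewrite !ffunE scaler_sumr -sumrB; apply: eq_bigr => j _.
  by rewrite !ffunE mulrBl -scalerAl.
have imgX g v : img (pact g v) = pact g (img v).
  apply/ffunP => j'; rewrite !ffunE mulr_sumr; apply: eq_bigr => j _.
  by rewrite !ffunE mulrA.
have [||s [sN _ srep]] := @poly_standard_basis J' (fun v => exists r, v = img r).
- by move=> _ c _ [u ->] [v ->]; exists (u - c *: v); rewrite imgB.
- by move=> g _ [v ->]; exists (pact g v); rewrite imgX.
have /boolp.choice[pre preP] (v : {ffun J' -> {mpoly K[n]}}) :
    exists r, (exists r, v = img r) -> v = img r.
  by case: (pselect (exists r, v = img r)) => [[r ->]|no]; [exists r|exists 0].
(* The loss of order in the division: a coefficient of order [d - c0] times a
   generator with leading monomial of degree at most [c0]. *)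
pose c0 := (\max_(p <- s) mdeg p.2.1)%N.
pose QL : {ffun J -> {mpoly K[n]}} := [ffun j => fs_trunc (L + c0) (Q j)].
have [||r [rP imgQL]] := srep (img QL) (L + c0)%N.
- by exists QL.
- move=> t; apply: contraR; rewrite -ltnNge => lt_t; rewrite /pcoef ffunE raddf_sum /=.
  have /(congr1 (fun f : fseries n K => f t.1)) := QM t.2.
  rewrite /= fct_sumE => Q0; rewrite -[X in _ == X]Q0; apply/eqP/eq_bigr => j _.
  apply/esym/fs_mul_coef => k // /lem_mdeg le_k.
  by rewrite ffunE fs_truncE // (leq_ltn_trans le_k).
(* A preimage of the image of the truncation, of order at least [L]. *)
pose W : {ffun J -> {mpoly K[n]}} := \sum_(x <- r) x.1.1 *: pact x.1.2 (pre x.2.1).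
have img0 : img 0 = 0.
  by apply/ffunP => j'; rewrite !ffunE big1 // => j _; rewrite ffunE mul0r.
have imgD u v : img (u + v) = img u + img v.
  by apply/ffunP => j'; rewrite !ffunE -big_split; apply: eq_bigr => j _; rewrite ffunE mulrDl.
have imgZ c v : img (c *: v) = c *: img v.
  by have := imgB 0 (- c) v; rewrite img0 !sub0r !scaleNr !opprK.
have imgW : img W = img QL.
  rewrite imgQL /W; move: rP; elim: (r) => [|x r' IH] rP; rewrite ?big_nil ?big_cons //.
  rewrite imgD imgZ imgX -preP ?IH // => [y yr|]; first by apply: rP; rewrite inE yr orbT.
  by apply: (proj1 (sN _ _)); apply: (proj1 (rP _ (mem_head _ _))).
exists (QL - W); split=> [j'|j a lt_a].
  have := imgB QL 1 W; rewrite !scale1r imgW subrr => /ffunP/(_ j').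
  by rewrite !ffunE.
rewrite !ffunE mcoeffB fs_truncE ?(leq_trans lt_a) ?leq_addr //.
rewrite -[RHS]subr0; congr (_ - _); rewrite /W sum_ffunE raddf_sum big_seq big1 // => x xr.
rewrite !ffunE /= mcoeffZ mcoeffXM; case: ifP => [/lem_mdeg le_a|]; last by rewrite mulr0.
have [xs le_d] := rP x xr.
have : (mdeg x.2.2.1 <= c0)%N by apply: (leq_bigmax_seq (F := fun p : {ffun J' -> {mpoly K[n]}} * ('X_{1..n} * J') => mdeg p.2.1)).
by move=> le_c; have := leq_trans le_d (leq_add le_a le_c); rewrite leq_add2r leqNgt lt_a.
Qed.

End PolyModules.

(** * Division of convergent power series and flatness *)

(** The value of the iterates of [Phi] at [t] no longer changes after [h t] steps. *)
Lemma wf_fixpoint (T : Type) (K : Type) (k0 : K) (h : T -> nat)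
    (Phi : (T -> K) -> T -> K) :
  (forall u u' t, (forall t', (h t' < h t)%N -> u t' = u' t') -> Phi u t = Phi u' t) ->
  exists u, forall t, u t = Phi u t.
Proof.
move=> local_Phi; pose U k := iter k Phi (fun=> k0).
have stable k : forall t l l', (h t <= k)%N -> (h t < l)%N -> (h t < l')%N -> U l t = U l' t.
  elim/ltn_ind: k => k IH t [//|l] [//|l'] tk tl tl' /=.
  apply: local_Phi => t' t't; apply: (IH (h t')) => //; first exact: leq_trans tk.
    exact: leq_trans t't _.
  exact: leq_trans t't _.
exists (fun t => U (h t).+1 t) => t /=; apply: local_Phi => t' t't.
exact: (stable (h t') t' (h t) (h t').+1).
Qed.

Section LocalWeights.
Variables (n : nat) (J : finType) (lam : 'I_n -> nat) (mu : J -> nat).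

Definition wdeg (t : 'X_{1..n} * J) : nat := (\sum_i lam i * t.1 i + mu t.2)%N.

Lemma wdeg_shift g t : wdeg (shiftT g t) = (\sum_i lam i * g i + wdeg t)%N.
Proof.
rewrite /wdeg addnA /= -big_split; congr (_ + _)%N.
by apply: eq_bigr => i _; rewrite mnmDE mulnDr.
Qed.

End LocalWeights.

(** The order that looks at low degrees first agrees, on finitely many
    comparisons, with positive weights; these are the exponents of the polyradius
    for which the leading terms dominate. *)
Lemma local_weights n (J : finType) (s : seq (('X_{1..n} * J) * ('X_{1..n} * J))) :
  {in s, forall p, tlt (local_fun n J) p.1 p.2} ->
  exists (lam : 'I_n -> nat) (mu : J -> nat), (forall i, (0 < lam i)%N) /\
    {in s, forall p, (wdeg lam mu p.2 < wdeg lam mu p.1)%N}.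
Proof.
move=> lt_s; set v := local_fun n J.
have [|L LP] := @lex_lt_functional n J (tie_break _ _ _)
    [seq p <- s | fun_at v p.1 == fun_at v p.2].
  move=> p; rewrite mem_filter => /andP[/eqP eqv /lt_s]; rewrite /tlt /=.
  by rewrite -/v eqv ltxx eqxx.
have [|Z0 Z0P] := @lex_combine _ _ v L s.
  move=> p ps; move: (lt_s p ps); rewrite /tlt /= => /orP[|/andP[eqL _]]; first by left.
  by right; split; [apply/eqP|apply: LP; rewrite mem_filter eqL].
(* A factor [Z] this large also makes the weights of the variables positive. *)
pose Z := Num.max Z0 (1 + \sum_i `|L.1 i|); pose C := \sum_j `|L.2 j|.
have lam_gt0 i : 1 <= Z - L.1 i.
  rewrite lerBrDr (@le_trans _ _ (1 + \sum_i `|L.1 i|)) //; last first.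
    by rewrite /Z le_max lexx orbT.
  rewrite lerD2l (le_trans (ler_norm _)) // (bigD1 i) //= lerDl.
  exact: sumr_ge0.
have mu_ge0 j : 0 <= C - L.2 j.
  rewrite subr_ge0 (le_trans (ler_norm _)) // /C (bigD1 j) //= lerDl.
  exact: sumr_ge0.
exists (fun i => `|(Z - L.1 i)%R|%N), (fun j => `|(C - L.2 j)%R|%N); split=> [i|p ps].
  by have := lam_gt0 i; lia.
have wdegE t : (wdeg (fun i => `|(Z - L.1 i)%R|%N) (fun j => `|(C - L.2 j)%R|%N) t)%:Z =
    C - fun_at (fun_comb Z v L) t.
  rewrite /wdeg PoszD fun_combE local_funE /fun_at gez0_abs //.
  rewrite (big_morph Posz PoszD (erefl 0)) mdegE natr_sum.
  rewrite mulrN mulr_sumr opprD opprK [in RHS]opprD.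
  have -> : \sum_i Posz (`|(Z - L.1 i)%R|%N * t.1 i) =
      \sum_i Z * (t.1 i)%:R - \sum_i L.1 i * (t.1 i)%:R.
    rewrite -sumrB; apply: eq_bigr => i _; rewrite PoszM gez0_abs ?mulrBl //.
      by rewrite !natz.
    exact: le_trans (lam_gt0 i).
  by ring.
have /(_ Z)/(_ _ p ps) := Z0P; rewrite /Z le_max lexx => /(_ isT) lt_p.
by rewrite -ltz_nat !wdegE ltrD2l ltrN2.
Qed.

Definition geom_bounded n (K : numFieldType) (r C : K) (f : fseries n K) :=
  forall m, `|f m| * r ^+ mdeg m <= C.

Lemma convergent_common n (K : numFieldType) (J : finType) (Q : J -> fseries n K) :
  (forall j, convergent (Q j)) ->
  exists r C : K, [/\ 0 < r, r <= 1, 0 <= C & forall j, geom_bounded r C (Q j)].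
Proof.
move=> cQ; have {cQ}/boolp.choice[C cC] := cQ; have {cC}/boolp.choice[rho rhoP] := cC.
(* Radii below 1, so that their product is below each of them. *)
pose r j := rho j / (1 + rho j).
have den j : 0 < 1 + rho j by rewrite addr_gt0 //; case: (rhoP j).
have r01 j : 0 < r j <= 1.
  by case: (rhoP j) => r0 _; rewrite divr_gt0 //= ler_pdivrMr // mul1r lerDr.
have r_rho j : r j <= rho j.
  by rewrite ler_pdivrMr // mulrDr mulr1 lerDl mulr_ge0 //; case: (rhoP j) => /ltW.
pose p := \prod_j r j; have p_gt0 : 0 < p by apply: prodr_gt0 => j _; case/andP: (r01 j).
have p_le j : p <= r j.
  rewrite /p (bigD1 j) //= -[leRHS]mulr1 ler_pM2l; last by case/andP: (r01 j).
  by apply: prodr_ile1 => i; case/andP: (r01 i) => /ltW -> ->.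
have C_ge0 j : 0 <= C j.
  by case: (rhoP j) => r0 /(_ 0%MM); apply: le_trans; rewrite mulr_ge0 ?exprn_ge0 // ltW.
exists p, (\sum_j C j); split=> //.
- by apply: prodr_ile1 => i; case/andP: (r01 i) => /ltW -> ->.
- exact: sumr_ge0.
move=> j m; apply: (@le_trans _ _ (C j)); last first.
  by rewrite (bigD1 j) //= lerDl sumr_ge0.
case: (rhoP j) => rho0 /(_ m); apply: le_trans; rewrite ler_wpM2l //.
apply: lerXn2r; rewrite ?nnegrE; [exact: ltW|exact: ltW|].
exact: le_trans (p_le j) (r_rho j).
Qed.

Section Division.
Variables (n : nat) (K : numFieldType) (J : finType) (N : nat).
Local Notation T := ('X_{1..n} * J)%type.
Variables (P : 'I_N -> J -> {mpoly K[n]}) (l : 'I_N -> T).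

Definition owner (t : T) : option 'I_N :=
  [pick i | ((l i).2 == t.2) && ((l i).1 <= t.1)%MM].

Lemma owner_shift g i : owner (shiftT g (l i)) != None.
Proof.
by rewrite /owner; case: pickP => // /(_ i); rewrite /= eqxx lem_addl.
Qed.

Definition leadc i : K := (P i (l i).2)@_(l i).1.

(** The quotients and the remainder of a division are stored in a single [u]:
    the value at a multiple of a leading monomial belongs to the quotient by its
    owner, and at the other monomials to the remainder. *)
Definition quo (u : T -> K) (i : 'I_N) : fseries n K := fun g =>
  if owner (shiftT g (l i)) == Some i then u (shiftT g (l i)) / leadc i else 0.

Definition div_tail (u : T -> K) (t : T) : K :=
  \sum_i \sum_(a <- msupp (P i t.2) | (a <= t.1)%MM && ((a, t.2) != l i))
     (P i t.2)@_a * quo u i (t.1 - a)%MM.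

Hypothesis leadc_neq0 : forall i, leadc i != 0.

Lemma div_tailE u t :
  (\sum_i quo u i * mp_fseries (P i t.2)) t.1 =
  div_tail u t + (if owner t is Some _ then u t else 0).
Proof.
rewrite fct_sumE; under eq_bigr => i _ do rewrite mp_fs_mulE.
have -> : (if owner t is Some _ then u t else 0) =
    \sum_i (if owner t == Some i then u t else 0).
  case: (owner t) => [i|]; last by rewrite big1.
  rewrite (bigD1 i) //= eqxx big1 ?addr0 // => i' ne.
  by case: eqP => // -[iE]; rewrite iE eqxx in ne.
rewrite /div_tail -big_split; apply: eq_bigr => i _ /=.
rewrite (bigID (fun a => (a, t.2) == l i)) /= addrC; congr (_ + _).
have [/andP[/eqP lj la]|nl] := boolP (((l i).2 == t.2) && ((l i).1 <= t.1)%MM); last first.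
  rewrite big1 => [|a /andP[le_a /eqP lE]]; last first.
    by move: nl; rewrite -lE /= eqxx le_a.
  rewrite /owner; case: pickP => // i' i'P; case: eqP => // -[iE].
  by move: nl; rewrite -iE i'P.
rewrite -big_filter (bigD1_seq (l i).1) ?filter_uniq ?msupp_uniq //=; last first.
  rewrite mem_filter la -lj -surjective_pairing eqxx mcoeff_msupp.
  exact: leadc_neq0.
rewrite big1_seq ?addr0 => [|a /andP[ne]]; last first.
  by rewrite mem_filter => /andP[/andP[_ /eqP lE] _]; rewrite -lE eqxx in ne.
have tE : shiftT (t.1 - (l i).1)%MM (l i) = t.
  by rewrite /shiftT submK // lj -surjective_pairing.
rewrite /quo tE; case: ifP => _; last by rewrite mulr0.
by rewrite -{1}lj mulrC divfK.
Qed.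

Variables (lam : 'I_n -> nat) (mu : J -> nat).
Hypothesis lam_gt0 : forall i, (0 < lam i)%N.
Local Notation wdeg := (wdeg lam mu).
Hypothesis wdeg_tail : forall i j a, a \in msupp (P i j) -> (a, j) != l i ->
  (wdeg (l i) < wdeg (a, j))%N.

Lemma wdeg_lower i t a : (a <= t.1)%MM -> a \in msupp (P i t.2) -> (a, t.2) != l i ->
  (wdeg (shiftT (t.1 - a)%MM (l i)) < wdeg t)%N.
Proof.
move=> le_a aP ne; have tE : t = shiftT (t.1 - a)%MM (a, t.2).
  by rewrite /shiftT submK // -surjective_pairing.
by rewrite [X in (_ < wdeg X)%N]tE !wdeg_shift ltn_add2l wdeg_tail.
Qed.

Lemma div_exists (f : T -> K) : exists u, forall t, u t = f t - div_tail u t.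
Proof.
apply: (wf_fixpoint 0 (h := wdeg)) => u u' t uu'; congr (_ - _).
apply: eq_bigr => i _; rewrite big_seq_cond [RHS]big_seq_cond.
apply: eq_bigr => a /andP[aP /andP[le_a ne]]; congr (_ * _); rewrite /quo uu' //.
exact: wdeg_lower.
Qed.

Lemma mdeg_le_wdeg t : (mdeg t.1 <= wdeg t)%N.
Proof.
rewrite mdegE (leq_trans _ (leq_addr _ _)) // leq_sum // => i _.
by rewrite leq_pmull.
Qed.

(** In the polyradius [eps ^ lam i] with [eps] small, the tails of the divisors
    have together at most half the size of the leading terms, whence the bound
    [2 C] for a dividend bounded by [C]. *)
Lemma div_bounded (f u : T -> K) (r C : K) : 0 < r -> r <= 1 -> 0 <= C ->
  (forall t, `|f t| * r ^+ mdeg t.1 <= C) ->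
  (forall t, u t = f t - div_tail u t) ->
  exists2 eps : K, 0 < eps <= 1 & forall t, `|u t| * eps ^+ wdeg t <= 2 * C.
Proof.
move=> r_gt0 r_le1 C_ge0 fC uE.
pose A j := \sum_i \sum_(a <- msupp (P i j)) `|(P i j)@_a / leadc i|.
have A_ge0 j : 0 <= A j by apply: sumr_ge0 => i _; apply: sumr_ge0.
pose B := 2 * (1 + \sum_j A j).
have AB j : 2 * A j <= B.
  rewrite ler_pM2l // (bigD1 j) //= addrCA lerDl addr_ge0 //; exact: sumr_ge0.
have B_ge1 : 1 <= B.
  by rewrite /B mulrDr mulr1 (@le_trans _ _ 2) ?ler1n // lerDl mulr_ge0 // sumr_ge0.
have B_gt0 : 0 < B by apply: lt_le_trans B_ge1.
pose eps := r / B; have eps_gt0 : 0 < eps by apply: divr_gt0.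
have eps_r : eps <= r by rewrite ler_pdivrMr // ler_peMr // ltW.
have eps_le1 : eps <= 1 by apply: le_trans r_le1.
have eps_ge0 : 0 <= eps by apply: ltW.
have epsB : eps * B = r by rewrite divfK ?gt_eqF.
clearbody eps; exists eps => [|t]; first by rewrite eps_gt0.
move: {2}(wdeg t) (erefl (wdeg t)) => k; elim/ltn_ind: k t => k IH t tk.
rewrite uE (le_trans (ler_wpM2r (exprn_ge0 _ eps_ge0) (ler_normB _ _))) //.
rewrite mulrDl mulr_natl mulr2n lerD //.
  apply: le_trans (fC t); rewrite ler_wpM2l //.
  apply: (@le_trans _ _ (eps ^+ mdeg t.1)).
    exact/ler_wiXn2l/mdeg_le_wdeg.
  by apply: lerXn2r; rewrite ?nnegrE // ltW.
have term i a : a \in msupp (P i t.2) -> (a <= t.1)%MM -> (a, t.2) != l i ->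
    `|(P i t.2)@_a * quo u i (t.1 - a)%MM| * eps ^+ wdeg t <=
    `|(P i t.2)@_a / leadc i| * (eps * (2 * C)).
  move=> aP le_a ne; have lt_w := wdeg_lower le_a aP ne; rewrite /quo; case: ifP => _.
    rewrite [in leLHS]mulrA [in leLHS]mulrAC normrM -mulrA ler_wpM2l //.
    move: lt_w; set t' := shiftT _ _ => lt_w.
    have ut' := IH _ (leq_trans lt_w (eq_leq tk)) t' erefl.
    rewrite -(subnKC lt_w) exprD exprSr -[X in _ * X]mulrA [X in X <= _]mulrA [eps * (2 * C)]mulrC ler_pM //.
    - by rewrite mulr_ge0 ?exprn_ge0.
    - by rewrite mulr_ge0 ?exprn_ge0.
    - by rewrite ler_piMr ?exprn_ile1.
  by rewrite mulr0 normr0 mul0r !mulr_ge0 ?ler0n.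
apply: (@le_trans _ _ (A t.2 * (eps * (2 * C)))); last first.
  have -> : A t.2 * (eps * (2 * C)) = eps * (2 * A t.2) * C by ring.
  rewrite ler_piMl // (le_trans _ r_le1) // -epsB.
  by rewrite ler_wpM2l.
rewrite (le_trans (ler_wpM2r (exprn_ge0 _ eps_ge0) (ler_norm_sum _ _ _))) //.
rewrite !mulr_suml ler_sum // => i _.
rewrite (le_trans (ler_wpM2r (exprn_ge0 _ eps_ge0) (ler_norm_sum _ _ _))) //.
rewrite !mulr_suml big_mkcond [leRHS]big_seq big_seq ler_sum // => a aP.
case: ifP => [/andP[le_a ne]|_]; first exact: term.
by rewrite !mulr_ge0.
Qed.

(** The polyradius [eps ^ lam i] contains the polydisc of radius [eps ^ Lam],
    [Lam] being the sum of the weights. *)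
Lemma quo_convergent (u : T -> K) (eps C : K) i : 0 < eps <= 1 -> 0 <= C ->
  (forall t, `|u t| * eps ^+ wdeg t <= C) -> convergent (quo u i).
Proof.
move=> /andP[eps_gt0 eps_le1] C_ge0 uC; pose Lam := (\sum_i lam i)%N.
have eps_ge0 : 0 <= eps by apply: ltW.
have den_gt0 : 0 < `|leadc i| * eps ^+ wdeg (l i).
  by rewrite mulr_gt0 ?normr_gt0 ?leadc_neq0 ?exprn_gt0.
exists (C / (`|leadc i| * eps ^+ wdeg (l i))), (eps ^+ Lam); split=> [|g].
  exact: exprn_gt0.
rewrite ler_pdivlMr // /quo; case: ifP => _; last by rewrite normr0 !mul0r.
set t' := shiftT _ _; rewrite normrM normfV.
have lc0 : `|leadc i| != 0 by rewrite normr_eq0 leadc_neq0.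
have -> : `|u t'| / `|leadc i| * (eps ^+ Lam) ^+ mdeg g * (`|leadc i| * eps ^+ wdeg (l i)) =
    `|u t'| * eps ^+ (Lam * mdeg g + wdeg (l i)).
  by rewrite exprD exprM; field.
apply: le_trans (uC t'); rewrite ler_wpM2l //; apply: ler_wiXn2l => //.
rewrite wdeg_shift leq_add2r mdegE big_distrr leq_sum //= => k _.
by rewrite leq_mul2r /Lam (bigD1 k) //= leq_addr orbT.
Qed.

End Division.

(** Formal solutions are divided by a standard basis of the module of polynomial
    solutions. The quotients converge; the remainder is a formal solution, and
    it vanishes because its leading monomial would be the one of a polynomial
    solution, hence a multiple of one that was divided out. *)
Theorem convergent_flat n (K : numFieldType) (J J' : finType)
    (M : J -> J' -> {mpoly K[n]}) (Q : J -> fseries n K) :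
  (forall j, convergent (Q j)) ->
  (forall j', \sum_j Q j * mp_fseries (M j j') = 0) ->
  exists N (S : 'I_N -> fseries n K) (P : 'I_N -> J -> {mpoly K[n]}),
  [/\ forall i, convergent (S i), forall i j', \sum_j P i j * M j j' = 0 &
      forall j, Q j = \sum_i S i * mp_fseries (P i j)].
Proof.
move=> cQ QM; pose sol (v : {ffun J -> {mpoly K[n]}}) := forall j', \sum_j v j * M j j' = 0.
have [||s [sN sl _]] := @poly_standard_basis n K J sol.
- move=> u c v uM vM j'; transitivity (\sum_j u j * M j j' - c *: \sum_j v j * M j j').
    rewrite scaler_sumr -sumrB; apply: eq_bigr => j _.
    by rewrite !ffunE mulrBl -scalerAl.
  by rewrite uM vM scaler0 subr0.
- move=> g v vM j'; transitivity ('X_[g] * \sum_j v j * M j j').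
    by rewrite mulr_sumr; apply: eq_bigr => j _; rewrite ffunE mulrA.
  by rewrite vM mulr0.
pose p i := tnth (in_tuple s) i; have ps i : p i \in s by apply: mem_tnth.
pose P i j : {mpoly K[n]} := (p i).1 j; pose l i := (p i).2.
have PM i : forall j', \sum_j P i j * M j j' = 0 by case: (sN _ (ps i)).
have lead i : is_lead (local_fun n J) (@pcoef n K J) (p i).1 (l i) by case: (sN _ (ps i)).
have lc0 i : leadc P l i != 0 by case: (lead i).
pose tails := [seq x <- flatten [seq [seq ((a, j), q.2) | j <- enum J,
    a <- msupp (q.1 j : {mpoly K[n]})] | q : {ffun J -> {mpoly K[n]}} * ('X_{1..n} * J) <- s]
  | x.1 != x.2].
have [x|lam [mu [lam_gt0 wdegP]]] := @local_weights n J tails.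
  rewrite mem_filter => /andP[ne /flatten_mapP[q qs /allpairsPdep[j [a [_ aq xE]]]]].
  move: ne; rewrite xE /= => ne; have [_ [_ /(_ (a, j))]] := sN _ qs.
  by rewrite /pcoef -mcoeff_msupp => /(_ aq)[/eqP|//]; rewrite (negPf ne).
have wtail i j a : a \in msupp (P i j) -> (a, j) != l i ->
    (wdeg lam mu (l i) < wdeg lam mu (a, j))%N.
  move=> aP ne; apply: (wdegP ((a, j), l i)); rewrite mem_filter /= ne /=.
  apply/flatten_mapP; exists (p i) => //; apply/allpairsPdep; exists j, a.
  by rewrite mem_enum.
have [u uE] := div_exists wtail (fun t => Q t.2 t.1).
have [r [C [r0 r1 C0 QC]]] := convergent_common cQ.
have [eps eps01 ueps] := div_bounded lam_gt0 wtail r0 r1 C0 (fun t => QC t.2 t.1) uE.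
have C2 : 0 <= 2 * C by rewrite mulr_ge0.
have cS i : convergent (quo P l u i) by have := quo_convergent lc0 i eps01 C2 ueps.
exists (size s), (quo P l u), P; split=> // j.
pose rem j : fseries n K := Q j - \sum_i quo P l u i * mp_fseries (P i j).
have remE t : rem t.2 t.1 = if owner l t is Some _ then 0 else u t.
  have -> : rem t.2 t.1 = Q t.2 t.1 - (\sum_i quo P l u i * mp_fseries (P i t.2)) t.1 by [].
  rewrite div_tailE // [in LHS]opprD addrA -uE; case: owner => [_|]; first exact: subrr.
  exact: subr0.
have remM j' : \sum_j rem j * mp_fseries (M j j') = 0.
  under eq_bigr => k _ do rewrite mulrBl.
  rewrite sumrB QM sub0r; under eq_bigr => k _ do rewrite mulr_suml.
  rewrite exchange_big big1 ?oppr0 // => i _ /=.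
  rewrite -[RHS](mulr0 (quo P l u i)) -[X in _ = _ * X](rmorph0 (@mp_fseries n K)) -(PM i j').
  by rewrite rmorph_sum mulr_sumr; apply: eq_bigr => k _; rewrite rmorphM mulrA.
apply/eqP; rewrite -subr_eq0; apply/eqP/funext => a; apply/eqP/negPn/negP => nz.
(* A polynomial solution with the same leading monomial as the remainder. *)
have [Q' [Q'M Q'E]] := poly_solutions_dense (mdeg a).+1 remM.
have Q'a : pcoef (a, j) Q' != 0 by rewrite /pcoef Q'E.
have [|t [g [q [[tQ tmax] qs tE]]]] := sl _ Q'M.
  by apply: contraNneq Q'a => ->; rewrite /pcoef ffunE mcoeff0.
have le_ta : (mdeg t.1 <= mdeg a)%N.
  case: (tmax _ Q'a) => [<-//|/tlt_le]; rewrite !local_funE lerN2 ler_nat //.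
move: tQ; rewrite /pcoef Q'E ?ltnS // remE.
have [i qE] : exists i, q = p i.
  by have /tnthP[i ->] : q \in in_tuple s by []; exists i.
have : owner l t != None by rewrite tE qE; apply: owner_shift.
by case: owner => //; rewrite eqxx.
Qed.

(** * Monomials and gradings of the Weyl algebra *)

Section WeylBasics.
Variables (n : nat) (K : comNzRingType).
Local Notation D := (weyl n K).
Local Notation symbol := {mpoly {mpoly K[n]}[n]}.
Implicit Types (P Q : D) (a b x y k : 'X_{1..n}).

Lemma wcoefP P Q : (forall a b, wcoef P a b = wcoef Q a b) -> P = Q.
Proof.
move=> eqPQ; apply/(@mpolyP n _ (P : symbol) Q) => b; apply/mpolyP => a.
exact: eqPQ.
Qed.

Lemma wcoef0 a b : wcoef (0 : D) a b = 0.
Proof. by rewrite /wcoef !mcoeff0. Qed.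

Lemma wcoefD P Q a b : wcoef (P + Q) a b = wcoef P a b + wcoef Q a b.
Proof. by rewrite /wcoef (@mcoeffD _ _ b (P : symbol) Q) mcoeffD. Qed.

Lemma wcoefB P Q a b : wcoef (P - Q) a b = wcoef P a b - wcoef Q a b.
Proof. by rewrite /wcoef (@mcoeffB _ _ b (P : symbol) Q) mcoeffB. Qed.

Lemma wcoef_sum I (r : seq I) (p : pred I) (F : I -> D) a b :
  wcoef (\sum_(i <- r | p i) F i) a b = \sum_(i <- r | p i) wcoef (F i) a b.
Proof.
elim/big_ind2: _ => //; first exact: wcoef0.
by move=> x1 x2 y1 y2 <- <-; rewrite wcoefD.
Qed.

Lemma wcoefZ c P a b : wcoef (c *: P) a b = c * wcoef P a b.
Proof. by rewrite /wcoef (@mcoeffZ _ _ c%:MP_[n] (P : symbol)) mcoeffCM. Qed.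

Lemma wcoef_mon a b x y : wcoef (wmon K a b) x y = ((a == x) && (b == y))%:R.
Proof.
rewrite /wcoef /wmon mcoeffZ mcoeffX; case: (b == y); rewrite ?andbT ?andbF.
  by rewrite mulr1 mcoeffX.
by rewrite mulr0 mcoeff0.
Qed.

Lemma mem_wsupp P a b : ((a, b) \in wsupp P) = (wcoef P a b != 0).
Proof.
apply/allpairsPdep/idP => [[b' [a' [_ + [-> ->]]]]|nz].
  by rewrite mcoeff_msupp.
exists b, a; rewrite !mcoeff_msupp; split=> //.
by apply: contraNneq nz => b0; rewrite /wcoef b0 mcoeff0.
Qed.

Lemma wsupp_uniq P : uniq (wsupp P).
Proof.
apply: allpairs_uniq_dep => [|b _|]; rewrite ?msupp_uniq //.
by move=> [b1 a1] [b2 a2] _ _ /= [-> ->].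
Qed.

Lemma weylE P : P = \sum_(ab <- wsupp P) wcoef P ab.1 ab.2 *: wmon K ab.1 ab.2.
Proof.
apply: wcoefP => a b; rewrite wcoef_sum.
under eq_bigr => ab _ do rewrite wcoefZ wcoef_mon -[_ && _]/((ab.1, ab.2) == (a, b)) -surjective_pairing.
have [ab_in|] := boolP ((a, b) \in wsupp P).
  rewrite (bigD1_seq (a, b)) ?wsupp_uniq //= eqxx mulr1 big1 ?addr0 // => ab.
  by move/negPf ->; rewrite mulr0.
move=> ab_out; rewrite big1_seq => [|ab /andP[_ ab_in]].
  by apply/eqP; rewrite -[_ == _]negbK -mem_wsupp.
by case: eqP => [abE|_]; [rewrite -abE ab_in in ab_out|rewrite mulr0].
Qed.

Lemma weyl_scaleAl c P Q : c *: (P * Q) = c *: P * Q.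
Proof. exact/esym/dop_mulZl. Qed.

Lemma pderivm_scale c b (Q : symbol) :
  dop_pderivm (mp_derivations n K) b (c%:MP_[n] *: Q) =
  c%:MP_[n] *: dop_pderivm (mp_derivations n K) b Q.
Proof.
elim/dop_pderivm_ind: b => [|b i IH]; first by rewrite !dop_pderivm0.
by rewrite -!dop_pderiv_pderivm IH dop_pderivZ /= mderivC scale0r add0r.
Qed.

Lemma weyl_scaleAr c P Q : c *: (P * Q) = P * (c *: Q).
Proof.
change (c%:MP_[n] *: dop_mul (mp_derivations n K) P Q =
  dop_mul (mp_derivations n K) P (c%:MP_[n] *: (Q : symbol))).
rewrite /dop_mul scaler_sumr; apply: eq_bigr => b _.
by rewrite pderivm_scale !scalerA mulrC.
Qed.

Lemma wmon_mul a b Q :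
  wmon K a b * Q = ('X_[a] : {mpoly K[n]}) *: dop_pderivm (mp_derivations n K) b Q.
Proof.
change (dop_mul (mp_derivations n K) (wmon K a b) Q = 'X_[a] *: dop_pderivm (mp_derivations n K) b Q).
by rewrite /wmon dop_mulZl dop_mulX.
Qed.

Lemma pderiv_wmon i a b : dop_pderiv (mp_derivations n K) i (wmon K a b) =
  (a i)%:R *: wmon K (a - U_(i))%MM b + wmon K a (b + U_(i))%MM :> D.
Proof.
rewrite /wmon dop_pderivZ dop_pderivX /= mderivX; congr (_ + _).
rewrite -[_ *: 'X_[_ - _]]mul_mpolyC; set s := ('X_[b] : symbol).
exact: (esym (scalerA ((a i)%:R)%:MP_[n] 'X_[a - U_(i)] s)).
Qed.

(** [P] consists of terms obtained from [x^a \partial^b] by removing as many [x]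
    as [\partial], which is what the Weyl relations produce. *)
Definition wlower a b P :=
  forall x y, wcoef P x y != 0 -> exists k, [/\ k != 0%MM, a = (x + k)%MM & b = (y + k)%MM].

Lemma wlowerD a b P Q : wlower a b P -> wlower a b Q -> wlower a b (P + Q).
Proof.
move=> lP lQ x y; rewrite wcoefD; have [->|/lP //] := eqVneq (wcoef P x y) 0.
by rewrite add0r => /lQ.
Qed.

Lemma wlowerZ a b c P : wlower a b P -> wlower a b (c *: P).
Proof.
move=> lP x y; rewrite wcoefZ => nz; apply: lP.
by apply: contraNneq nz => ->; rewrite mulr0.
Qed.

Lemma wlower_pderiv i a b P : wlower a b P ->
  wlower a (b + U_(i))%MM (dop_pderiv (mp_derivations n K) i P : D).
Proof.
move=> lP; have -> : dop_pderiv (mp_derivations n K) i P =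
    \sum_(xy <- wsupp P) wcoef P xy.1 xy.2 *:
      (dop_pderiv (mp_derivations n K) i (wmon K xy.1 xy.2) : D) :> D.
  rewrite {1}[P]weylE (raddf_sum (dop_pderiv (mp_derivations n K) i)) /=.
  apply: eq_bigr => xy _; rewrite -[RHS]/(_%:MP_[n] *: _).
  by rewrite -[X in dop_pderiv _ _ X]/(_%:MP_[n] *: _) dop_pderivZ /= mderivC scale0r add0r.
rewrite big_seq; elim/big_ind: _ => // [x y|u v|xy]; first by rewrite wcoef0 eqxx.
  exact: wlowerD.
rewrite [xy]surjective_pairing mem_wsupp => /lP[k [k0 aE bE]].
apply: wlowerZ; rewrite pderiv_wmon; apply: wlowerD => [x y|x y].
  rewrite wcoefZ wcoef_mon; have [x0|xi] := eqVneq (xy.1 i) 0%N.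
    by rewrite x0 mul0r eqxx.
  case: andP => [[/eqP <- /eqP <-] _|_]; last by rewrite mulr0 eqxx.
  exists (k + U_(i))%MM; split; first by rewrite mnmD_eq0 mnm1_eq0 andbF.
    by rewrite [(k + _)%MM]addmC addmA submK ?lep1mP.
  by rewrite bE addmA.
rewrite wcoef_mon; case: andP => [[/eqP <- /eqP <-] _|_]; last by rewrite eqxx.
by exists k; rewrite aE bE -!addmA [(k + _)%MM]addmC.
Qed.

Lemma pderivm_wmon a b b' :
  wlower a (b + b')%MM (dop_pderivm (mp_derivations n K) b (wmon K a b') - wmon K a (b + b')%MM : D).
Proof.
elim/dop_pderivm_ind: b => [|b i IH].
  by rewrite dop_pderivm0 add0m => x y; rewrite wcoefB subrr eqxx.
rewrite -dop_pderiv_pderivm.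
have -> : (dop_pderiv (mp_derivations n K) i (dop_pderivm (mp_derivations n K) b (wmon K a b'))
    - wmon K a (b + U_(i) + b')%MM : D) =
    dop_pderiv (mp_derivations n K) i (dop_pderivm (mp_derivations n K) b (wmon K a b') -
      wmon K a (b + b')%MM) + ((a i)%:R *: wmon K (a - U_(i))%MM (b + b')%MM).
  rewrite raddfB /= pderiv_wmon; set u := dop_pderiv _ _ _; set v := _ *: _.
  have -> : (b + U_(i) + b' = b + b' + U_(i))%MM by rewrite -!addmA [(U_(i) + _)%MM]addmC.
  set z := wmon _ _ _; rewrite -[RHS]/((u - (v + z) : D) + v).
  by rewrite opprD addrA addrAC subrK.
apply: wlowerD.
  by rewrite -addmA [(U_(i) + _)%MM]addmC addmA; apply: wlower_pderiv.
move=> x y; rewrite wcoefZ wcoef_mon.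
have [a0|ai] := eqVneq (a i) 0%N; first by rewrite a0 mul0r eqxx.
case: andP => [[/eqP <- /eqP <-] _|_]; last by rewrite mulr0 eqxx.
exists U_(i)%MM; rewrite mnm1_eq0 submK ?lep1mP //; split=> //.
by rewrite -!addmA [(U_(i) + _)%MM]addmC.
Qed.

(** Moving [\partial^b] to the right of [x^a'] removes equally many [x] and
    [\partial]. *)
Lemma wmon_mul_lower a b a' b' :
  wlower (a + a')%MM (b + b')%MM (wmon K a b * wmon K a' b' - wmon K (a + a')%MM (b + b')%MM).
Proof.
have -> : wmon K a b * wmon K a' b' - wmon K (a + a')%MM (b + b')%MM =
   ('X_[a] : {mpoly K[n]}) *: ((dop_pderivm (mp_derivations n K) b (wmon K a' b') : symbol) -
     wmon K a' (b + b')%MM) :> D.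
  rewrite wmon_mul [RHS]scalerBr; congr (_ - _).
  by rewrite /wmon scalerA mpolyXD.
move=> x y; rewrite /wcoef mcoeffZ mcoeffXM; case: ifP => [le_ax nz|]; last by rewrite eqxx.
have [k [k0 aE bE]] := pderivm_wmon nz; exists k; split=> //.
by rewrite aE addmA [(a + _)%MM]addmC submK.
Qed.

Lemma wcoef_mul P Q x y : wcoef (P * Q) x y =
  \sum_(p <- wsupp P) \sum_(q <- wsupp Q) wcoef P p.1 p.2 * wcoef Q q.1 q.2 *
     wcoef (wmon K p.1 p.2 * wmon K q.1 q.2) x y.
Proof.
rewrite {1}[P]weylE {1}[Q]weylE mulr_suml wcoef_sum; apply: eq_bigr => p _.
rewrite mulr_sumr wcoef_sum; apply: eq_bigr => q _.
by rewrite -weyl_scaleAl -weyl_scaleAr !wcoefZ mulrA.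
Qed.

Lemma wsupp_mul P Q x y : wcoef (P * Q) x y != 0 -> exists p q k,
  [/\ wcoef P p.1 p.2 != 0, wcoef Q q.1 q.2 != 0,
      (p.1 + q.1 = x + k)%MM & (p.2 + q.2 = y + k)%MM].
Proof.
rewrite wcoef_mul => nz.
have [p pP nzp] : exists2 p, p \in wsupp P & \sum_(q <- wsupp Q) wcoef P p.1 p.2 *
    wcoef Q q.1 q.2 * wcoef (wmon K p.1 p.2 * wmon K q.1 q.2) x y != 0.
  apply: contrapT => no; case/negP: nz; rewrite big1_seq // => p /andP[_ pP].
  by apply/eqP/negPn/negP => nzp; apply: no; exists p.
have [q qQ nzq] : exists2 q, q \in wsupp Q & wcoef P p.1 p.2 *
    wcoef Q q.1 q.2 * wcoef (wmon K p.1 p.2 * wmon K q.1 q.2) x y != 0.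
  apply: contrapT => no; case/negP: nzp; rewrite big1_seq // => q /andP[_ qQ].
  by apply/eqP/negPn/negP => nzq; apply: no; exists q.
have nzm : wcoef (wmon K p.1 p.2 * wmon K q.1 q.2) x y != 0.
  by apply: contraNneq nzq => ->; rewrite mulr0.
have [k pk] : exists k, (p.1 + q.1 = x + k)%MM /\ (p.2 + q.2 = y + k)%MM.
  have := @wmon_mul_lower p.1 p.2 q.1 q.2 x y.
  rewrite wcoefB wcoef_mon; case: andP => [[/eqP xE /eqP yE] _|_].
    by exists 0%MM; rewrite !addm0.
  by rewrite subr0 => /(_ nzm)[k [_ ? ?]]; exists k.
exists p, q, k; case: pk; split=> //; rewrite -mem_wsupp -surjective_pairing //.
Qed.

(** The hypothesis says that no term of [Q] can contribute to the coefficient on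
    the left by losing pairs [x, \partial]. *)
Lemma wcoef_mon_mul a b x y Q :
  (forall k, k != 0%MM -> wcoef Q (x + k)%MM (y + k)%MM = 0) ->
  wcoef (wmon K a b * Q) (a + x)%MM (b + y)%MM = wcoef Q x y.
Proof.
move=> topQ; rewrite {1}[Q]weylE mulr_sumr wcoef_sum.
under eq_bigr => q _ do rewrite -weyl_scaleAr wcoefZ.
have lowq q : q \in wsupp Q -> q != (x, y) ->
    wcoef (wmon K a b * wmon K q.1 q.2) (a + x)%MM (b + y)%MM = 0.
  move=> qQ ne; apply/eqP/negPn/negP => nz.
  have := @wmon_mul_lower a b q.1 q.2 (a + x)%MM (b + y)%MM.
  rewrite wcoefB wcoef_mon; case: andP => [[/eqP/addmI xE /eqP/addmI yE] _|_].
    by rewrite [q]surjective_pairing xE yE eqxx in ne.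
  rewrite subr0 => /(_ nz)[k [k0]]; rewrite -!addmA => /addmI qx /addmI qy.
  have := topQ _ k0; rewrite -qx -qy => /eqP; apply/negP.
  by rewrite -mem_wsupp -surjective_pairing.
have self : wcoef (wmon K a b * wmon K x y) (a + x)%MM (b + y)%MM = 1.
  apply/eqP; rewrite -subr_eq0; apply/negPn/negP => nz.
  have := @wmon_mul_lower a b x y (a + x)%MM (b + y)%MM.
  rewrite wcoefB wcoef_mon !eqxx => /(_ nz)[k [k0 aE _]]; case/eqP: k0.
  by apply: (@addmI _ (a + x)%MM); rewrite -aE addm0.
have [xyQ|] := boolP ((x, y) \in wsupp Q).
  rewrite (bigD1_seq (x, y)) ?wsupp_uniq //= self mulr1 big1_seq ?addr0 // => q.
  by case/andP=> ne qQ; rewrite lowq ?mulr0.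
move=> xyN; rewrite big1_seq => [|q /andP[_ qQ]].
  by apply/esym/eqP; rewrite -[_ == _]negbK -mem_wsupp.
by rewrite lowq ?mulr0 //; apply: contraNneq xyN => <-.
Qed.

End WeylBasics.

(** * The V-filtration on free modules and controlled generation *)

Lemma sum_delta (X : eqType) (K : pzSemiRingType) (s : seq X) (p : pred X)
    (c : X -> K) y : uniq s ->
  \sum_(x <- s | p x) c x * (x == y)%:R = if p y && (y \in s) then c y else 0.
Proof.
move=> us; rewrite big_mkcond; have [ys|yN] := boolP (y \in s).
  rewrite (bigD1_seq y) //= eqxx mulr1 andbT big1 ?addr0 // => x /negPf ->.
  by rewrite mulr0 if_same.
rewrite andbF big1_seq // => x /andP[_ xs].
by case: eqP => [xE|_]; [rewrite -xE xs in yN|rewrite mulr0 if_same].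
Qed.

Section Grading.
Variables (R : realType) (n : nat) (w : 'I_n -> R).
Local Notation K := R[i].
Local Notation D := (weyl n K).
Implicit Types (P Q : D) (a b : 'X_{1..n}).

Definition wt a b : R := \sum_i w i * ((b i)%:R - (a i)%:R).

Lemma wtD a b a' b' : wt (a + a')%MM (b + b')%MM = wt a b + wt a' b'.
Proof.
rewrite /wt -big_split; apply: eq_bigr => i _ /=.
by rewrite !mnmDE !natrD -mulrDr; congr (_ * _); ring.
Qed.

Lemma wt_diag k : wt k k = 0.
Proof. by rewrite /wt big1 // => i _; rewrite subrr mulr0. Qed.

Definition hcomp (r : R) P : D :=
  \sum_(ab <- wsupp P | wt ab.1 ab.2 == r) wcoef P ab.1 ab.2 *: wmon K ab.1 ab.2.

Lemma wcoef_filter (p : pred ('X_{1..n} * 'X_{1..n})) P a b :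
  wcoef (\sum_(ab <- wsupp P | p ab) wcoef P ab.1 ab.2 *: wmon K ab.1 ab.2) a b =
  if p (a, b) then wcoef P a b else 0.
Proof.
transitivity (\sum_(ab <- wsupp P | p ab) wcoef P ab.1 ab.2 * (ab == (a, b))%:R).
  by rewrite wcoef_sum; apply: eq_bigr => ab _; rewrite wcoefZ wcoef_mon
    -[_ && _]/((ab.1, ab.2) == (a, b)) -surjective_pairing.
rewrite sum_delta ?wsupp_uniq // mem_wsupp /=.
by case: eqP => [->|]; rewrite ?andbT ?andbF // if_same.
Qed.

Lemma wcoef_hcomp r P a b : wcoef (hcomp r P) a b = if wt a b == r then wcoef P a b else 0.
Proof. exact: wcoef_filter. Qed.

(** With the order or the equality for [cmp], this says that the map
    [Q |-> Q A] respects the V-filtrations or the gradings of the free modules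
    with shifts [s] and [t]. *)
Definition mgr (cmp : rel R) p q (s : 'I_p -> R) (t : 'I_q -> R) (A : 'M[D]_(p, q)) :=
  forall i j a b, wcoef (A i j) a b != 0 -> cmp (wt a b + t j) (s i).

Definition neqr : rel R := fun x y => x != y.

(** The initial part, when [A] respects the filtrations. *)
Definition mcomp p q (s : 'I_p -> R) (t : 'I_q -> R) (A : 'M[D]_(p, q)) : 'M[D]_(p, q) :=
  \matrix_(i, j) hcomp (s i - t j) (A i j).

Section MatrixGrading.
Variables (p q : nat) (s : 'I_p -> R) (t : 'I_q -> R).
Implicit Types A B : 'M[D]_(p, q).

Lemma mgr_sub (rel1 rel2 : rel R) (s' : 'I_p -> R) A :
  (forall i x, rel1 x (s i) -> rel2 x (s' i)) -> mgr rel1 s t A -> mgr rel2 s' t A.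
Proof. by move=> sub gA i j a b /gA/sub. Qed.

Lemma mgrD rl A B : mgr rl s t A -> mgr rl s t B -> mgr rl s t (A + B).
Proof.
move=> gA gB i j a b; rewrite !mxE wcoefD.
by have [->|/gA //] := eqVneq (wcoef (A i j) a b) 0; rewrite add0r => /gB.
Qed.

Lemma mgrB rl A B : mgr rl s t A -> mgr rl s t B -> mgr rl s t (A - B).
Proof.
move=> gA gB i j a b; rewrite !mxE wcoefB.
have [->|/gA //] := eqVneq (wcoef (A i j) a b) 0.
by rewrite sub0r oppr_eq0 => /gB.
Qed.

Lemma wcoef_mcomp A i j a b :
  wcoef (mcomp s t A i j) a b = if wt a b + t j == s i then wcoef (A i j) a b else 0.
Proof. by rewrite mxE wcoef_hcomp eq_sym subr_eq eq_sym. Qed.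

Lemma mcomp_hom A : mgr eq_op s t (mcomp s t A).
Proof. by move=> i j a b; rewrite wcoef_mcomp; case: ifP => //; rewrite eqxx. Qed.

Lemma wcoef_mcomp_rest A i j a b : wcoef ((A - mcomp s t A) i j) a b =
  if wt a b + t j == s i then 0 else wcoef (A i j) a b.
Proof.
have -> : (A - mcomp s t A) i j = A i j - mcomp s t A i j by rewrite !mxE.
by rewrite wcoefB wcoef_mcomp; case: ifP; rewrite ?subrr ?subr0.
Qed.

Lemma mcomp_rest A : mgr neqr s t (A - mcomp s t A).
Proof.
by move=> i j a b; rewrite wcoef_mcomp_rest /neqr; case: ifP => //; rewrite eqxx.
Qed.

Lemma mcomp_lower A : mgr <=%R s t A -> mgr <%R s t (A - mcomp s t A).
Proof.
move=> leA i j a b; rewrite wcoef_mcomp_rest lt_neqAle.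
by case: (wt a b + t j == s i) => [|/leA -> //]; rewrite eqxx.
Qed.

(** A homogeneous part is recognized by the rest having no term of its degree. *)
Lemma mcomp_uniq A B : mgr eq_op s t B -> mgr neqr s t (A - B) -> mcomp s t A = B.
Proof.
move=> homB restA; apply/matrixP => i j; apply: wcoefP => a b.
rewrite wcoef_mcomp; case: eqP => [stE|stN].
  apply/eqP; rewrite -subr_eq0 -wcoefB; apply/negPn/negP.
  have -> : A i j - B i j = (A - B) i j by rewrite !mxE.
  by move/restA; rewrite /neqr stE eqxx.
by apply/esym/eqP/negPn/negP => /homB/eqP.
Qed.

Lemma mcomp_id A : mgr eq_op s t A -> mcomp s t A = A.
Proof. by move=> homA; apply: mcomp_uniq => // i j a b; rewrite subrr mxE wcoef0 eqxx. Qed.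

Lemma mgr_lt_le A : mgr <%R s t A ->
  exists2 eps : R, 0 < eps & mgr <=%R (fun i => s i - eps) t A.
Proof.
move=> ltA; pose terms := [seq (ij, ab) | ij : 'I_p * 'I_q <- enum {: 'I_p * 'I_q},
  ab <- wsupp (A ij.1 ij.2)].
pose gap (x : ('I_p * 'I_q) * ('X_{1..n} * 'X_{1..n})) :=
  s x.1.1 - (wt x.2.1 x.2.2 + t x.1.2).
have : exists2 eps : R, 0 < eps & {in terms, forall x, eps <= gap x}.
  have: {in terms, forall x, 0 < gap x}.
    move=> x /allpairsPdep[[i j] [[a b] [_ + ->]]].
    by rewrite mem_wsupp /gap subr_gt0 => /ltA.
  elim: terms => [|x l IH] gap0; first by exists 1.
  have [y yl|eps eps0 epsl] := IH; first by apply: gap0; rewrite inE yl orbT.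
  exists (Num.min (gap x) eps); first by rewrite lt_min eps0 gap0 ?mem_head.
  by move=> y; rewrite inE ge_min => /predU1P[->|/epsl ->]; rewrite ?lexx ?orbT.
case=> eps eps0 epsP; exists eps => // i j a b nz.
have /epsP : ((i, j), (a, b)) \in terms.
  by apply/allpairsPdep; exists (i, j), (a, b); rewrite mem_enum mem_wsupp.
by rewrite /gap /= lerBrDl lerBrDr addrC.
Qed.

Lemma mgr_le_exists A : exists c : R, mgr <=%R (fun i => s i + c) t A.
Proof.
pose terms := [seq (ij, ab) | ij : 'I_p * 'I_q <- enum {: 'I_p * 'I_q},
  ab <- wsupp (A ij.1 ij.2)].
pose gap (x : ('I_p * 'I_q) * ('X_{1..n} * 'X_{1..n})) :=
  wt x.2.1 x.2.2 + t x.1.2 - s x.1.1.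
exists (\sum_(x <- terms) `|gap x|) => i j a b nz.
have xin : ((i, j), (a, b)) \in terms.
  by apply/allpairsPdep; exists (i, j), (a, b); rewrite mem_enum mem_wsupp.
rewrite -lerBlDl (le_trans (ler_norm _)) // -/(gap ((i, j), (a, b))).
by rewrite (big_rem _ xin) /= lerDl sumr_ge0.
Qed.

End MatrixGrading.

Lemma mgr_mul (cmp1 cmp2 cmp3 : rel R) p q m (s : 'I_p -> R) (t : 'I_q -> R) (u : 'I_m -> R)
    (A : 'M[D]_(p, q)) (B : 'M[D]_(q, m)) :
  mgr cmp1 s t A -> mgr cmp2 t u B ->
  (forall x y s t u, cmp1 (x + t) s -> cmp2 (y + u) t -> cmp3 (x + y + u) s) ->
  mgr cmp3 s u (A *m B).
Proof.
move=> gA gB cmpM i j a b; rewrite mxE wcoef_sum => nz.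
have [k nzk] : exists k, wcoef (A i k * B k j) a b != 0.
  apply: contrapT => no; case/negP: nz; rewrite big1 // => k _.
  by apply/eqP/negPn/negP => nzk; apply: no; exists k.
have [x [y [c [/gA xA /gB yB aE bE]]]] := wsupp_mul nzk.
have -> : wt a b = wt x.1 x.2 + wt y.1 y.2.
  by rewrite -wtD aE bE wtD wt_diag addr0.
exact: cmpM xA yB.
Qed.

Lemma mgr_le_mul p q m s t u (A : 'M[D]_(p, q)) (B : 'M[D]_(q, m)) :
  mgr <=%R s t A -> mgr <=%R t u B -> mgr <=%R s u (A *m B).
Proof. by move=> gA gB; apply: mgr_mul gA gB _ => x y s' t' u'; lra. Qed.

Lemma mgr_eq_mul p q m s t u (A : 'M[D]_(p, q)) (B : 'M[D]_(q, m)) :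
  mgr eq_op s t A -> mgr eq_op t u B -> mgr eq_op s u (A *m B).
Proof.
move=> gA gB; apply: mgr_mul gA gB _ => x y s' t' u' /eqP <- /eqP <-.
by rewrite addrA.
Qed.

Lemma mgr_eqle p q (s : 'I_p -> R) (t : 'I_q -> R) (A : 'M[D]_(p, q)) :
  mgr eq_op s t A -> mgr <=%R s t A.
Proof. by apply: mgr_sub => i x /eqP ->. Qed.

Lemma mgr_ltne p q (s : 'I_p -> R) (t : 'I_q -> R) (A : 'M[D]_(p, q)) :
  mgr <%R s t A -> mgr neqr s t A.
Proof. by apply: mgr_sub => i x; rewrite lt_neqAle => /andP[]. Qed.

(** The two products differ by [(A - in A) B + in A (B - in B)], of lower order. *)
Lemma mcomp_mul p q m s t u (A : 'M[D]_(p, q)) (B : 'M[D]_(q, m)) :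
  mgr <=%R s t A -> mgr <=%R t u B ->
  mcomp s u (A *m B) = mcomp s t A *m mcomp t u B.
Proof.
move=> leA leB; apply: mcomp_uniq.
  by apply: mgr_eq_mul; apply: mcomp_hom.
apply: mgr_ltne; have -> : A *m B - mcomp s t A *m mcomp t u B =
    (A - mcomp s t A) *m B + mcomp s t A *m (B - mcomp t u B).
  by rewrite mulmxBl mulmxBr addrA subrK.
apply: mgrD.
  have ltA := mcomp_lower leA; apply: (mgr_mul ltA leB) => x y s' t' u'; lra.
have leA0 := mgr_eqle (@mcomp_hom _ _ s t A); have ltB := mcomp_lower leB.
apply: (mgr_mul leA0 ltB) => x y s' t' u'; lra.
Qed.

Lemma mcomp_mulr p q m s t u (A : 'M[D]_(p, q)) (B : 'M[D]_(q, m)) :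
  mgr eq_op t u B -> mcomp s u (A *m B) = mcomp s t A *m B.
Proof.
move=> homB; apply: mcomp_uniq.
  by apply: mgr_eq_mul homB; apply: mcomp_hom.
rewrite -mulmxBl; have restA := @mcomp_rest _ _ s t A.
apply: (mgr_mul restA homB) => x y s' t' u'.
by rewrite /neqr => ne /eqP uE; rewrite -addrA uE.
Qed.

Lemma mcomp_mull p q m s t u (A : 'M[D]_(p, q)) (B : 'M[D]_(q, m)) :
  mgr eq_op s t A -> mcomp s u (A *m B) = A *m mcomp t u B.
Proof.
move=> homA; apply: mcomp_uniq.
  by apply: mgr_eq_mul homA _; apply: mcomp_hom.
rewrite -mulmxBr; have restB := @mcomp_rest _ _ t u B.
apply: (mgr_mul homA restB) => x y s' t' u'.
by rewrite /neqr => /eqP <- ne; rewrite -addrA (inj_eq (addrI _)).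
Qed.

Lemma mcomp_decompose q (t : 'I_q -> R) (Q : 'rV[D]_q) :
  exists rs : seq R, Q = \sum_(r <- rs) mcomp (fun=> r) t Q.
Proof.
exists (undup [seq wt x.2.1 x.2.2 + t x.1 | x <- [seq (j, ab) | j <- enum 'I_q,
  ab <- wsupp (Q 0 j)]]).
set rs := undup _; apply/rowP => j; apply: wcoefP => a b.
rewrite summxE wcoef_sum; under eq_bigr => r _ do rewrite wcoef_mcomp.
have [Q0|nz] := eqVneq (wcoef (Q 0 j) a b) 0.
  by rewrite big1 // => r _; rewrite Q0 if_same.
have rin : wt a b + t j \in rs.
  rewrite mem_undup; apply/mapP; exists (j, (a, b)) => //.
  by apply/allpairsPdep; exists j, (a, b); rewrite mem_enum mem_wsupp.
rewrite (bigD1_seq (wt a b + t j)) ?undup_uniq //= eqxx big1 ?addr0 // => r.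
by rewrite eq_sym => /negPf ->.
Qed.

End Grading.

Section SplitMonomials.
Variable n : nat.
Implicit Types g : 'X_{1..n + n}.

Definition lft g : 'X_{1..n} := [multinom g (lshift n i) | i < n].
Definition rgt g : 'X_{1..n} := [multinom g (rshift n i) | i < n].
Definition mrg (a b : 'X_{1..n}) : 'X_{1..n + n} :=
  [multinom (match fintype.split i with inl i => a i | inr i => b i end) | i < n + n].

Lemma lftD g h : lft (g + h)%MM = (lft g + lft h)%MM.
Proof. by apply/mnmP => i; rewrite !(mnmE, mnmDE). Qed.

Lemma rgtD g h : rgt (g + h)%MM = (rgt g + rgt h)%MM.
Proof. by apply/mnmP => i; rewrite !(mnmE, mnmDE). Qed.

Lemma lft_mrg a b : lft (mrg a b) = a.
Proof. by apply/mnmP => i; rewrite !mnmE (unsplitK (inl i)). Qed.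

Lemma rgt_mrg a b : rgt (mrg a b) = b.
Proof. by apply/mnmP => i; rewrite !mnmE (unsplitK (inr i)). Qed.

Lemma mrgK g : mrg (lft g) (rgt g) = g.
Proof.
apply/mnmP => i; rewrite mnmE -{2}(splitK i).
by case: (fintype.split i) => j; rewrite mnmE.
Qed.

Lemma mdeg_split g : mdeg g = (mdeg (lft g) + mdeg (rgt g))%N.
Proof.
rewrite !mdegE big_split_ord /=.
by congr (_ + _)%N; apply: eq_bigr => i _; rewrite mnmE.
Qed.

End SplitMonomials.

Section WeylModules.
Variables (R : realType) (n : nat) (w : 'I_n -> R).
Local Notation K := R[i].
Local Notation D := (weyl n K).

Section OneModule.
Variables (q : nat) (t : 'I_q -> R).
Local Notation T := ('X_{1..n + n} * 'I_q)%type.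

Definition vfun : functional R (n + n) 'I_q :=
  (fun i => match fintype.split i with inl i => - w i | inr i => w i end, t).

Lemma vfun_monE g : fun_mon vfun g = wt w (lft g) (rgt g).
Proof.
rewrite /fun_mon /wt big_split_ord /= -big_split; apply: eq_bigr => i _ /=.
by rewrite (unsplitK (inl i)) (unsplitK (inr i)) !mnmE; ring.
Qed.

Lemma vfun_atE (x : T) : fun_at vfun x = wt w (lft x.1) (rgt x.1) + t x.2.
Proof. by rewrite -vfun_monE. Qed.

Definition row_coef (x : T) (Q : 'rV[D]_q) : K := wcoef (Q 0 x.2) (lft x.1) (rgt x.1).

Definition row_act (g : 'X_{1..n + n}) (Q : 'rV[D]_q) : 'rV[D]_q :=
  wmon K (lft g) (rgt g) *: Q.

Definition row_scal (c : K) (Q : 'rV[D]_q) : 'rV[D]_q := (c *: (1 : D)) *: Q.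

Lemma row_coef_act_supp g Q x : row_coef x (row_act g Q) != 0 ->
  exists y k, [/\ row_coef y Q != 0, y.2 = x.2 &
    shiftT g y = shiftT (mrg k k) x].
Proof.
rewrite /row_coef mxE => /wsupp_mul[p [p' [k []]]].
rewrite wcoef_mon; case: andP => [[/eqP <- /eqP <-] _|_]; last by rewrite eqxx.
move=> nz aE bE; exists (mrg p'.1 p'.2, x.2), k; split; [|by []|].
  by rewrite [_.1]/= [_.2]/= lft_mrg rgt_mrg.
congr (_, _); rewrite [_.1]/= -[LHS]mrgK -[RHS]mrgK !lftD !rgtD !lft_mrg !rgt_mrg.
by rewrite aE bE ![(k + _)%MM]addmC.
Qed.

(** Adding as many [x] as [\partial] keeps the weight and raises the degree. *)
Lemma shift_diag_lower k (x y : T) : k != 0%MM -> y = shiftT (mrg k k) x -> tlt vfun x y.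
Proof.
move=> k0 ->; apply: tlt_deg.
  by rewrite fun_at_shift vfun_monE lft_mrg rgt_mrg wt_diag add0r.
rewrite /= mdegD (mdeg_split (mrg k k)) lft_mrg rgt_mrg -[X in (X < _)%N]add0n ltn_add2r.
by rewrite addn_gt0 lt0n mdeg_eq0 k0.
Qed.

Lemma row_coef_act_lead g Q x : is_lead vfun row_coef Q x ->
  is_lead vfun row_coef (row_act g Q) (shiftT g x).
Proof.
move=> [xQ xmax]; split.
  rewrite /row_coef mxE lftD rgtD wcoef_mon_mul // => k k0.
  apply/eqP/negPn/negP => nz; pose y : T := (mrg (lft x.1 + k) (rgt x.1 + k), x.2)%MM.
  have xy : tlt vfun x y.
    apply: shift_diag_lower k0 _; congr (_, _).
    by rewrite -[RHS]mrgK lftD rgtD lft_mrg rgt_mrg ![(k + _)%MM]addmC.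
  have [|yE|yx] := xmax y; first by rewrite /row_coef lft_mrg rgt_mrg.
    by rewrite yE /tlt lex_lt_irr in xy.
  by have := lex_lt_trans xy yx; rewrite lex_lt_irr.
move=> z /row_coef_act_supp[y [k [yQ _ yzE]]].
have [k0|k0] := eqVneq k 0%MM.
  have zE : z = shiftT g y.
    rewrite yzE k0; have -> : mrg 0%MM 0%MM = 0%MM :> 'X_{1..n + n}.
      by apply/mnmP => i; rewrite mnmE; case: fintype.split => j; rewrite !mnm0E.
    by rewrite /shiftT add0m -surjective_pairing.
  case: (xmax y yQ) => [<-|lt_yx]; [by left|right].
  by rewrite zE /tlt lex_lt_shift.
right; have zy := shift_diag_lower k0 yzE.
case: (xmax y yQ) => [<-//|lt_yx]; apply: lex_lt_trans zy _.
by rewrite lex_lt_shift.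
Qed.

(** The standard basis theorem for the order that compares the weights first. The
    leading monomials of the representation bound the orders of its terms, so
    the V-filtration of [N] is induced, up to a shift, by its generators. *)
Lemma weyl_standard_basis (N : 'rV[D]_q -> Prop) :
  (forall U V, N U -> N V -> N (U - V)) -> (forall a V, N V -> N (a *: V)) ->
  exists k (P : 'M[D]_(k, q)) (p : 'I_k -> R),
  [/\ forall i, N (row i P), mgr w <=%R p t P &
      forall (Q : 'rV[D]_q) (r : R), N Q -> mgr w <=%R (fun=> r) t Q ->
      exists2 U : 'rV[D]_k, mgr w <=%R (fun=> r) p U & Q = U *m P].
Proof.
move=> NB NZ.
have cfB x U c V : row_coef x (U - row_scal c V) = row_coef x U - c * row_coef x V.
  by rewrite /row_coef !mxE wcoefB -weyl_scaleAl mul1r wcoefZ.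
have cf_ext V : (forall x, row_coef x V = 0) -> V = 0.
  move=> V0; apply/rowP => j; rewrite mxE; apply: wcoefP => a b; rewrite wcoef0.
  by have := V0 (mrg a b, j); rewrite /row_coef /= lft_mrg rgt_mrg.
have cf_fin V : exists d, bounded row_coef d V.
  exists (\sum_j \sum_(ab <- wsupp (V 0%R j)) (mdeg ab.1 + mdeg ab.2))%N => x.
  rewrite /row_coef -mem_wsupp => xV; rewrite (bigD1 x.2) //= (big_rem _ xV) /=.
  by rewrite mdeg_split -addnA leq_addr.
have act_bounded d g V : bounded row_coef d V -> bounded row_coef (mdeg g + d) (row_act g V).
  move=> dV x /row_coef_act_supp[y [k [/dV le_d _ /(congr1 fst)/= xE]]].
  have : (mdeg x.1 <= mdeg (g + y.1)%MM)%N by rewrite xE mdegD leq_addl.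
  by move/leq_trans; apply; rewrite mdegD leq_add2l.
have N_sub U c V : N U -> N V -> N (U - row_scal c V) by move=> NU NV; apply/NB/NZ.
have N_act g V : N V -> N (row_act g V) by apply: NZ.
have [s [sN _ srep]] := standard_basis cfB cf_ext cf_fin act_bounded
  row_coef_act_lead N_sub N_act.
pose x i := tnth (in_tuple s) i; have xs i : x i \in s by apply: mem_tnth.
exists (size s), (\matrix_i (x i).1), (fun i => fun_at vfun (x i).2); split.
- by move=> i; rewrite rowK; case: (sN _ (xs i)).
- move=> i j a b; rewrite mxE => nz; have [_ [_ /(_ (mrg a b, j))]] := sN _ (xs i).
  rewrite /row_coef /= lft_mrg rgt_mrg => /(_ nz).
  have vE : fun_at vfun (mrg a b, j) = wt w a b + t j.
    by rewrite vfun_atE /= lft_mrg rgt_mrg.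
  by case=> [<-|/tlt_le]; rewrite vE ?lexx.
move=> Q r NQ leQ; have [y|rr [rrP QE]] := srep Q r NQ.
  by rewrite vfun_atE; apply: leQ.
pose term (z : K * 'X_{1..n + n} * ('rV[D]_q * T)) : D :=
  z.1.1 *: wmon K (lft z.1.2) (rgt z.1.2).
exists (\row_(i < size s) \sum_(z <- rr | index z.2 s == i) term z).
  move=> u i a b; rewrite mxE wcoef_sum => nz.
  have [z [zr /eqP zi nzz]] : exists z, [/\ z \in rr, index z.2 s == i & wcoef (term z) a b != 0].
    apply: contrapT => no; case/negP: nz; rewrite big1_seq // => z /andP[zi zr].
    by apply/eqP/negPn/negP => nzz; apply: no; exists z.
  have [zs] := rrP z zr; move: nzz; rewrite /term wcoefZ wcoef_mon vfun_monE.
  case: andP => [[/eqP <- /eqP <-] _|_]; last by rewrite mulr0 eqxx.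
  by have -> : z.2 = x i by rewrite /x (tnth_nth z.2) /= -zi nth_index.
rewrite QE mulmx_sum_row; under [RHS]eq_bigr => i _ do rewrite mxE rowK scaler_suml.
rewrite (exchange_big_dep xpredT) //= big_seq [RHS]big_seq; apply: eq_bigr => z /rrP[zs _].
have lt_z : (index z.2 s < size s)%N by rewrite index_mem.
rewrite (big_pred1 (Ordinal lt_z)) => [|i]; last by rewrite /= eq_sym.
have -> : x (Ordinal lt_z) = z.2 by rewrite /x (tnth_nth z.2) nth_index.
have -> : term z = (z.1.1 *: (1 : D)) * wmon K (lft z.1.2) (rgt z.1.2).
  by rewrite -weyl_scaleAl mul1r.
exact: (scalerA (z.1.1 *: (1 : D)) (wmon K (lft z.1.2) (rgt z.1.2)) z.2.1).
Qed.

End OneModule.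

(** Division by the rows of [psi] terminates after finitely many steps at any
    given order: if [P] is a finite family that generates with control, then
    [P = a psi + T P] with [T] lowering the order by some [eps > 0], so every
    element is a controlled combination of the rows of [psi] up to terms of
    arbitrarily low order, and for these any expression in the rows will do. *)
Lemma strict_generators p q (s : 'I_p -> R) (t : 'I_q -> R) (psi : 'M[D]_(p, q))
    (N : 'rV[D]_q -> Prop) :
  mgr w <=%R s t psi ->
  (forall Q, N Q <-> exists S, Q = S *m psi) ->
  (forall Q r, N Q -> mgr w <=%R (fun=> r) t Q -> exists2 S : 'rV[D]_p,
     mgr w eq_op (fun=> r) s S & mcomp w (fun=> r) t Q = S *m mcomp w s t psi) ->
  forall (Q : 'rV[D]_q) (r : R), N Q -> mgr w <=%R (fun=> r) t Q ->
  exists2 S : 'rV[D]_p, mgr w <=%R (fun=> r) s S & Q = S *m psi.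
Proof.
move=> le_psi Ngen div.
have NB U V : N U -> N V -> N (U - V).
  move=> /Ngen[S ->] /Ngen[S' ->]; apply/Ngen; exists (S - S'); exact/esym/mulmxBl.
have NZ a V : N V -> N (a *: V).
  by move=> /Ngen[S ->]; apply/Ngen; exists (a *: S); rewrite scalemxAl.
have [k [P [pw [NP leP rep]]]] := weyl_standard_basis t NB NZ.
have leP_row i : mgr w <=%R (fun=> pw i) t (row i P).
  by move=> u j a b; rewrite mxE; apply: leP.
have /boolp.choice[a0 a0P] i : exists S : 'rV[D]_p, mgr w eq_op (fun=> pw i) s S /\
    mcomp w (fun=> pw i) t (row i P) = S *m mcomp w s t psi.
  by have [S] := div _ _ (NP i) (leP_row i); exists S.
pose A : 'M[D]_(k, p) := \matrix_i a0 i.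
have homA : mgr w eq_op pw s A.
  by move=> i j x y; rewrite mxE; case: (a0P i) => + _; apply.
have ltP : mgr w <%R pw t (P - A *m psi).
  have topP : mcomp w pw t P = A *m mcomp w s t psi.
    apply/row_matrixP => i; rewrite row_mul rowK -(proj2 (a0P i)).
    by apply/rowP => j; rewrite !mxE.
  have -> : P - A *m psi = (P - mcomp w pw t P) - A *m (psi - mcomp w s t psi).
    by rewrite topP mulmxBr opprB addrA subrK.
  apply: mgrB; first exact: mcomp_lower.
  have leA := mgr_eqle homA; have ltpsi := mcomp_lower le_psi.
  by apply: (mgr_mul leA ltpsi) => x y s1 t1 u1; lra.
have [eps eps0 leT] := mgr_lt_le ltP.
have /boolp.choice[T0 T0P] i : exists U : 'rV[D]_k, mgr w <=%R (fun=> pw i - eps) pw U /\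
    row i (P - A *m psi) = U *m P.
  have [||U] := rep (row i (P - A *m psi)) (pw i - eps); last by exists U.
    rewrite raddfB /= row_mul; apply: NB => //.
    by apply/Ngen; eexists.
  by move=> u j x y; rewrite mxE; apply: leT.
pose T : 'M[D]_k := \matrix_i T0 i.
have leTT : mgr w <=%R (fun i => pw i - eps) pw T.
  by move=> i j x y; rewrite mxE; case: (T0P i) => + _; apply.
(* The orders of [T] are lower by [eps] than what the orders of [P] allow. *)
have PE : P = A *m psi + T *m P.
  apply/eqP; rewrite addrC -subr_eq; apply/eqP/row_matrixP => i.
  by rewrite row_mul rowK; case: (T0P i).
have /boolp.choice[c0 c0P] i : exists S, row i P = S *m psi by apply/Ngen.
pose C : 'M[D]_(k, p) := \matrix_i c0 i.
have PC : P = C *m psi by apply/row_matrixP => i; rewrite row_mul rowK.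
have [c leC] := mgr_le_exists w pw s C.
have iter l (Q : 'rV[D]_q) r : N Q -> mgr w <=%R (fun=> r) t Q ->
    exists (S : 'rV[D]_p) (U : 'rV[D]_k), [/\ mgr w <=%R (fun=> r) s S,
      mgr w <=%R (fun=> r - eps *+ l) pw U & Q = S *m psi + U *m P].
  move=> NQ leQ; elim: l => [|l [S [U [leS leU QE]]]].
    have [U leU QE] := rep Q r NQ leQ; exists 0, U; rewrite mul0mx add0r subr0; split=> //.
    by move=> i j x y; rewrite mxE wcoef0 eqxx.
  exists (S + U *m A), (U *m T); split.
  - apply: mgrD => //; apply: mgr_sub (mgr_le_mul leU (mgr_eqle homA)) => _ x le_x.
    by apply: le_trans le_x _; rewrite lerBlDr lerDl mulrn_wge0 // ltW.
  - have leU' : mgr w <=%R (fun=> r - eps *+ l.+1) (fun i => pw i - eps) U.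
      by move=> i j x y /leU; rewrite mulrSr addrA opprD addrA lerD2r.
    exact: mgr_le_mul leU' leTT.
  - by rewrite mulmxDl -addrA -!mulmxA -mulmxDr -PE.
(* [c] bounds the loss of order in expressing [P] by the rows of [psi]; after
   [l] steps the remainder is so low that this loss does not matter. *)
move=> Q r NQ leQ; have [l le_l] : exists l, c <= eps *+ l.
  exists (Num.truncn (`|c| / eps)).+1; rewrite -mulr_natr mulrC -ler_pdivrMr //.
  rewrite (le_trans _ (ltW (truncnS_gt _))) // ler_pM2r ?invr_gt0 //.
  exact: ler_norm.
have [S [U [leS leU QE]]] := iter l Q r NQ leQ.
exists (S + U *m C); last by rewrite mulmxDl -mulmxA -PC.
apply: mgrD => //.
have leU' : mgr w <=%R (fun=> r) (fun i => pw i + c) U.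
  by move=> i j x y /leU; lra.
exact: mgr_le_mul leU' leC.
Qed.

End WeylModules.

(** * Graded exactness and the homotopy given by the b-function *)

Section Initials.
Variables (R : realType) (n : nat) (w : 'I_n -> R).
Local Notation K := R[i].
Local Notation D := (weyl n K).

Definition rsh q (t : 'I_q -> int) : 'I_q -> R := fun j => (t j)%:~R.

Section OneRow.
Variables (q : nat) (t : 'I_q -> int).
Implicit Types Q : 'rV[D]_q.

Lemma top_termP Q (r : R) j ab : mgr w <=%R (fun=> r) (rsh t) Q ->
  (exists j' ab', ab' \in wsupp (Q 0 j') /\ term_ord w t ab' j' = r) ->
  ab \in wsupp (Q 0 j) -> top_term w t Q ab j = (wt w ab.1 ab.2 + rsh t j == r).
Proof.
move=> leQ [j0 [ab0 [ab0Q r0]]] abQ; apply/forallP/eqP => [top|abr j'].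
  apply/eqP; rewrite eq_le; apply/andP; split.
    by apply: (leQ 0 j); rewrite -mem_wsupp -surjective_pairing.
  by rewrite -r0; have /allP := top j0; apply.
apply/allP => ab' ab'Q; rewrite /term_ord -/(wt w ab.1 ab.2) -/(wt w ab'.1 ab'.2).
by rewrite [leRHS]abr; apply: (leQ 0 j'); rewrite -mem_wsupp -surjective_pairing.
Qed.

Lemma has_ord_le Q r : has_ord w t Q r -> mgr w <=%R (fun=> r) (rsh t) Q.
Proof.
move=> [j [ab [_ /forallP top <-]]] i j' a b; rewrite ord1 -mem_wsupp => nz.
by have /allP/(_ _ nz) := top j'.
Qed.

Lemma initial_mcomp Q r : has_ord w t Q r ->
  initial w t Q = mcomp w (fun=> r) (rsh t) Q.
Proof.
move=> oQ; have leQ := has_ord_le oQ; case: oQ => j0 [ab0 [ab0Q _ r0]].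
apply/rowP => j; rewrite [LHS]mxE [RHS]mxE /hcomp.
rewrite big_seq_cond [RHS]big_seq_cond; apply: eq_bigl => ab.
case abQ: (ab \in wsupp (Q 0 j)) => //=.
rewrite (top_termP leQ) //; last by exists j0, ab0.
by rewrite eq_sym [RHS]eq_sym subr_eq.
Qed.

Lemma mcomp_has_ord Q r : mgr w <=%R (fun=> r) (rsh t) Q ->
  mcomp w (fun=> r) (rsh t) Q != 0 -> has_ord w t Q r.
Proof.
move=> leQ nz; have [j [ab [abQ abr]]] : exists j ab,
    ab \in wsupp (Q 0 j) /\ wt w ab.1 ab.2 + rsh t j = r.
  apply: contrapT => no; case/eqP: nz; apply/rowP => j; apply: wcoefP => a b.
  rewrite wcoef_mcomp mxE wcoef0; case: eqP => // abr.
  apply/eqP/negPn/negP => nz; apply: no; exists j, (a, b).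
  by rewrite mem_wsupp.
exists j, ab; split=> //; rewrite (top_termP leQ) ?abr //.
by exists j, ab.
Qed.

Lemma initial0 : initial w t (0 : 'rV[D]_q) = 0.
Proof.
apply/rowP => j; rewrite !mxE big1_seq // => ab /andP[_].
by rewrite [ab]surjective_pairing mem_wsupp wcoef0 eqxx.
Qed.

End OneRow.

Lemma lspan_rows p q (A : 'M[D]_(p, q)) Q :
  lspan (fun P => exists k, P = row k A) Q <-> exists S, Q = S *m A.
Proof.
split=> [[N [a [g [gA ->]]]]|[S ->]].
  have /boolp.choice[f fP] := gA.
  exists (\sum_i a i *: delta_mx 0 (f i)); rewrite mulmx_suml.
  by apply: eq_bigr => i _; rewrite -scalemxAl -rowE -fP.
exists p, (fun k => S 0 k), (fun k => row k A); split=> [i|]; first by exists i.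
exact: mulmx_sum_row.
Qed.

End Initials.

Section GradedExactness.
Variables (R : realType) (n : nat) (w : 'I_n -> R).
Local Notation K := R[i].
Local Notation D := (weyl n K).
Variables (I : D -> Prop) (F : shifted_free n K).
Hypothesis F_adapted : adapted_resolution w I F.

Local Notation rs i := (rsh R (sh F i)).
Local Notation rp i := (rsh R (@sh_pred _ _ F i)).

Definition gpsi i : 'M[D]_(rk F i, rk_pred F i) := mcomp w (rs i) (rp i) (psi F i).

Lemma psi_le i : mgr w <=%R (rs i) (rp i) (psi F i).
Proof.
case: i => [|i]; first by move=> k [].
case: F_adapted => _ _ ordF _ _ k j a b nz.
have /ordF/has_ord_le/(_ 0 j a b) : row k (psi F i.+1) != 0.
  apply: contraNneq nz => /rowP/(_ j); rewrite !mxE => E.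
  by rewrite [psi F i.+1 k j]E wcoef0.
by rewrite mxE; apply.
Qed.

Arguments psi_le : clear implicits.

Lemma gpsi_hom i : mgr w eq_op (rs i) (rp i) (gpsi i).
Proof. exact: mcomp_hom. Qed.
Arguments gpsi_hom : clear implicits.

Lemma initial_row i k : initial w (sh F i) (row k (psi F i.+1)) = row k (gpsi i.+1).
Proof.
have rowE : row k (gpsi i.+1) = mcomp w (fun=> rs i.+1 k) (rs i) (row k (psi F i.+1)).
  by apply/rowP => j; rewrite !mxE.
have [r0|nz] := eqVneq (row k (psi F i.+1)) 0.
  rewrite rowE r0 initial0; apply/esym/rowP => j; apply: wcoefP => a b.
  by rewrite wcoef_mcomp !mxE wcoef0 if_same.
case: F_adapted => _ _ ordF _ _; rewrite rowE; apply: initial_mcomp; exact: ordF.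
Qed.

Lemma out_kernelP i Q : @out_kernel n K F I i Q <-> exists S, Q = S *m psi F i.+1.
Proof. by rewrite -lspan_rows; case: F_adapted => _ _ _ ker _; apply: ker. Qed.

Lemma initial_kernelP i Q : initial_submod w (sh F i) (@out_kernel n K F I i) Q <->
  exists S, Q = S *m gpsi i.+1.
Proof.
rewrite -lspan_rows; case: F_adapted => _ _ _ _ ini; rewrite ini.
suff -> : (fun P => exists k, P = initial w (sh F i) (row k (psi F i.+1))) =
          (fun P => exists k, P = row k (gpsi i.+1)) by [].
by apply: funext => P; apply: propext; split=> -[k ->]; exists k; rewrite initial_row.
Qed.

Lemma initial_in_kernel i Q r : @out_kernel n K F I i Q -> has_ord w (sh F i) Q r ->
  exists S, mcomp w (fun=> r) (rs i) Q = S *m gpsi i.+1.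
Proof.
move=> kQ oQ; apply/initial_kernelP; rewrite -(initial_mcomp oQ).
exists 1%N, (fun=> 1), (fun=> initial w (sh F i) Q); split=> [_|]; first by exists Q.
by rewrite big_ord1 scale1r.
Qed.

Lemma psi_comp i : psi F i.+1 *m psi F i = 0.
Proof.
case: i => [|i]; first by rewrite mulmx0.
apply/row_matrixP => k; rewrite row0 row_mul.
have /out_kernelP : exists S, row k (psi F i.+2) = S *m psi F i.+2.
  by exists (delta_mx 0 k); rewrite rowE.
by [].
Qed.

Lemma gpsi_comp i : gpsi i.+1 *m gpsi i = 0.
Proof.
have := mcomp_mul (psi_le i.+1) (psi_le i); rewrite psi_comp => <-.
apply/matrixP => k j; apply: wcoefP => a b.
by rewrite wcoef_mcomp !mxE wcoef0 if_same.
Qed.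

Lemma strict_kernel i Q r : @out_kernel n K F I i Q -> mgr w <=%R (fun=> r) (rs i) Q ->
  exists2 S, mgr w <=%R (fun=> r) (rs i.+1) S & Q = S *m psi F i.+1.
Proof.
apply: (strict_generators (psi_le i.+1)) Q r => [Q|Q r kQ leQ]; first exact: out_kernelP.
have [m0|nz] := eqVneq (mcomp w (fun=> r) (rs i) Q) 0.
  exists 0; last by rewrite m0 mul0mx.
  by move=> k j a b; rewrite mxE wcoef0 eqxx.
have [S SE] := initial_in_kernel kQ (mcomp_has_ord leQ nz).
exists (mcomp w (fun=> r) (rs i.+1) S); first exact: mcomp_hom.
rewrite -(mcomp_mulr _ _ (gpsi_hom i.+1)) -SE.
by apply/esym/mcomp_id/mcomp_hom.
Qed.

(** A homogeneous syzygy of the initial matrices is the initial part of a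
    syzygy: its product with [psi] has lower order, so by strictness it is the
    product of a row of lower order with [psi]. *)
Lemma gr_exact i (S : 'rV[D]_(rk F i.+1)) : S *m gpsi i.+1 = 0 ->
  exists T, S = T *m gpsi i.+2.
Proof.
move=> S0; have [l ->] := mcomp_decompose w (rs i.+1) S.
elim: l => [|r l [T IH]]; first by exists 0; rewrite big_nil mul0mx.
suff [T' T'E] : exists T', mcomp w (fun=> r) (rs i.+1) S = T' *m gpsi i.+2.
  by exists (T' + T); rewrite big_cons IH T'E mulmxDl.
have [->|] := eqVneq (mcomp w (fun=> r) (rs i.+1) S) 0; first by exists 0; rewrite mul0mx.
have: mcomp w (fun=> r) (rs i.+1) S *m gpsi i.+1 = 0.
  rewrite -(mcomp_mulr _ _ (gpsi_hom i.+1)) S0.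
  by apply/rowP => j; apply: wcoefP => a b; rewrite wcoef_mcomp !mxE wcoef0 if_same.
have := @mcomp_hom R n w 1 _ (fun=> r) (rs i.+1) S.
clear S0 IH; move: (mcomp _ _ _ S) => {}S homS S0 nz.
have leSpsi := mgr_le_mul (mgr_eqle homS) (psi_le i.+1).
have mcomp0 : mcomp w (fun=> r) (rs i) (S *m psi F i.+1) = 0.
  by rewrite (mcomp_mull _ _ homS).
have ltSpsi := mcomp_lower leSpsi; rewrite mcomp0 subr0 in ltSpsi.
have [eps eps0 leQ] := mgr_lt_le ltSpsi.
have kQ : @out_kernel n K F I i (S *m psi F i.+1) by apply/out_kernelP; exists S.
have [S' leS' SS'] := strict_kernel kQ leQ.
have kS : @out_kernel n K F I i.+1 (S - S') by rewrite /= mulmxBl SS' subrr.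
have topS : mcomp w (fun=> r) (rs i.+1) (S - S') = S.
  apply: mcomp_uniq; first exact: homS.
  apply: mgr_ltne => k j a b.
  rewrite addrAC subrr sub0r mxE -sub0r wcoefB wcoef0 sub0r oppr_eq0 => /leS'.
  by move=> le_r; apply: le_lt_trans le_r _; rewrite ltrBlDr ltrDl.
rewrite -topS; apply: (initial_in_kernel kS).
apply: mcomp_has_ord; last by rewrite topS.
apply: mgrB; first exact: mgr_eqle.
by apply: mgr_sub leS' => _ x; lra.
Qed.

End GradedExactness.

Section Theta.
Variables (n : nat) (K : comNzRingType).
Local Notation D := (weyl n K).
Local Notation symbol := {mpoly {mpoly K[n]}[n]}.
Implicit Types (P Q : D) (a b : 'X_{1..n}).

Lemma pderivm1 (Q : symbol) i :
  dop_pderivm (mp_derivations n K) U_(i)%MM Q = dop_pderiv (mp_derivations n K) i Q.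
Proof. by rewrite -[U_(i)%MM]add0m -dop_pderiv_pderivm dop_pderivm0. Qed.

Lemma xmul_wmon a c d : wmon K a 0%MM * wmon K c d = wmon K (a + c)%MM d.
Proof. by rewrite wmon_mul dop_pderivm0 /wmon scalerA mpolyXD. Qed.

Lemma wmonM a b P : wmon K a b * P = wmon K a 0%MM * (wmon K 0%MM b * P).
Proof. by rewrite mulrA xmul_wmon addm0. Qed.

Lemma pmul_wmon (i : 'I_n) c d : wmon K 0%MM U_(i)%MM * wmon K c d =
  (c i)%:R *: wmon K (c - U_(i))%MM d + wmon K c (d + U_(i))%MM.
Proof. rewrite wmon_mul pderivm1 pderiv_wmon mpolyX0; exact: scale1r. Qed.

Lemma pmulD a b : wmon K 0%MM (a + b)%MM = wmon K 0%MM a * wmon K 0%MM b.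
Proof.
have E : dop_pderivm (mp_derivations n K) a 'X_[b] = 'X_[a + b].
  elim/dop_pderivm_ind: a => [|a i IH]; first by rewrite add0m dop_pderivm0.
  rewrite -dop_pderiv_pderivm IH dop_pderivX; congr 'X_[_].
  by rewrite -!addmA [(U_(i) + _)%MM]addmC.
have X c : wmon K 0%MM c = 'X_[c] :> symbol by rewrite /wmon mpolyX0 scale1r.
by rewrite wmon_mul mpolyX0 (X (a + b)%MM) (X b) E; apply/esym/scale1r.
Qed.

#[local] Opaque wmon weyl_scale dop_mul.

Lemma xd_wmon (i : 'I_n) a b : wmon K U_(i)%MM U_(i)%MM * wmon K a b =
  wmon K (a + U_(i))%MM (b + U_(i))%MM + (a i)%:R *: wmon K a b.
Proof.
rewrite wmonM pmul_wmon mulrDr -weyl_scaleAr !xmul_wmon addrC [(U_(i) + a)%MM]addmC.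
apply: (congr1 (+%R _)); have [->|ai] := eqVneq (a i) 0%N.
  by apply: (etrans (scale0r _)); apply/esym/scale0r.
by rewrite [(U_(i) + _)%MM]addmC submK ?lep1mP.
Qed.

Lemma dpow_xd (i : 'I_n) b : wmon K 0%MM b * wmon K U_(i)%MM U_(i)%MM =
  wmon K U_(i)%MM (b + U_(i))%MM + (b i)%:R *: wmon K 0%MM b.
Proof.
elim/dop_pderivm_ind: b => [|b j IH].
  by rewrite xmul_wmon !add0m mnm0E scale0r addr0.
have E1 : wmon K 0%MM U_(j)%MM * wmon K U_(i)%MM (b + U_(i))%MM =
    wmon K U_(i)%MM (b + U_(j) + U_(i))%MM + (i == j)%:R *: wmon K 0%MM (b + U_(j))%MM.
  rewrite pmul_wmon mnm1E addrC -!addmA [(U_(i) + U_(j))%MM]addmC.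
  apply: (congr1 (+%R _)).
  have [->|_] := eqVneq i j; last by apply: (etrans (scale0r _)); apply/esym/scale0r.
  by congr (_ *: wmon _ _ _); apply/mnmP => k; rewrite mnmBE mnm0E subnn.
have E2 : wmon K 0%MM U_(j)%MM * wmon K 0%MM b = wmon K 0%MM (b + U_(j))%MM.
  by rewrite -pmulD addmC.
have -> : ((b + U_(j))%MM i = (i == j) + b i)%N by rewrite mnmDE mnm1E eq_sym addnC.
rewrite -[in LHS]E2 -mulrA IH mulrDr -weyl_scaleAr E1 E2 -addrA -scalerDl -natrD.
reflexivity.
Qed.

Lemma wmon_xd (i : 'I_n) a b : wmon K a b * wmon K U_(i)%MM U_(i)%MM =
  wmon K (a + U_(i))%MM (b + U_(i))%MM + (b i)%:R *: wmon K a b.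
Proof. by rewrite wmonM dpow_xd mulrDr -weyl_scaleAr !xmul_wmon addm0. Qed.

Variable c : 'I_n -> K.

Definition euler_op : D := \sum_i c i *: wmon K U_(i)%MM U_(i)%MM.

(** Minus the eigenvalue of the monomial [x^a \partial^b] for the commutator with
    the Euler operator. *)
Definition euler_wt a b : K := \sum_i c i * ((b i)%:R - (a i)%:R).

Lemma scale_shift (V : lmodType K) (x y z : K) (u v : V) :
  x *: (u + y *: v) = x *: (u + z *: v) + (x * (y - z)) *: v.
Proof.
by rewrite !scalerDr -addrA !scalerA -scalerDl -mulrDr addrC addrC subrKC.
Qed.

Lemma wmon_euler a b :
  wmon K a b * euler_op = euler_op * wmon K a b + euler_wt a b *: wmon K a b.
Proof.
rewrite mulr_sumr mulr_suml scaler_suml -big_split; apply: eq_bigr => i _.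
rewrite -weyl_scaleAr -weyl_scaleAl wmon_xd xd_wmon; exact: scale_shift.
Qed.

Lemma euler_comm P (r : K) : (forall a b, wcoef P a b != 0 -> euler_wt a b = r) ->
  P * euler_op = euler_op * P + r *: P.
Proof.
move=> homP; rewrite {1 2 3}[P]weylE mulr_suml mulr_sumr scaler_sumr -big_split.
rewrite big_seq [RHS]big_seq; apply: eq_bigr => -[a b]; rewrite mem_wsupp => /homP rE.
rewrite -weyl_scaleAl wmon_euler rE -weyl_scaleAr.
apply: (etrans (scalerDr _ _ _)); apply: (congr1 (+%R _)).
by apply: (etrans (scalerA _ _ _)); rewrite mulrC; apply/esym/scalerA.
Qed.

Lemma euler_shift_comm P (r x : K) : (forall a b, wcoef P a b != 0 -> euler_wt a b = r) ->
  P * (euler_op + x *: (1 : D)) = (euler_op + (r + x) *: (1 : D)) * P.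
Proof.
move=> homP; rewrite mulrDr (euler_comm homP) mulrDl -addrA; apply: (congr1 (+%R _)).
rewrite -weyl_scaleAr -weyl_scaleAl mulr1 mul1r.
exact/esym/scalerDl.
Qed.

Definition euler_poly (x : K) (p : {poly K}) : D :=
  \sum_(i < size p) p`_i *: (euler_op + x *: (1 : D)) ^+ i.

Lemma euler_poly_comm P (r x : K) p : (forall a b, wcoef P a b != 0 -> euler_wt a b = r) ->
  P * euler_poly x p = euler_poly (r + x) p * P.
Proof.
move=> homP; rewrite mulr_sumr mulr_suml; apply: eq_bigr => i _.
rewrite -weyl_scaleAl -weyl_scaleAr; apply: (congr1 ( *:%R _)).
elim: (nat_of_ord i) => [|k IH]; first by rewrite !expr0 mul1r mulr1.
by rewrite exprSr mulrA IH [in RHS]exprSr -!mulrA -(euler_shift_comm _ homP).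
Qed.

End Theta.

Section ThetaAction.
Variables (R : realType) (n : nat) (w : 'I_n -> R).
Local Notation K := R[i].
Local Notation D := (weyl n K).

Definition theta_poly (x : R) (p : {poly K}) : D :=
  euler_poly (fun i => (w i)%:C%C) x%:C%C p.

Lemma theta_poly0 p : theta_poly 0 p = at_theta w p.
Proof.
have E : euler_op (fun i => (w i)%:C%C) + (0 : R)%:C%C *: (1 : D) = weight_theta w.
  by rewrite scale0r; apply: addr0.
by rewrite /theta_poly /euler_poly E.
Qed.

Lemma euler_wtE a b : euler_wt (fun i => (w i)%:C%C) a b = (wt w a b)%:C%C.
Proof.
rewrite /wt rmorph_sum; apply: eq_bigr => i _.
by rewrite rmorphM rmorphB /= !rmorph_nat.
Qed.

Lemma theta_poly_comm P (r x : R) p : (forall a b, wcoef P a b != 0 -> wt w a b = r) ->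
  P * theta_poly x p = theta_poly (r + x) p * P.
Proof.
move=> homP; rewrite /theta_poly rmorphD; apply: euler_poly_comm => a b /homP <-.
exact: euler_wtE.
Qed.

(** On a component with shift [t j], the degree of a homogeneous solution exceeds
    the eigenvalue of [theta] by [t j]; with this correction the matrix commutes
    with homogeneous maps and acts on solutions of degree [mu] as [p(mu)]. *)
Definition theta_diag q (t : 'I_q -> R) (p : {poly K}) : 'M[D]_q :=
  diag_mx (\row_j theta_poly (t j) p).

Lemma theta_diag_comm p q (s : 'I_p -> R) (t : 'I_q -> R) (A : 'M[D]_(p, q)) b :
  mgr w eq_op s t A -> A *m theta_diag t b = theta_diag s b *m A.
Proof.
move=> homA; apply/matrixP => i j.
have -> : (A *m theta_diag t b) i j = A i j * theta_poly (t j) b.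
  by rewrite mul_mx_diag [LHS]mxE [X in _ * X]mxE.
have -> : (theta_diag s b *m A) i j = theta_poly (s i) b * A i j.
  by rewrite mul_diag_mx [LHS]mxE [X in X * _]mxE.
rewrite -[X in _ = theta_poly X _ * _](subrK (t j) (s i)).
by apply: theta_poly_comm => x y /homA/eqP <-; rewrite addrK.
Qed.

End ThetaAction.

#[local] Transparent wmon weyl_scale dop_mul.

Section Homotopy.
Variables (R : realType) (n : nat) (w : 'I_n -> R).
Local Notation K := R[i].
Local Notation D := (weyl n K).
Variables (I : D -> Prop) (F : shifted_free n K) (b : {poly K}).
Hypothesis F_adapted : adapted_resolution w I F.
Hypothesis b_bfun : is_bfunction w I b.

Local Notation gpsi := (gpsi w F).
Local Notation phi i := (theta_diag w (rsh R (sh F i)) b).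

(** The b-function lives in [D], the resolution starts with a free module of rank 1. *)
Lemma initial_submod_cast q (t : 'I_q -> int) P : q = 1%N -> (forall j, t j = 0) ->
  initial_ideal w I P ->
  initial_submod w t (fun Q : 'rV_q => forall j, I (Q 0 j)) (\row_j P).
Proof.
move=> q1 t0; have -> : t = (fun=> 0) by apply: funext.
clear t t0; subst q; rewrite /initial_ideal => -[N [a [g [gI PE]]]].
exists N, a, g; split=> [i|].
  by have [Q IQ ->] := gI i; exists Q => // j; rewrite ord1.
by rewrite -PE; apply/rowP => j; rewrite !mxE ord1 eqxx mulr1n.
Qed.

(** Right multiplication by [b(theta)] is the zero map on [D / in(I)]; its lift
    [phi] to the graded resolution is therefore null-homotopic. *)
Lemma homotopy i : exists (H : 'M[D]_(rk F i, rk F i.+1)) (H' : 'M[D]_(rk_pred F i, rk F i)),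
  phi i = H *m gpsi i.+1 + gpsi i *m H'.
Proof.
elim: i => [|i [H [H' phiE]]].
  have [rk0 sh0 _ _ _] := F_adapted.
  have /boolp.choice[h hP] k : exists S, row k (phi 0) = S *m gpsi 1.
    apply/(initial_kernelP F_adapted).
    have -> : row k (phi 0) = \row_j at_theta w b; last first.
      by apply: initial_submod_cast => //; apply/(proj2 b_bfun); rewrite dvdpp.
    apply/rowP => j; rewrite [LHS]mxE [LHS]mxE [X in X *+ _]mxE [RHS]mxE.
    have jk : k = j by apply/val_inj; case: k j => k + [j]; rewrite rk0 /= !ltnS !leqn0 => /eqP -> /eqP ->.
    by rewrite jk eqxx mulr1n /rsh sh0 theta_poly0.
  exists (\matrix_k h k), 0; rewrite mulmx0 addr0.
  by apply/row_matrixP => k; rewrite row_mul rowK.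
(* The usual construction: [phi - gpsi H] maps to cycles, and cycles are boundaries. *)
have ker : (phi i.+1 - gpsi i.+1 *m H) *m gpsi i.+1 = 0.
  rewrite mulmxBl -(theta_diag_comm b (@gpsi_hom _ _ w F i.+1)) -mulmxA -mulmxBr.
  by rewrite /= phiE addrAC subrr add0r mulmxA (gpsi_comp F_adapted) mul0mx.
have /boolp.choice[h hP] k : exists S, row k (phi i.+1 - gpsi i.+1 *m H) = S *m gpsi i.+2.
  by apply: (gr_exact F_adapted); rewrite -row_mul ker row0.
exists (\matrix_k h k), H; apply/eqP; rewrite -subr_eq; apply/eqP/row_matrixP => k.
by rewrite row_mul rowK hP.
Qed.

End Homotopy.

(** * The action on formal power series *)

Section FormalOperators.
Variables (n : nat) (K : comNzRingType).
Local Notation S := (fseries n K).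
Local Notation Dh := (fdiffop n K).
Local Notation symbol := {mpoly S[n]}.
Local Notation delta := (fs_derivations n K).
Local Notation wsymbol := {mpoly {mpoly K[n]}[n]}.

Lemma fs_derivm_add i b (f : S) :
  fs_derivm (b + U_(i))%MM f = fs_deriv i (fs_derivm b f).
Proof.
have iterC j k g : fs_deriv i (iter k (@fs_deriv n K j) g) =
    iter k (@fs_deriv n K j) (fs_deriv i g).
  by elim: k => //= k IH; rewrite fs_derivC IH.
pose G b s := foldr (fun i => iter (b i) (@fs_deriv n K i)) f s.
have E (s : seq 'I_n) : uniq s ->
    G (b + U_(i))%MM s = if i \in s then fs_deriv i (G b s) else G b s.
  elim: s => //= j s IH /andP[js us]; rewrite inE mnmDE mnm1E IH //.
  case: eqVneq js => [<- /negPf->|_ _]; rewrite ?addn1 //= addn0.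
  by case: ifP => //= _; rewrite iterC.
by have := E _ (enum_uniq 'I_n); rewrite mem_enum.
Qed.

Lemma fs_derivm0 (f : S) : fs_derivm 0%MM f = f.
Proof. by rewrite /fs_derivm; elim: (enum _) => //= i s ->; rewrite mnm0E. Qed.

Lemma fs_derivm_is_zmod_morphism b : zmod_morphism (@fs_derivm n K b).
Proof.
elim/dop_pderivm_ind: b => [|b i IH] f g; first by rewrite !fs_derivm0.
by rewrite !fs_derivm_add IH raddfB.
Qed.

HB.instance Definition _ b := GRing.isZmodMorphism.Build S S (@fs_derivm n K b)
  (fs_derivm_is_zmod_morphism b).

Lemma fact_actwE k (P : symbol) f : (msize P <= k)%N ->
  fact_act (P : Dh) f = \sum_(b : 'X_{1..n < k}) P@_b * fs_derivm b f.
Proof.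
move=> lek; rewrite /fact_act (big_mksub 'X_{1..n < k}) /=; first last.
- by move=> x /msize_mdeg_lt /leq_trans; apply.
- by rewrite msupp_uniq.
by rewrite big_rmcond //= => b /memN_msupp_eq0 ->; rewrite mul0r.
Qed.

Lemma fact_actB (P Q : symbol) f :
  fact_act (P - Q : Dh) f = fact_act (P : Dh) f - fact_act (Q : Dh) f.
Proof.
pose k := maxn (msize (P - Q)) (maxn (msize P) (msize Q)).
rewrite !(@fact_actwE k) ?leq_max ?leqnn ?orbT // -sumrB.
by apply: eq_bigr => b _; rewrite mcoeffB mulrBl.
Qed.

Lemma fact_act0 f : fact_act (0 : Dh) f = 0.
Proof. by rewrite /fact_act msupp0 big_nil. Qed.

Lemma fact_actD (P Q : symbol) f :
  fact_act (P + Q : Dh) f = fact_act (P : Dh) f + fact_act (Q : Dh) f.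
Proof. by rewrite -{1}[Q]opprK fact_actB -[- Q]sub0r fact_actB fact_act0 sub0r opprK. Qed.

Lemma fact_act_sum I (r : seq I) (F : I -> symbol) f :
  fact_act (\sum_(i <- r) F i : Dh) f = \sum_(i <- r) fact_act (F i : Dh) f.
Proof. by elim: r => [|i r IH]; rewrite ?big_nil ?fact_act0 // !big_cons fact_actD IH. Qed.

Lemma fact_actZ a (P : symbol) f : fact_act (a *: P : Dh) f = a * fact_act (P : Dh) f.
Proof.
pose k := maxn (msize (a *: P)) (msize P).
rewrite !(@fact_actwE k) ?leq_max ?leqnn ?orbT // mulr_sumr.
by apply: eq_bigr => b _; rewrite mcoeffZ mulrA.
Qed.

Lemma fact_actX b f : fact_act ('X_[b] : Dh) f = fs_derivm b f.
Proof. by rewrite /fact_act msuppX big_seq1 mcoeffX eqxx mul1r. Qed.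

Lemma fact_act_is_zmod_morphism (P : symbol) : zmod_morphism (fact_act (P : Dh)).
Proof.
move=> f g; rewrite /fact_act -sumrB; apply: eq_bigr => b _.
by rewrite raddfB mulrBr.
Qed.

HB.instance Definition _ (P : symbol) := GRing.isZmodMorphism.Build S S
  (fact_act (P : Dh)) (fact_act_is_zmod_morphism P).

Lemma fact_act_pderiv i (Q : symbol) f :
  fact_act (dop_pderiv delta i Q : Dh) f = fs_deriv i (fact_act (Q : Dh) f).
Proof.
rewrite [Q]mpolyE (raddf_sum (dop_pderiv delta i)) /= !fact_act_sum raddf_sum /=.
apply: eq_bigr => b _; rewrite dop_pderivZ fact_actD !fact_actZ dop_pderivX !fact_actX.
by rewrite fs_derivM fs_derivm_add.
Qed.

Lemma fact_actM (P Q : Dh) f : fact_act (P * Q) f = fact_act P (fact_act Q f).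
Proof.
change (fact_act (dop_mul delta P Q : Dh) f = fact_act P (fact_act Q f)).
rewrite [P]mpolyE dop_mul_suml !fact_act_sum; apply: eq_bigr => b _.
rewrite dop_mulZl !fact_actZ dop_mulX fact_actX; congr (_ * _).
elim/dop_pderivm_ind: b => [|b i IH]; first by rewrite dop_pderivm0 fs_derivm0.
by rewrite -dop_pderiv_pderivm fact_act_pderiv IH fs_derivm_add.
Qed.

Lemma mcoeff_to_fdiffop (P : weyl n K) b :
  (to_fdiffop P : symbol)@_b = mp_fseries (P : wsymbol)@_b.
Proof. exact: mcoeff_map_mpoly. Qed.

Lemma to_fdiffop_is_zmod_morphism : zmod_morphism (@to_fdiffop n K).
Proof.
move=> P Q.
exact: (raddfB (map_mpoly (@mp_fseries n K : {additive _ -> _})) (P : wsymbol) Q).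
Qed.

HB.instance Definition _ := GRing.isZmodMorphism.Build (weyl n K) Dh (@to_fdiffop n K)
  to_fdiffop_is_zmod_morphism.

Lemma to_fdiffopZ a (P : wsymbol) :
  (to_fdiffop (a *: P : weyl n K) : symbol) = mp_fseries a *: (to_fdiffop (P : weyl n K) : symbol).
Proof.
apply/mpolyP => b; rewrite [RHS]mcoeffZ; apply: (etrans (mcoeff_to_fdiffop _ _)).
rewrite [X in _ = _ * X]mcoeff_to_fdiffop mcoeffZ; exact: rmorphM.
Qed.

Lemma mp_fseries_deriv i (p : {mpoly K[n]}) :
  mp_fseries (mderiv i p) = fs_deriv i (mp_fseries p).
Proof. by apply: funext => m; rewrite /mp_fseries mcoeff_deriv. Qed.

Lemma to_fdiffopX b : to_fdiffop ('X_[b] : weyl n K) = 'X_[b] :> symbol.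
Proof.
apply/mpolyP => m; rewrite mcoeff_to_fdiffop !mcoeffX.
by case: (b == m); rewrite ?rmorph1 ?rmorph0.
Qed.

Lemma to_fdiffop_pderiv i (Q : wsymbol) :
  to_fdiffop (dop_pderiv (mp_derivations n K) i Q : weyl n K) =
  dop_pderiv delta i (to_fdiffop (Q : weyl n K)).
Proof.
have sumE (r : seq 'X_{1..n}) (G : 'X_{1..n} -> wsymbol) :
    (to_fdiffop (\sum_(b <- r) G b : weyl n K) : symbol) = \sum_(b <- r) (to_fdiffop (G b : weyl n K) : symbol).
  exact: (raddf_sum (@to_fdiffop n K)).
rewrite [Q]mpolyE (raddf_sum (dop_pderiv (mp_derivations n K) i)) /= !sumE.
rewrite (raddf_sum (dop_pderiv delta i)) /=; apply: eq_bigr => b _.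
rewrite to_fdiffopZ !dop_pderivZ to_fdiffopX !dop_pderivX.
apply/mpolyP => m; rewrite mcoeff_to_fdiffop !mcoeffD !mcoeffZ mcoeffX rmorphD !rmorphM /=.
by rewrite mp_fseries_deriv !mcoeffX; congr (_ * _ + _ * _); case: eqP; rewrite ?rmorph1 ?rmorph0.
Qed.

Lemma to_fdiffop_is_monoid_morphism : monoid_morphism (@to_fdiffop n K).
Proof.
split=> [|P Q].
  apply/(@mpolyP n _ (to_fdiffop 1 : symbol) 1) => m.
  by rewrite mcoeff_to_fdiffop !mcoeff1; case: eqP; rewrite ?rmorph1 ?rmorph0.
change ((to_fdiffop (dop_mul (mp_derivations n K) P Q : weyl n K) : symbol) =
  dop_mul delta (to_fdiffop P) (to_fdiffop Q)).
have sumE (r : seq 'X_{1..n}) (G : 'X_{1..n} -> wsymbol) :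
    (to_fdiffop (\sum_(b <- r) G b : weyl n K) : symbol) = \sum_(b <- r) (to_fdiffop (G b : weyl n K) : symbol).
  exact: (raddf_sum (@to_fdiffop n K)).
rewrite [P]mpolyE dop_mul_suml !sumE dop_mul_suml; apply: eq_bigr => b _.
rewrite dop_mulZl !to_fdiffopZ dop_mulZl to_fdiffopX !dop_mulX; congr (_ *: _).
elim/dop_pderivm_ind: b => [|b i IH]; first by rewrite !dop_pderivm0.
by rewrite -!dop_pderiv_pderivm to_fdiffop_pderiv IH.
Qed.

HB.instance Definition _ := GRing.isMonoidMorphism.Build (weyl n K) Dh (@to_fdiffop n K)
  to_fdiffop_is_monoid_morphism.

End FormalOperators.

Section WeylAction.
Variables (n : nat) (K : comNzRingType).
Local Notation S := (fseries n K).
Local Notation D := (weyl n K).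
Implicit Types (P Q : D) (f g : S).

Lemma wactM P Q f : wact (P * Q) f = wact P (wact Q f).
Proof. by rewrite /wact rmorphM fact_actM. Qed.

Lemma wactDl P Q f : wact (P + Q) f = wact P f + wact Q f.
Proof. by rewrite /wact raddfD; apply: fact_actD. Qed.

Lemma wact0l f : wact (0 : D) f = 0.
Proof. by rewrite /wact raddf0; apply: fact_act0. Qed.

Lemma wact_suml I (r : seq I) (F : I -> D) f :
  wact (\sum_(i <- r) F i) f = \sum_(i <- r) wact (F i) f.
Proof. by elim: r => [|i r IH]; rewrite ?big_nil ?wact0l // !big_cons wactDl IH. Qed.

Lemma wact_is_zmod_morphism P : zmod_morphism (wact P).
Proof. exact: fact_act_is_zmod_morphism. Qed.

HB.instance Definition _ P := GRing.isZmodMorphism.Build S S (wact P)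
  (wact_is_zmod_morphism P).

Lemma wact_mon a b f m :
  wact (wmon K a b) f m = if (a <= m)%MM then fs_derivm b f (m - a)%MM else 0.
Proof.
rewrite /wact /wmon to_fdiffopZ fact_actZ to_fdiffopX fact_actX mulrC mp_fs_mulE msuppX.
by rewrite big_mkcond big_seq1 mcoeffX eqxx mul1r.
Qed.

Lemma wactZl c P f : wact (c *: P) f = c *: wact P f.
Proof.
rewrite /wact -[c *: P]/(weyl_scale c P) /weyl_scale to_fdiffopZ fact_actZ mulrC.
apply: funext => m; rewrite mp_fs_mulE msuppC.
have [->|c0] := eqVneq c 0; first by rewrite big_nil; apply/esym/mul0r.
rewrite big_mkcond big_seq1 subm0 mcoeffC eqxx mulr1.
by case: ifP => // /negP[]; apply/mnm_lepP => i; rewrite mnm0E.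
Qed.

Lemma wmon00 : wmon K 0%MM 0%MM = 1 :> weyl n K.
Proof. by rewrite /wmon !mpolyX0 scale1r. Qed.

Lemma wact1 f : wact (1 : D) f = f.
Proof.
rewrite -wmon00; apply: funext => m; rewrite wact_mon fs_derivm0 subm0.
by case: ifP => // /negP[]; apply/mnm_lepP => i; rewrite mnm0E.
Qed.

Lemma wactZr c P f : wact P (c *: f) = c *: wact P f.
Proof.
have scaleE g : c *: g = wact (c *: (1 : D)) g by rewrite wactZl wact1.
by rewrite !scaleE -!wactM -weyl_scaleAr -weyl_scaleAl mulr1 mul1r.
Qed.

Lemma wactE P f : wact P f =
  \sum_(ab <- wsupp P) wcoef P ab.1 ab.2 *: wact (wmon K ab.1 ab.2) f.
Proof. by rewrite {1}[P]weylE wact_suml; apply: eq_bigr => ab _; rewrite wactZl. Qed.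

Definition mfact (m : 'X_{1..n}) : nat := (\prod_(i < n) (m i)`!)%N.

Lemma mfactS m i : mfact (m + U_(i))%MM = (mfact m * (m i).+1)%N.
Proof.
rewrite /mfact (bigD1 i) //= [in RHS](bigD1 i) //= mnmDE mnm1E eqxx addn1 factS.
rewrite [RHS]mulnC mulnA; congr (_ * _)%N; apply: eq_bigr => j ne.
by rewrite mnmDE mnm1E eq_sym (negPf ne) addn0.
Qed.

(** In terms of the coefficients [m! f_m], differentiation is a shift. *)
Lemma fs_derivm_coef b f m :
  fs_derivm b f m *+ mfact m = f (m + b)%MM *+ mfact (m + b)%MM.
Proof.
elim/dop_pderivm_ind: b m => [|b i IH] m; first by rewrite fs_derivm0 addm0.
rewrite fs_derivm_add /fs_deriv -mulrnA mulnC -mfactS IH.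
by rewrite -!addmA [(U_(i) + b)%MM]addmC.
Qed.

Lemma fs_derivm_supp b f m : fs_derivm b f m != 0 -> f (m + b)%MM != 0.
Proof.
elim/dop_pderivm_ind: b m => [|b i IH] m; first by rewrite fs_derivm0 addm0.
rewrite fs_derivm_add /fs_deriv => nz.
have /IH : fs_derivm b f (m + U_(i))%MM != 0.
  by apply: contraNneq nz => ->; rewrite mul0rn.
by rewrite -addmA [(U_(i) + b)%MM]addmC.
Qed.

Lemma wact_supp P f m : wact P f m != 0 -> exists a b k,
  [/\ wcoef P a b != 0, f k != 0 & (k + a = m + b)%MM].
Proof.
rewrite wactE fct_sumE => nz.
have [[a b] abP nzab] : exists2 ab, ab \in wsupp P &
    (wcoef P ab.1 ab.2 *: wact (wmon K ab.1 ab.2) f) m != 0.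
  apply: contrapT => no; case/negP: nz; rewrite big1_seq // => ab /andP[_ abP].
  by apply/eqP/negPn/negP => nzab; apply: no; exists ab.
have : wact (wmon K a b) f m != 0.
  apply: contraNneq nzab => E; rewrite -[_ m]/(wcoef P a b * wact (wmon K a b) f m).
  by rewrite E mulr0.
rewrite wact_mon; case: ifP => [le_am /fs_derivm_supp fk|]; last by rewrite eqxx.
exists a, b, (m - a + b)%MM; split=> //; first by rewrite -mem_wsupp.
by rewrite -addmA [(b + a)%MM]addmC addmA submK.
Qed.

Section MatrixAction.

Lemma wmat_actM p q r (A : 'M[D]_(p, q)) (B : 'M[D]_(q, r)) (g : 'I_r -> S) :
  wmat_act (A *m B) g = wmat_act A (wmat_act B g).
Proof.
apply: funext => i.
transitivity (\sum_j \sum_k wact (A i k * B k j) (g j)).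
  by apply: eq_bigr => j _; rewrite [X in wact X _]mxE; apply: wact_suml.
rewrite exchange_big; apply: eq_bigr => k _.
apply: (etrans _ (esym (raddf_sum (wact (A i k)) _ _ _))).
by apply: eq_bigr => j _; apply: wactM.
Qed.

Lemma wmat_act_is_zmod_morphism p q (A : 'M[D]_(p, q)) :
  zmod_morphism (wmat_act A : ('I_q -> S) -> ('I_p -> S)).
Proof.
move=> f g; apply: funext => i; apply: (etrans _ (sumrB _ _ _ _)).
by apply: eq_bigr => j _; apply: (raddfB (wact (A i j))).
Qed.

HB.instance Definition _ p q (A : 'M[D]_(p, q)) :=
  GRing.isZmodMorphism.Build ('I_q -> S) ('I_p -> S) (wmat_act A)
    (wmat_act_is_zmod_morphism A).

Lemma wmat_actZ p q (A : 'M[D]_(p, q)) c (f : 'I_q -> S) :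
  wmat_act A (c *: f) = c *: wmat_act A f.
Proof.
apply: funext => i; apply: (etrans _ (esym (scaler_sumr _ _ _ _))).
by apply: eq_bigr => j _; apply: wactZr.
Qed.

Lemma wmat_actD p q (A B : 'M[D]_(p, q)) (f : 'I_q -> S) :
  wmat_act (A + B) f = wmat_act A f + wmat_act B f.
Proof.
apply: funext => i; apply: (etrans _ (big_split _ _ _ _ _)).
by apply: eq_bigr => j _; rewrite [X in wact X _]mxE; apply: wactDl.
Qed.

End MatrixAction.
End WeylAction.

(** * Solutions of high degree are boundaries *)

Lemma euler_act n (K : comNzRingType) (c : 'I_n -> K) (f : fseries n K) m :
  wact (euler_op c) f m = (\sum_i c i * (m i)%:R) * f m.
Proof.
rewrite /euler_op wact_suml fct_sumE mulr_suml; apply: eq_bigr => i _.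
rewrite wactZl -[LHS]/(c i * wact (wmon K U_(i)%MM U_(i)%MM) f m) -mulrA; congr (_ * _).
rewrite wact_mon lep1mP; have [->|mi] := eqVneq (m i) 0%N; first by rewrite mul0r.
have -> : fs_derivm U_(i)%MM f = fs_deriv i f.
  by rewrite -(add0m U_(i)%MM) fs_derivm_add fs_derivm0.
rewrite /fs_deriv.
rewrite submK ?lep1mP // mnmBE mnm1E eqxx subn1 prednK ?lt0n // mulr_natl.
by [].
Qed.

Section Degrees.
Variables (R : realType) (n : nat) (w : 'I_n -> R).
Local Notation K := R[i].
Local Notation fs := (fseries n K).
Local Notation D := (weyl n K).

Definition wdot (k : 'X_{1..n}) : R := \sum_i w i * (k i)%:R.

Lemma wdotD k l : wdot (k + l)%MM = wdot k + wdot l.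
Proof.
by rewrite /wdot -big_split; apply: eq_bigr => i _; rewrite mnmDE natrD mulrDr.
Qed.

Lemma wt_wdot a b : wt w a b = wdot b - wdot a.
Proof. by rewrite /wdot -sumrB; apply: eq_bigr => i _; rewrite mulrBr. Qed.

Definition fsup (cmp : rel R) (r : R) q (t : 'I_q -> R) (f : 'I_q -> fs) :=
  forall j k, f j k != 0 -> cmp (wdot k + t j) r.

Definition fcomp (r : R) q (t : 'I_q -> R) (f : 'I_q -> fs) : 'I_q -> fs :=
  fun j k => if wdot k + t j == r then f j k else 0.

Definition ltrev : rel R := fun x y => y < x.
Definition lerev : rel R := fun x y => y <= x.

Section OneVector.
Variables (q : nat) (t : 'I_q -> R).
Implicit Types f g : 'I_q -> fs.

Lemma fsupD cmp r f g : fsup cmp r t f -> fsup cmp r t g -> fsup cmp r t (f + g).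
Proof.
move=> sf sg j k; have -> : (f + g) j k = f j k + g j k by [].
by have [->|/sf //] := eqVneq (f j k) 0; rewrite add0r => /sg.
Qed.

Lemma fsupB cmp r f g : fsup cmp r t f -> fsup cmp r t g -> fsup cmp r t (f - g).
Proof.
move=> sf sg j k; have -> : (f - g) j k = f j k - g j k by [].
by have [->|/sf //] := eqVneq (f j k) 0; rewrite sub0r oppr_eq0 => /sg.
Qed.

Lemma fsup_sub (cmp1 cmp2 : rel R) r r' f : (forall x, cmp1 x r -> cmp2 x r') ->
  fsup cmp1 r t f -> fsup cmp2 r' t f.
Proof. by move=> sub sf j k /sf/sub. Qed.

Lemma fcomp_hom r f : fsup eq_op r t (fcomp r t f).
Proof. by move=> j k; rewrite /fcomp; case: ifP => //; rewrite eqxx. Qed.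

Lemma fcomp_rest r f : fsup (@neqr R) r t (f - fcomp r t f).
Proof.
move=> j k; have -> : (f - fcomp r t f) j k = f j k - fcomp r t f j k by [].
by rewrite /fcomp /neqr; case: ifP => //; rewrite subrr eqxx.
Qed.

Lemma fcomp_upper r f : fsup lerev r t f -> fsup ltrev r t (f - fcomp r t f).
Proof.
move=> sf j k; have -> : (f - fcomp r t f) j k = f j k - fcomp r t f j k by [].
rewrite /fcomp /ltrev lt_neqAle; case: ifP => [_|/negbT ne]; first by rewrite subrr eqxx.
by rewrite subr0 [r == _]eq_sym ne => /sf.
Qed.

Lemma fsup_disjoint (cmp1 cmp2 : rel R) r f :
  (forall x, cmp1 x r -> cmp2 x r -> False) ->
  fsup cmp1 r t f -> fsup cmp2 r t f -> f = 0.
Proof.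
move=> disj s1 s2; apply: funext => j; apply: funext => k.
by apply/eqP/negPn/negP => nz; apply: disj (s1 _ _ nz) (s2 _ _ nz).
Qed.

End OneVector.

(** The exponent [k] of a term of [f] that a term of [A] of weight [x] maps to the
    exponent [m] has [w.k = w.m + x]. *)
Lemma fsup_act (cmp1 cmp2 cmp3 : rel R) p q (s : 'I_p -> R) (t : 'I_q -> R) r
    (A : 'M[D]_(p, q)) (f : 'I_q -> fs) :
  mgr w cmp1 s t A -> fsup cmp2 r t f ->
  (forall mu x tau sg, cmp1 (x + tau) sg -> cmp2 (mu + x + tau) r -> cmp3 (mu + sg) r) ->
  fsup cmp3 r s (wmat_act A f).
Proof.
move=> gA sf comb i m nz.
have [j nzj] : exists j, wact (A i j) (f j) m != 0.
  apply: contrapT => no; case/negP: nz; rewrite /wmat_act fct_sumE big1 // => j _.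
  by apply/eqP/negPn/negP => nzj; apply: no; exists j.
have [a [b [k [/gA Aab /sf fk kE]]]] := wact_supp nzj.
apply: comb Aab _; rewrite wt_wdot.
have -> : wdot m + (wdot b - wdot a) = wdot k; last exact: fk.
by rewrite addrA -wdotD -kE wdotD addrK.
Qed.

Lemma theta_poly_act x p (f : fs) (mu : R) :
  (forall k, f k != 0 -> wdot k = mu) ->
  wact (theta_poly w x p) f = p.[(mu + x)%:C%C] *: f.
Proof.
move=> fmu.
have act1 : wact (euler_op (fun i => (w i)%:C%C) + x%:C%C *: (1 : D)) f = (mu + x)%:C%C *: f.
  rewrite wactDl wactZl wact1; apply: funext => k.
  rewrite -[LHS]/(wact (euler_op (fun i => (w i)%:C%C)) f k + x%:C%C * f k) euler_act.
  rewrite -[RHS]/((mu + x)%:C%C * f k) -mulrDl.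
  have [->|/fmu muE] := eqVneq (f k) 0; first by rewrite !mulr0.
  congr (_ * _); rewrite rmorphD -muE /wdot rmorph_sum; congr (_ + _).
  by apply: eq_bigr => i _; rewrite rmorphM rmorph_nat.
rewrite /theta_poly /euler_poly wact_suml horner_coef scaler_suml; apply: eq_bigr => i _.
rewrite wactZl -[RHS]scalerA; congr (_ *: _).
elim: (nat_of_ord i) => [|k IH]; first by rewrite !expr0 wact1 scale1r.
by rewrite exprS wactM IH wactZr act1 scalerA exprSr.
Qed.

Lemma theta_diag_act q (t : 'I_q -> R) p (f : 'I_q -> fs) mu :
  fsup eq_op mu t f -> wmat_act (theta_diag w t p) f = p.[mu%:C%C] *: f.
Proof.
move=> sf; apply: funext => j; rewrite /wmat_act (bigD1 j) // big1 => [|l ne].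
  rewrite mxE eqxx mulr1n mxE Monoid.mulm1 (@theta_poly_act _ _ _ (mu - t j)).
    by rewrite subrK.
  by move=> k /sf/eqP <-; rewrite addrK.
by rewrite mxE eq_sym (negPf ne) mulr0n wact0l.
Qed.

End Degrees.

Section Lifting.
Variables (R : realType) (n : nat) (w : 'I_n -> R).
Local Notation K := R[i].
Local Notation fs := (fseries n K).
Local Notation D := (weyl n K).
Hypothesis w_gt0 : forall i, 0 < w i.

Lemma wdot_bounded (C : R) : exists N : nat, forall k, wdot w k <= C -> (mdeg k < N)%N.
Proof.
exists (\sum_i Num.truncn (C / w i)).+1 => k le_C; rewrite ltnS mdegE leq_sum // => i _.
have term_ge0 j : 0 <= w j * (k j)%:R by rewrite mulr_ge0 // ltW.
have le_i : (k i)%:R <= C / w i.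
  rewrite ler_pdivlMr // mulrC (le_trans _ le_C) // /wdot (bigD1 i) //= lerDl.
  exact: sumr_ge0.
by rewrite truncn_ge_nat // (le_trans _ le_i).
Qed.

Lemma finite_degrees q (t : 'I_q -> R) (C : R) :
  exists s : seq ('X_{1..n} * 'I_q), forall k j, wdot w k + t j <= C -> (k, j) \in s.
Proof.
have [N NP] := wdot_bounded (C + \sum_j `|t j|).
exists (mons_upto _ _ N) => k j le_C; apply: mem_mons_upto => /=; apply/ltnW/NP.
rewrite -lerBlDr (le_trans _ le_C) // lerD2l.
have := ler_norm (- t j); rewrite normrN => le_t.
rewrite lerNl (le_trans le_t) // (bigD1 j) //= lerDl.
exact: sumr_ge0.
Qed.

Variables (I : D -> Prop) (F : shifted_free n K) (b : {poly K}).
Hypothesis F_adapted : adapted_resolution w I F.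
Hypothesis b_bfun : is_bfunction w I b.
Variable d : nat.

Local Notation t := (rsh R (sh F d)).
Local Notation u := (rsh R (@sh_pred _ _ F d)).

(** The homotopy makes [b(mu)] annihilate the cohomology of degree [mu] of the
    graded complex. *)
Lemma gr_lift (f : 'I_(rk F d) -> fs) (mu : R) : fsup w eq_op mu t f ->
  wmat_act (gpsi w F d.+1) f = 0 -> b.[mu%:C%C] != 0 ->
  exists2 g : 'I_(rk_pred F d) -> fs, fsup w eq_op mu u g & f = wmat_act (gpsi w F d) g.
Proof.
move=> homf f0 bmu; have [H [H' phiE]] := homotopy F_adapted b_bfun d.
pose h := (b.[mu%:C%C])^-1 *: wmat_act H' f.
have fE : f = wmat_act (gpsi w F d) h.
  have := theta_diag_act b homf; rewrite phiE wmat_actD !wmat_actM f0 raddf0 add0r => E.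
  by rewrite wmat_actZ E scalerA mulVf // scale1r.
exists (fcomp w mu u h); first exact: fcomp_hom.
have homG := @gpsi_hom _ _ w F d.
apply/eqP; rewrite -subr_eq0; apply/eqP; apply: (@fsup_disjoint _ _ w _ t eq_op (@neqr R) mu).
- by move=> x xE; rewrite /neqr xE.
- apply: fsupB => //; apply: (fsup_act homG (@fcomp_hom _ _ w _ u mu h)).
  by move=> m x tau sg /eqP <- /eqP <-; rewrite addrA.
- rewrite {1}fE -raddfB; apply: (fsup_act homG (@fcomp_rest _ _ w _ u mu h)).
  by move=> m x tau sg /eqP <-; rewrite /neqr addrA.
Qed.

(** The lowest part of a solution is a solution of the initial system, hence the
    image of some [g]; [psi] and its initial part differ on [g] in higher degrees
    only. *)
Lemma lift_step (f : 'I_(rk F d) -> fs) (mu : R) : fsup w (@lerev R) mu t f ->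
  wmat_act (psi F d.+1) f = 0 -> b.[mu%:C%C] != 0 ->
  exists2 g : 'I_(rk_pred F d) -> fs, fsup w eq_op mu u g &
    fsup w (@ltrev R) mu t (f - wmat_act (psi F d) g).
Proof.
move=> supf f0 bmu; set f1 := fcomp w mu t f.
have homf1 : fsup w eq_op mu t f1 by apply: fcomp_hom.
have homG1 := @gpsi_hom _ _ w F d.+1; have homG := @gpsi_hom _ _ w F d.
have le1 := @psi_le _ _ _ _ _ F_adapted d.+1; have le0 := @psi_le _ _ _ _ _ F_adapted d.
have lt1 := mcomp_lower le1; have lt0 := mcomp_lower le0.
have [|g homg fE] := gr_lift homf1 _ bmu.
  apply: (@fsup_disjoint _ _ w _ (rsh R (sh F d.+1)) eq_op (@ltrev R) mu).
  - by move=> x /eqP ->; rewrite /ltrev ltxx.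
  - apply: (fsup_act homG1 homf1) => m x tau sg /eqP <- /eqP <-.
    by rewrite addrA.
  have E : wmat_act (gpsi w F d.+1) f1 = - (wmat_act (psi F d.+1) (f - f1) +
      wmat_act (psi F d.+1 - gpsi w F d.+1) f1).
    apply/eqP; rewrite eq_sym eqr_oppLR -addr_eq0 -addrA -wmat_actD subrK.
    by rewrite -raddfD /= subrK f0.
  rewrite E -sub0r; apply: fsupB; first by move=> j k; rewrite eqxx.
  apply: fsupD.
    apply: (fsup_act le1 (fcomp_upper supf)) => m x tau sg.
    by rewrite /ltrev; lra.
  apply: (fsup_act lt1 homf1) => m x tau sg lt_sg /eqP <-.
  by rewrite /ltrev; lra.
exists g => //.
have -> : f - wmat_act (psi F d) g = (f - f1) - wmat_act (psi F d - gpsi w F d) g.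
  have -> : wmat_act (psi F d) g = wmat_act (psi F d - gpsi w F d) g + f1.
    rewrite fE -wmat_actD; apply: (congr1 (fun A => wmat_act A g)).
    exact/esym/subrK.
  by rewrite opprD addrA addrAC.
apply: fsupB; first exact: fcomp_upper.
apply: (fsup_act lt0 homg) => m x tau sg lt_sg /eqP <-.
by rewrite /ltrev; lra.
Qed.

Variable k1 : R.
Hypothesis b_high : forall j k, k1 < wdot w k + t j -> b.[(wdot w k + t j)%:C%C] != 0.

(** The positivity of the weights leaves finitely many indices of degree at most
    [M]; each step removes those of the lowest degree that occurs. *)
Lemma lift_interval (f : 'I_(rk F d) -> fs) (m M : R) : k1 <= m ->
  wmat_act (psi F d.+1) f = 0 -> fsup w (@ltrev R) m t f ->
  exists2 g : 'I_(rk_pred F d) -> fs, fsup w (@ltrev R) m u g &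
    fsup w (@ltrev R) M t (f - wmat_act (psi F d) g).
Proof.
have [s sP] := finite_degrees t M.
pose deg (x : 'X_{1..n} * 'I_(rk F d)) := wdot w x.1 + t x.2.
move: {2}(count _ _).+1 (ltnSn (count (fun x => m < deg x) s)) => c.
elim: c => [//|c IH] in f m * => lt_c le_m f0 supf.
have [highf|] := pselect (fsup w (@ltrev R) M t f).
  by exists 0 => [j k|]; rewrite ?eqxx // raddf0 subr0.
move=> lowf; pose low x := (f x.2 x.1 != 0) && (deg x <= M).
have [x [xs lowx xmin]] : exists x, [/\ x \in s, low x & forall y, low y -> deg x <= deg y].
  have low_s x : low x -> x \in s.
    by case: x => k j /andP[_ le_M]; apply: sP.
  have [y lowy] : exists y, low y.
    apply: contrapT => no; apply: lowf => j k nz; rewrite /ltrev ltNge; apply/negP => le_M.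
    by apply: no; exists (k, j); rewrite /low nz.
  have : exists2 x, x \in [seq x <- s | low x] &
      {in [seq x <- s | low x], forall y, deg x <= deg y}.
    have : y \in [seq x <- s | low x] by rewrite mem_filter lowy low_s.
    elim: [seq x <- s | low x] y {lowy} => // z l IHl y _.
    case: l IHl => [|z' l] IHl.
      by exists z; rewrite ?mem_head // => y'; rewrite inE => /eqP ->.
    have [x xl xmin] := IHl z' (mem_head _ _).
    have [le_zx|lt_xz] := leP (deg z) (deg x).
      exists z; rewrite ?mem_head // => y'; rewrite inE => /predU1P[-> //|/xmin].
      exact: le_trans.
    exists x; first by rewrite inE xl orbT.
    by move=> y'; rewrite inE => /predU1P[->|/xmin //]; apply: ltW.
  case=> x; rewrite mem_filter => /andP[lowx xs] xmin; exists x; split=> // z lowz.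
  by apply: xmin; rewrite mem_filter lowz low_s.
have [fx le_x] := andP lowx; have lt_mx : m < deg x by apply: (supf _ _ fx).
have supx : fsup w (@lerev R) (deg x) t f.
  move=> j k nz; rewrite /lerev; have [le_M|lt_M] := leP (wdot w k + t j) M.
    by apply: (xmin (k, j)); rewrite /low nz.
  by apply: le_trans le_x (ltW lt_M).
have [|g homg supg] := lift_step supx f0.
  by apply: b_high; apply: le_lt_trans le_m lt_mx.
have kill g' : wmat_act (psi F d.+1) (f - wmat_act (psi F d) g') = 0.
  by rewrite raddfB /= f0 -wmat_actM (psi_comp F_adapted) sub0r /wmat_act;
    apply/funext => i; rewrite fctE big1 ?oppr0 // => j _; rewrite mxE wact0l.
have [||||g' supg' highg'] := IH (f - wmat_act (psi F d) g) (deg x).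
- rewrite -ltnS; apply: leq_trans lt_c; rewrite ltnS.
  apply: (@count_lt _ _ _ _ x) => //; last by rewrite ltxx.
  by move=> y; apply: lt_trans.
- exact: le_trans le_m (ltW lt_mx).
- exact: kill.
- exact: supg.
exists (g + g'); last by rewrite raddfD /= opprD addrA.
apply: fsupD.
  by apply: fsup_sub homg => y /eqP ->.
by apply: fsup_sub supg' => y; apply: lt_trans.
Qed.

(** The lifts of successive intervals of degrees have increasing degrees, so
    that their sum is a formal power series. *)
Theorem lift_high (f : 'I_(rk F d) -> fs) :
  wmat_act (psi F d.+1) f = 0 -> fsup w (@ltrev R) k1 t f ->
  exists g : 'I_(rk_pred F d) -> fs, f = wmat_act (psi F d) g.
Proof.
move=> f0 supf; pose lev (N : nat) : R := k1 + N%:R.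
have lev_ge N : k1 <= lev N by rewrite lerDl.
have /boolp.choice[G GP] (x : nat * ('I_(rk F d) -> fs)) :
    exists g : 'I_(rk_pred F d) -> fs, wmat_act (psi F d.+1) x.2 = 0 ->
    fsup w (@ltrev R) (lev x.1) t x.2 -> fsup w (@ltrev R) (lev x.1) u g /\
    fsup w (@ltrev R) (lev x.1.+1) t (x.2 - wmat_act (psi F d) g).
  have [[x0 supx]|no] := pselect (wmat_act (psi F d.+1) x.2 = 0 /\
    fsup w (@ltrev R) (lev x.1) t x.2); last by exists 0 => x0 supx; case: no.
  by have [g ? ?] := lift_interval (lev x.1.+1) (lev_ge x.1) x0 supx; exists g.
pose ff := fix ff N := if N is N'.+1 then ff N' - wmat_act (psi F d) (G (N', ff N')) else f.
pose gg N := G (N, ff N).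
have psi0 g : wmat_act (psi F d.+1) (wmat_act (psi F d) g) = 0.
  rewrite -wmat_actM (psi_comp F_adapted); apply/funext => i.
  by apply: big1 => j _; rewrite mxE wact0l.
have ffP N : wmat_act (psi F d.+1) (ff N) = 0 /\ fsup w (@ltrev R) (lev N) t (ff N).
  elim: N => [|N [ffN supN]] /=; first by rewrite /lev addr0.
  split; first by rewrite raddfB /= ffN psi0 subrr.
  by case: (GP (N, ff N) ffN supN).
have ggP N : fsup w (@ltrev R) (lev N) u (gg N).
  by have [ffN supN] := ffP N; case: (GP (N, ff N) ffN supN).
have ffE N : ff N = f - wmat_act (psi F d) (\sum_(i < N) gg i).
  elim: N => [|N IH]; first by rewrite big_ord0 raddf0 subr0.
  by rewrite big_ord_recr raddfD /= opprD addrA -IH.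
pose bnd j k := (Num.truncn (`|wdot w k + u j - k1|)).+1.
pose g : 'I_(rk_pred F d) -> fs := fun j k => \sum_(i < bnd j k) gg i j k.
have gg0 N j k : wdot w k + u j <= lev N -> gg N j k = 0.
  move=> le_N; apply/eqP/negPn/negP => /ggP; rewrite /ltrev.
  by rewrite ltNge le_N.
have sum_stable j k L L' : wdot w k + u j <= lev L -> (L <= L')%N ->
    \sum_(i < L') gg i j k = \sum_(i < L) gg i j k.
  move=> le_L LL'; rewrite -(subnKC LL') big_split_ord /= [X in _ + X]big1 ?addr0 // => i _.
  apply: gg0; apply: le_trans le_L _; rewrite lerD2l ler_nat; exact: leq_addr.
have tail L : fsup w (@ltrev R) (lev L) u (g - \sum_(i < L) gg i).
  move=> j k; rewrite /ltrev ltNge; apply: contra => le_L.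
  have -> : (g - \sum_(i < L) gg i) j k = g j k - (\sum_(i < L) gg i) j k by [].
  have le_b : wdot w k + u j <= lev (bnd j k).
    rewrite -lerBlDl (le_trans (ler_norm _)) // ltW //; exact: truncnS_gt.
  rewrite !fct_sumE subr_eq0 /g -(sum_stable j k _ (maxn L (bnd j k)) le_b) ?leq_maxr //.
  by rewrite (sum_stable j k L) ?leq_maxl.
exists g; apply/eqP; rewrite -subr_eq0; apply/eqP.
apply: funext => j; apply: funext => k; apply/eqP/negPn/negP => nz.
pose L := (Num.truncn (`|wdot w k + t j - k1|)).+1.
have high : fsup w (@ltrev R) (lev L) t (f - wmat_act (psi F d) g).
  have -> : f - wmat_act (psi F d) g = ff L - wmat_act (psi F d) (g - \sum_(i < L) gg i).
    by rewrite ffE raddfB /= opprB addrA subrK.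
  apply: fsupB; first by case: (ffP L).
  have le0 := @psi_le _ _ _ _ _ F_adapted d.
  apply: (fsup_act le0 (tail L)) => m x tau sg.
  by rewrite /ltrev; lra.
have := high _ _ nz; rewrite /ltrev ltNge => /negP; apply.
rewrite -lerBlDl (le_trans (ler_norm _)) // ltW //; exact: truncnS_gt.
Qed.

End Lifting.

(** * Truncated vectors and formal solutions *)

Section Sigma.
Variables (R : realType) (n : nat).
Local Notation K := R[i].
Local Notation fs := (fseries n K).
Local Notation D := (weyl n K).

Lemma mfact_neq0 (m : 'X_{1..n}) : (mfact m)%:R != 0 :> K.
Proof.
rewrite pnatr_eq0 -lt0n /mfact; elim/big_ind: _ => // [x y x0 y0|i _].
  by rewrite muln_gt0 x0.
exact: fact_gt0.
Qed.

Lemma mfact0 : @mfact n 0%MM = 1%N.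
Proof. by rewrite /mfact big1 // => i _; rewrite mnm0E. Qed.

Lemma sigmaE q (c : ivec R n q) l k : sigma c l k = c (k, l) / (mfact k)%:R.
Proof. by []. Qed.

Lemma sigmaK q (c : ivec R n q) l k : sigma c l k *+ mfact k = c (k, l).
Proof.
rewrite sigmaE -(@mulr_natr K); exact: (@divfK K _ (mfact_neq0 k)).
Qed.

Definition coefs q (f : 'I_q -> fs) : ivec R n q := fun kl => f kl.2 kl.1 *+ mfact kl.1.

Lemma coefsK q (f : 'I_q -> fs) : sigma (coefs f) = f.
Proof.
apply: funext => l; apply: funext => k.
rewrite sigmaE /coefs -(@mulr_natr K); exact: (@mulfK K _ (mfact_neq0 k)).
Qed.

Lemma sigma_inj q : injective (@sigma R n q).
Proof.
move=> c c' eqcc; apply: funext => -[k l].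
by rewrite -(sigmaK c) -(sigmaK c') eqcc.
Qed.

Lemma sigma_is_zmod_morphism q : zmod_morphism (@sigma R n q : ivec R n q -> ('I_q -> fs)).
Proof. by move=> c c'; apply: funext => l; apply: funext => k; apply: mulrBl. Qed.

HB.instance Definition _ q := GRing.isZmodMorphism.Build (ivec R n q) ('I_q -> fs)
  (@sigma R n q) (@sigma_is_zmod_morphism q).

Lemma sigmaZ q a (c : ivec R n q) : sigma (a *: c) = a *: sigma c :> ('I_q -> fs).
Proof. by apply: funext => l; apply: funext => k; apply/esym/mulrA. Qed.

Lemma wact_at0 (P : D) (f : fs) : wact P f 0%MM =
  \sum_(ab <- wsupp P | ab.1 == 0%MM) wcoef P 0%MM ab.2 * (f ab.2 *+ mfact ab.2).
Proof.
rewrite wactE fct_sumE [RHS]big_mkcond; apply: eq_bigr => -[a b] _ /=.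
rewrite -[LHS]/(wcoef P a b * wact (wmon K a b) f 0%MM) wact_mon.
have [->|a0] := eqVneq a 0%MM.
  rewrite lepm_refl subm0; congr (_ * _).
  by rewrite -[LHS]mulr1n -mfact0 fs_derivm_coef add0m.
case: ifP => [/mnm_lepP le0|]; last by rewrite mulr0.
by case/eqP: a0; apply/mnmP => i; have := le0 i; rewrite mnm0E leqn0 => /eqP.
Qed.

(** The coefficient [i! F_i] of [F = A c] is the value at the origin of
    [\partial^i F], an application of [\partial^i A]. *)
Lemma sigma_bar p q (A : 'M[D]_(p, q)) (c : ivec R n q) :
  sigma (bar_mul A c) = wmat_act A (sigma c).
Proof.
apply: funext => j; apply: funext => i; rewrite sigmaE.
apply: (canLR (mulfK (mfact_neq0 i))); rewrite mulr_natr.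
rewrite -[in RHS](add0m i) -(fs_derivm_coef i) mfact0 mulr1n.
have -> : fs_derivm i (wmat_act A (sigma c) j) 0%MM =
    wact (wmon K 0%MM i) (wmat_act A (sigma c) j) 0%MM.
  by rewrite wact_mon lepm_refl subm0.
rewrite /wmat_act raddf_sum fct_sumE; apply: eq_bigr => l _.
rewrite -[RHS]/(wact (wmon K 0%MM i) (wact (A j l) (sigma c l)) 0%MM) -wactM wact_at0.
by apply: eq_bigr => ab _; rewrite sigmaK.
Qed.

End Sigma.

Section Truncations.
Variables (R : realType) (n : nat) (w : 'I_n -> R).
Local Notation K := R[i].
Local Notation fs := (fseries n K).
Local Notation D := (weyl n K).

Lemma idegE q (t : 'I_q -> int) kl : ideg w t kl = wdot w kl.1 + rsh R t kl.2.
Proof. by []. Qed.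

Lemma trunc_is_zmod_morphism m q (t : 'I_q -> int) :
  zmod_morphism (trunc w m t : ivec R n q -> ivec R n q).
Proof.
move=> c c'; apply: funext => kl.
rewrite -[RHS]/(trunc w m t c kl - trunc w m t c' kl) /trunc.
by case: ifP => // _; rewrite subr0.
Qed.

HB.instance Definition _ m q (t : 'I_q -> int) :=
  GRing.isZmodMorphism.Build (ivec R n q) (ivec R n q) (trunc w m t)
    (@trunc_is_zmod_morphism m q t).

Lemma truncZ m q (t : 'I_q -> int) a (c : ivec R n q) :
  trunc w m t (a *: c) = a *: trunc w m t c.
Proof.
apply: funext => kl; rewrite -[RHS]/(a * trunc w m t c kl) /trunc.
by case: ifP => // _; rewrite mulr0.
Qed.

Lemma trunc_id m q (t : 'I_q -> int) (c : ivec R n q) :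
  trunc w m t (trunc w m t c) = trunc w m t c.
Proof. by apply: funext => kl; rewrite /trunc; case: (ideg w t kl <= m%:~R). Qed.

Lemma trunc_fsup m q (t : 'I_q -> int) (c : ivec R n q) : trunc w m t c = 0 ->
  fsup w (@ltrev R) m%:~R (rsh R t) (sigma c).
Proof.
move=> c0 l k; rewrite /ltrev ltNge sigmaE; apply: contra => le_m.
have := congr1 (fun c : ivec R n q => c (k, l)) c0; rewrite /trunc idegE le_m => ->.
by rewrite mul0r.
Qed.

Lemma fsup_trunc m q (t : 'I_q -> int) (c : ivec R n q) :
  fsup w (@ltrev R) m%:~R (rsh R t) (sigma c) -> trunc w m t c = 0.
Proof.
move=> supc; apply: funext => -[k l]; rewrite /trunc; case: ifP => // le_m.
rewrite -[LHS]sigmaK; have [->|/supc] := eqVneq (sigma c l k) 0; first exact: mul0rn.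
by rewrite /ltrev ltNge -[_ + _]/(ideg w t (k, l)) le_m.
Qed.

(** The matrices are block triangular: [A] maps series of degrees above [m] to
    series of degrees above [m]. *)
Lemma trunc_bar m p q (s : 'I_p -> int) (t : 'I_q -> int) (A : 'M[D]_(p, q))
    (c : ivec R n q) : mgr w <=%R (rsh R s) (rsh R t) A ->
  trunc w m s (bar_mul A (trunc w m t c)) = trunc w m s (bar_mul A c).
Proof.
move=> leA; apply/esym/eqP; rewrite -subr_eq0 -raddfB; apply/eqP/fsup_trunc.
rewrite raddfB /= !sigma_bar -!raddfB /=.
have supc : fsup w (@ltrev R) m%:~R (rsh R t) (sigma (c - trunc w m t c)).
  by apply: trunc_fsup; rewrite raddfB /= trunc_id subrr.
apply: (fsup_act leA supc) => mu x tau sg; rewrite /ltrev; lra.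
Qed.

End Truncations.

(** * The resolution over the analytic operators *)

Section Convergence.
Variables (n : nat) (K : numFieldType).
Local Notation fs := (fseries n K).

Lemma convergent0 : convergent (0 : fs).
Proof. by exists 0, 1; split=> // m; rewrite normr0 mul0r. Qed.

Lemma convergentD (f g : fs) : convergent f -> convergent g -> convergent (f + g).
Proof.
move=> cf cg.
have [|r [C [r0 _ C0 bnd]]] := @convergent_common n K bool (fun b => if b then f else g).
  by case.
exists (C + C), r; split=> // m; rewrite -[(f + g) m]/(f m + g m).
apply: (le_trans (ler_wpM2r (exprn_ge0 _ (ltW r0)) (ler_normD _ _))).
by rewrite mulrDl lerD //; [apply: (bnd true)|apply: (bnd false)].
Qed.

Lemma convergent_sum (I : Type) (s : seq I) (p : pred I) (F : I -> fs) :
  (forall i, convergent (F i)) -> convergent (\sum_(i <- s | p i) F i).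
Proof.
move=> cF; elim/big_ind: _ => //; [exact: convergent0|exact: convergentD].
Qed.

Lemma convergent_mul_poly (f : fs) (p : {mpoly K[n]}) :
  convergent f -> convergent (f * mp_fseries p).
Proof.
move=> [C [r [r0 bnd]]].
have C0 : 0 <= C by apply: le_trans (bnd 0%MM); rewrite mulr_ge0 // exprn_ge0 // ltW.
exists (\sum_(a <- msupp p) `|p@_a| * (C * r ^+ mdeg a)), r; split=> // m.
rewrite mp_fs_mulE big_mkcond.
apply: (le_trans (ler_wpM2r (exprn_ge0 _ (ltW r0)) (ler_norm_sum _ _ _))).
rewrite mulr_suml ler_sum // => a _; case: ifP => [le_am|_]; last first.
  by rewrite normr0 mul0r !mulr_ge0 // exprn_ge0 // ltW.
rewrite normrM -mulrA ler_wpM2l // -{2}(submK le_am) mdegD exprD mulrA.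
by rewrite ler_wpM2r // exprn_ge0 // ltW.
Qed.

End Convergence.

Section FormalOperatorCoefficients.
Variables (n : nat) (K : comNzRingType).
Local Notation fs := (fseries n K).
Local Notation Dh := (fdiffop n K).
Local Notation symbol := {mpoly fs[n]}.
Local Notation wsymbol := {mpoly {mpoly K[n]}[n]}.
Local Notation pderivm := (dop_pderivm (mp_derivations n K)).

Definition opcoef (P : Dh) (b : 'X_{1..n}) : fs := (P : symbol)@_b.

Lemma opcoefP (P Q : Dh) : (forall b, opcoef P b = opcoef Q b) -> P = Q.
Proof. by move=> eqPQ; apply/(@mpolyP n _ (P : symbol) Q). Qed.

Lemma opcoef0 b : opcoef 0 b = 0.
Proof. exact: mcoeff0. Qed.

Lemma opcoef_sum (I : Type) (s : seq I) (p : pred I) (F : I -> Dh) b :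
  opcoef (\sum_(i <- s | p i) F i) b = \sum_(i <- s | p i) opcoef (F i) b.
Proof. exact: (raddf_sum (mcoeff b : {additive symbol -> fs})). Qed.

Lemma opcoef_to (P : weyl n K) b : opcoef (to_fdiffop P) b = mp_fseries (P : wsymbol)@_b.
Proof. exact: mcoeff_to_fdiffop. Qed.

Lemma to_fdiffop_pderivm b (Q : wsymbol) :
  to_fdiffop (pderivm b Q : weyl n K) =
  dop_pderivm (fs_derivations n K) b (to_fdiffop (Q : weyl n K)).
Proof.
elim/dop_pderivm_ind: b => [|b i IH]; first by rewrite !dop_pderivm0.
by rewrite -!dop_pderiv_pderivm to_fdiffop_pderiv IH.
Qed.

Lemma opcoef_mul k (P : Dh) (Q : weyl n K) c : (msize (P : symbol) <= k)%N ->
  opcoef (P * to_fdiffop Q) c =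
  \sum_(b : 'X_{1..n < k}) opcoef P b * mp_fseries (pderivm b (Q : wsymbol))@_c.
Proof.
move=> le_k; rewrite -[P * _]/(dop_mul _ (P : symbol) (to_fdiffop Q)) (dop_mulwE _ _ le_k).
apply: (etrans (opcoef_sum _ _ _ _)); apply: eq_bigr => b _.
rewrite -to_fdiffop_pderivm; apply: (etrans (mcoeffZ _ _ _)).
by rewrite mcoeff_to_fdiffop.
Qed.

Definition opscale (f : fs) (P : Dh) : Dh := f *: (P : symbol).

Lemma opcoef_scale f P b : opcoef (opscale f P) b = f * opcoef P b.
Proof. exact: mcoeffZ. Qed.

Lemma opscaleM f P Q : opscale f (P * Q) = opscale f P * Q.
Proof. exact/esym/dop_mulZl. Qed.

Lemma opscale_sum (J : Type) (s : seq J) (p : pred J) f (F : J -> Dh) :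
  opscale f (\sum_(i <- s | p i) F i) = \sum_(i <- s | p i) opscale f (F i).
Proof. exact: (scaler_sumr f s p (F : J -> symbol)). Qed.

End FormalOperatorCoefficients.

Section AnalyticResolution.
Variables (R : realType) (n : nat) (w : 'I_n -> R).
Local Notation K := R[i].
Local Notation D := (weyl n K).
Local Notation fs := (fseries n K).
Local Notation Dh := (fdiffop n K).
Local Notation wsymbol := {mpoly {mpoly K[n]}[n]}.
Local Notation symbol := {mpoly fs[n]}.
Local Notation pderivm := (dop_pderivm (mp_derivations n K)).

(** For operators of bounded order, the equation [Q psi = 0] is a linear system
    over the polynomials in the coefficients of [Q], so flatness applies. *)
Lemma analytic_syzygies p q (psi : 'M[D]_(p, q)) (Q : 'rV[Dh]_p) :
  (forall j, analytic_op (Q 0 j)) -> Q *m map_mx (@to_fdiffop n K) psi = 0 ->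
  exists N (S : 'I_N -> fs) (h : 'I_N -> 'rV[D]_p),
  [/\ forall i, convergent (S i), forall i, h i *m psi = 0 &
      forall j, Q 0 j = \sum_i opscale (S i) (to_fdiffop (h i 0 j))].
Proof.
move=> anQ Q0; pose k := (\sum_j msize (Q 0%R j : symbol))%N.
have le_k j : (msize (Q 0%R j : symbol) <= k)%N by rewrite /k (bigD1 j) //= leq_addr.
(* Bounds for the orders in [\partial] of the unknowns and of the equations. *)
pose k' := (\sum_j \sum_l \sum_(b : 'X_{1..n < k}) msize (pderivm b (psi j l : wsymbol)))%N.
have le_k' j l (b : 'X_{1..n < k}) c : ~~ (mdeg c < k')%N ->
    (pderivm b (psi j l : wsymbol))@_c = 0.
  rewrite -leqNgt => le_c; apply/memN_msupp_eq0/msize_mdeg_ge; apply: leq_trans le_c.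
  by rewrite /k' (bigD1 j) //= (bigD1 l) //= (bigD1 b) //= -!addnA leq_addr.
pose M (x : 'I_p * 'X_{1..n < k}) (y : 'I_q * 'X_{1..n < k'}) : {mpoly K[n]} :=
  (pderivm x.2 (psi x.1 y.1 : wsymbol))@_y.2.
pose QQ (x : 'I_p * 'X_{1..n < k}) := opcoef (Q 0 x.1) x.2.
have [|y|N [S [P [cS PM QE]]]] := @convergent_flat n K _ _ M QQ.
- by move=> x; apply: anQ.
- have /rowP/(_ y.1) := Q0; rewrite !mxE => /(congr1 (fun P => opcoef P y.2)).
  rewrite opcoef0 opcoef_sum => E; rewrite -[RHS]E.
  rewrite -(pair_bigA _ (fun j b => QQ (j, b) * mp_fseries (M (j, b) y))) /=.
  by apply: eq_bigr => j _; rewrite mxE (opcoef_mul _ _ (le_k j)).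
pose h i : 'rV[D]_p := \row_j (\sum_(b : 'X_{1..n < k}) P i (j, b) *: ('X_[b] : wsymbol) : wsymbol).
have hpsi i j l : h i 0 j * psi j l =
    (\sum_(b : 'X_{1..n < k}) P i (j, b) *: pderivm b (psi j l : wsymbol) : wsymbol) :> D.
  rewrite mxE -[LHS]/(dop_mul _ _ _) dop_mul_suml; apply: eq_bigr => b _.
  by rewrite dop_mulZl dop_mulX.
exists N, S, h; split=> // [i|j].
  apply/rowP => l; rewrite mxE [RHS]mxE; apply/(@mpolyP n {mpoly K[n]}) => c.
  rewrite mcoeff0; apply: (etrans (raddf_sum (mcoeff c : {additive wsymbol -> {mpoly K[n]}}) _ _ _)).
  have E j : ((h i 0 j * psi j l : D) : wsymbol)@_c =
      \sum_(b : 'X_{1..n < k}) P i (j, b) * (pderivm b (psi j l : wsymbol))@_c.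
    by rewrite hpsi raddf_sum; apply: eq_bigr => b _; rewrite /= mcoeffZ.
  apply: (etrans (eq_bigr _ (fun j _ => E j))).
  have [lt_c|ge_c] := boolP (mdeg c < k')%N; last first.
    by rewrite big1 // => j _; rewrite big1 // => b _; rewrite le_k' ?mulr0.
  rewrite (pair_bigA _ (fun j (b : 'X_{1..n < k}) => P i (j, b) * (pderivm b (psi j l : wsymbol))@_c)) /=.
  rewrite -[RHS](PM i (l, BMultinom lt_c)); apply: eq_bigr => -[j b] _ //.
apply: opcoefP => b; rewrite opcoef_sum.
have hE i : opcoef (to_fdiffop (h i 0 j)) b =
    mp_fseries (\sum_(b' : 'X_{1..n < k}) P i (j, b') * (b' == b :> 'X_{1..n})%:R).
  rewrite opcoef_to mxE raddf_sum; congr mp_fseries; apply: eq_bigr => b' _.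
  by rewrite /= mcoeffZ mcoeffX.
under eq_bigr => i _ do rewrite opcoef_scale hE.
have [lt_b|ge_b] := boolP (mdeg b < k)%N; last first.
  have -> : opcoef (Q 0 j) b = 0.
    by apply/memN_msupp_eq0/msize_mdeg_ge/(leq_trans (le_k j)); rewrite leqNgt.
  rewrite big1 // => i _; rewrite big1 ?rmorph0 ?mulr0 // => b' _.
  case: eqP => [bE|_]; last by rewrite mulr0.
  by case/negP: ge_b; rewrite -bE; apply: bmdeg.
have := QE (j, BMultinom lt_b); rewrite /QQ /= => ->; apply: eq_bigr => i _.
congr (_ * mp_fseries _); rewrite (bigD1 (BMultinom lt_b)) //= eqxx mulr1 big1 ?addr0 // => b'.
by rewrite bmeqP /= => /negPf ->; rewrite mulr0.
Qed.

Variables (I : D -> Prop) (F : shifted_free n K).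
Hypothesis F_adapted : adapted_resolution w I F.

(** The polynomial syzygies that [analytic_syzygies] provides are combinations of
    rows of the next matrix over the Weyl algebra. *)
Theorem adapted_analytic : analytic_resolution I F.
Proof.
have [rk0 _ _ _ _] := F_adapted; split=> // i Q anQ; split; last first.
  move=> [S [anS ->]]; case: i Q anQ S anS => [|i] Q anQ S anS /=; last first.
    by rewrite -mulmxA -map_mxM (psi_comp F_adapted) map_mx0 mulmx0.
  move=> j; exists (rk F 1), (fun k => S 0 k), (fun k => psi F 1 k j); split=> [k|].
    split; first exact: anS.
    have /(out_kernelP F_adapted) kk : exists S', row k (psi F 1) = S' *m psi F 1.
      by exists (delta_mx 0 k); rewrite rowE.
    by have := kk j; rewrite mxE.
  by rewrite mxE; apply: eq_bigr => k _; rewrite [X in _ * X = _]mxE.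
case: i Q anQ => [|i] Q anQ kQ.
  pose j0 : 'I_(rk F 0) := cast_ord (esym rk0) ord0.
  have [N [a [g [agP QE]]]] := kQ j0.
  have /boolp.choice[c cP] l : exists c, \row_(j < rk F 0) g l = c *m psi F 1.
    by apply/(out_kernelP F_adapted) => j; rewrite mxE; case: (agP l).
  pose A : 'rV[Dh]_(rk F 1) := \row_k \sum_l a l * to_fdiffop (c l 0 k).
  have AE k : A 0 k = (\sum_l a l * to_fdiffop (c l 0 k) : Dh).
    exact: mxE.
  exists A; split=> [k b|].
    rewrite AE -[_@_b]/(opcoef _ b) opcoef_sum; apply: convergent_sum => l.
    rewrite (opcoef_mul _ _ (leqnn _)); apply: convergent_sum => b'.
    by apply: convergent_mul_poly; case: (agP l) => + _; apply.
  apply/rowP => j; have -> : j = j0.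
    by apply/val_inj; case: j => j + /=; rewrite rk0 ltnS leqn0 => /eqP.
  rewrite QE; apply: (@etrans _ _ (\sum_l \sum_k a l * to_fdiffop (c l 0 k) * to_fdiffop (psi F 1 k j0))).
    apply: eq_bigr => l _; have /rowP/(_ j0) := cP l; rewrite mxE => ->.
    rewrite mxE rmorph_sum mulr_sumr; apply: eq_bigr => k _.
    by rewrite rmorphM mulrA.
  rewrite exchange_big [RHS]mxE; apply: eq_bigr => k _.
  have -> : map_mx (@to_fdiffop n K) (psi F 1) k j0 = to_fdiffop (psi F 1 k j0) by rewrite [LHS]mxE.
  rewrite AE; exact/esym/mulr_suml.
have [N [S [h [cS h0 QE]]]] := analytic_syzygies anQ kQ.
have /boolp.choice[T TP] l : exists T, h l = T *m psi F i.+2.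
  by apply/(out_kernelP F_adapted); apply: h0.
pose A : 'rV[Dh]_(rk F i.+2) := \row_k \sum_l opscale (S l) (to_fdiffop (T l 0 k)).
have AE k : A 0 k = (\sum_l opscale (S l) (to_fdiffop (T l 0 k)) : Dh).
  exact: mxE.
exists A; split=> [k b|].
  rewrite AE -[_@_b]/(opcoef _ b) opcoef_sum; apply: convergent_sum => l.
  by rewrite opcoef_scale opcoef_to; apply: convergent_mul_poly.
apply/rowP => j; rewrite QE.
apply: (@etrans _ _ (\sum_l \sum_k opscale (S l) (to_fdiffop (T l 0 k)) * to_fdiffop (psi F i.+2 k j))).
  apply: eq_bigr => l _; rewrite TP mxE rmorph_sum opscale_sum; apply: eq_bigr => k _.
  by rewrite rmorphM opscaleM.
rewrite exchange_big [RHS]mxE; apply: eq_bigr => k _.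
have -> : map_mx (@to_fdiffop n K) (psi F i.+2) k j = to_fdiffop (psi F i.+2 k j) by rewrite [LHS]mxE.
rewrite AE; exact/esym/mulr_suml.
Qed.

End AnalyticResolution.

(** * The cohomology of the truncated complex *)

Section TruncatedBasis.
Variables (R : realType) (n : nat) (w : 'I_n -> R).
Local Notation K := R[i].
Local Notation fs := (fseries n K).
Local Notation D := (weyl n K).
Variables (I : D -> Prop) (F : shifted_free n K) (b : {poly K}).
Hypothesis w_gt0 : forall i, 0 < w i.
Hypothesis F_adapted : adapted_resolution w I F.
Hypothesis b_bfun : is_bfunction w I b.
Variables (d : nat) (k1 : int).
Hypothesis k1_deg : forall kl : 'X_{1..n} * 'I_(rk F d),
  root b (ideg w (sh F d) kl)%:C%C -> ideg w (sh F d) kl <= k1%:~R.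

Local Notation A := (psi F d.+1).
Local Notation B := (psi F d).
Local Notation s := (sh F d.+1).
Local Notation t := (sh F d).
Local Notation u := (@sh_pred _ _ F d).

Lemma trunc_barA m (c : ivec R n (rk F d)) :
  trunc w m s (bar_mul A (trunc w m t c)) = trunc w m s (bar_mul A c).
Proof. exact: trunc_bar (@psi_le _ _ _ _ _ F_adapted d.+1). Qed.

Lemma trunc_barB m (c : ivec R n (rk_pred F d)) :
  trunc w m t (bar_mul B (trunc w m u c)) = trunc w m t (bar_mul B c).
Proof. exact: trunc_bar (@psi_le _ _ _ _ _ F_adapted d). Qed.

(** Each coefficient of the image of [c] is seen by the truncations of high degree. *)
Lemma extension_solution (c : ivec R n (rk F d)) :
  (forall m : int, k1 <= m -> trunc_ker w m A t s (trunc w m t c)) ->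
  wmat_act A (sigma c) = 0.
Proof.
move=> kc; rewrite -sigma_bar; apply: (etrans _ (raddf0 (@sigma R n _))).
congr sigma; apply: funext => ij.
pose m : int := Num.max k1 (Num.ceil (ideg w s ij)).
have [|_] := kc m; first by rewrite le_max lexx.
rewrite /trunc_mul trunc_id trunc_barA.
move/(congr1 (fun c : ivec R n _ => c ij)); rewrite /trunc.
suff -> : ideg w s ij <= m%:~R by [].
by rewrite (le_trans (ceil_ge _)) // ler_int le_max lexx orbT.
Qed.

(** The low degrees are governed by the truncated complex and the high ones are
    exact: subtracting from a solution a combination of the extensions and a
    boundary leaves degrees above [k1] only, and [lift_high] applies. *)
Lemma truncated_basis (e : nat) (c cinf : 'I_e -> ivec R n (rk F d)) :
  basis_mod (trunc_ker w k1 A t s) (trunc_im w k1 B u t) c ->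
  (forall i, trunc w k1 t (cinf i) = c i /\
     forall m : int, k1 <= m -> trunc_ker w m A t s (trunc w m t (cinf i))) ->
  basis_mod (fun f : 'I_(rk F d) -> fs => wmat_act A f = 0)
    (fun f => exists g, f = wmat_act B g) (fun i => sigma (cinf i)).
Proof.
move=> [_ free_c span_c] ext.
have sigma_comb (a : 'I_e -> K) :
    \sum_i a i *: sigma (cinf i) = sigma (\sum_i a i *: cinf i) :> ('I_(rk F d) -> fs).
  by rewrite (raddf_sum (@sigma R n _)); apply: eq_bigr => i _; apply/esym/sigmaZ.
have trunc_comb (a : 'I_e -> K) :
    trunc w k1 t (\sum_i a i *: cinf i) = \sum_i a i *: c i.
  rewrite (raddf_sum (trunc w k1 t)); apply: eq_bigr => i _.
  by apply: (etrans (truncZ _ _ _ _ _)); case: (ext i) => ->.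
split=> [i|a [g gE] |f f0].
- by apply: extension_solution; case: (ext i).
- apply: free_c; exists (trunc w k1 u (coefs g)); first exact: trunc_id.
  rewrite -trunc_comb /trunc_mul trunc_id trunc_barB; congr trunc.
  by apply: sigma_inj; rewrite sigma_bar coefsK -gE -sigma_comb.
have ker_f : trunc_ker w k1 A t s (trunc w k1 t (coefs f)).
  split; first exact: trunc_id.
  rewrite /trunc_mul trunc_id trunc_barA; apply/fsup_trunc; rewrite sigma_bar coefsK f0.
  by move=> j k; rewrite eqxx.
have [a [g0 g0E im_g0]] := span_c _ ker_f.
exists a; pose f1 : 'I_(rk F d) -> fs :=
  sigma (coefs f - \sum_i a i *: cinf i - bar_mul B g0).
have f1E : f1 = f - \sum_i a i *: sigma (cinf i) - wmat_act B (sigma g0).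
  by rewrite /f1 2!(raddfB (@sigma R n _)) /= sigma_bar coefsK sigma_comb.
have high_f1 : fsup w (@ltrev R) k1%:~R (rsh R t) f1.
  apply: trunc_fsup; rewrite 2!(raddfB (trunc w k1 t)) /= trunc_comb im_g0.
  by rewrite /trunc_mul trunc_barB subrr.
have [||g1 g1E] := lift_high w_gt0 F_adapted b_bfun _ _ high_f1.
- move=> j k lt_k; apply: contraL lt_k => /eqP rt.
  by rewrite -leNgt; apply: (k1_deg (kl := (k, j))); apply/eqP.
- rewrite f1E 2!raddfB /= f0 sub0r raddf_sum big1 => [|i _]; last first.
    by rewrite /= wmat_actZ extension_solution ?scaler0 //; case: (ext i).
  rewrite oppr0 sub0r -wmat_actM (psi_comp F_adapted); apply/funext => i.
  rewrite -[LHS]/(- (wmat_act 0 (sigma g0) i)) /wmat_act big1 ?oppr0 // => j _.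
  by rewrite mxE wact0l.
exists (sigma g0 + g1); rewrite raddfD /= -g1E f1E.
by apply/esym; rewrite addrC; apply: subrK.
Qed.

End TruncatedBasis.

Lemma classical_solutions (R : realType) n (w : 'I_n -> R) (I : weyl n R[i] -> Prop)
    (F : shifted_free n R[i]) (f : 'I_(rk F 0) -> fseries n R[i]) :
  left_ideal I -> adapted_resolution w I F ->
  wmat_act (psi F 1) f = 0 <-> (forall l j, I l -> wact l (f j) = 0).
Proof.
move=> [I0 _ _] F_adapted; split=> [f0 l j Il|f0].
  pose Q : 'rV[weyl n R[i]]_(rk F 0) := \row_k (if k == j then l else 0).
  have /(out_kernelP F_adapted)[S QE] : @out_kernel _ _ F I 0 Q.
    by move=> k; rewrite mxE; case: ifP.
  have : wmat_act Q f 0 = 0 by rewrite QE wmat_actM f0 raddf0.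
  rewrite /wmat_act (bigD1 j) // big1 => [|k ne].
    by rewrite mxE eqxx Monoid.mulm1.
  by rewrite mxE (negPf ne) wact0l.
apply: funext => k; apply: big1 => j _; apply: f0.
have /(out_kernelP F_adapted) kk : exists S, row k (psi F 1) = S *m psi F 1.
  by exists (delta_mx 0 k); rewrite rowE.
by have := kk j; rewrite mxE.
Qed.

Theorem theorem4p2 (R : realType) (n : nat)
    (I : weyl n R[i] -> Prop) (I_ideal : left_ideal I) (I_hol : holonomic I)
    (w : 'I_n -> R) (w_gt0 : forall i, 0 < w i)
    (d : nat) (F : shifted_free n R[i]) (F_adapted : adapted_resolution w I F)
    (b : {poly R[i]}) (b_bfun : is_bfunction w I b)
    (k1 : int) (k1_max : max_integral_root b k1)
    (* automatic for integral weights, see [integral_weight_degrees] *)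
    (k1_deg : forall kl : 'X_{1..n} * 'I_(rk F d),
       root b (ideg w (sh F d) kl)%:C%C -> ideg w (sh F d) kl <= k1%:~R) :
  let A := psi F d.+1 in let B := psi F d in
  let s := sh F d.+1 in let t := sh F d in let u := @sh_pred _ _ F d in
  forall (e : nat) (c : 'I_e -> ivec R n (rk F d)),
    basis_mod (trunc_ker w k1 A t s) (trunc_im w k1 B u t) c ->
  forall cinf : 'I_e -> ivec R n (rk F d),
    (forall i, trunc w k1 t (cinf i) = c i /\
       forall m : int, k1 <= m -> trunc_ker w m A t s (trunc w m t (cinf i))) ->
  [/\ analytic_resolution I F,
      basis_mod (fun f : 'I_(rk F d) -> fseries n R[i] => wmat_act A f = 0)
        (fun f => exists g, f = wmat_act B g) (fun i => sigma (cinf i)) &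
      d = 0%N ->
      basis_mod (fun f : 'I_(rk F d) -> fseries n R[i] =>
          forall l j, I l -> wact l (f j) = 0)
        (fun f => f = 0) (fun i => sigma (cinf i))].
Proof.
move=> A B s t u e c c_basis cinf ext.
have basis := truncated_basis w_gt0 F_adapted b_bfun k1_deg c_basis ext.
split=> [||d0]; [exact: adapted_analytic F_adapted|exact: basis|].
subst d; case: basis => sol free span; split=> [i|a a0|f fI].
- exact/(classical_solutions _ I_ideal F_adapted)/sol.
- by apply: free; exists 0; rewrite a0 raddf0.
have [|a [g gE]] := span f; first exact/(classical_solutions _ I_ideal F_adapted).
exists a; rewrite gE; apply: funext => j; apply: big1 => -[] //.
Qed.
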